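(* Let $p$ be a prime, $q=p^m$, let $r\ge 2$, and let $L\subseteq \mathbf{F}_q$ be an $r$-dimensional $\mathbf{F}_p$-linear subspace. Put $R(x)=\prod_{c\in L}(x-c)\in\mathbf{F}_q[x]$ (a $p$-linearized polynomial of degree $p^r$). Let $R=R_1+R_2$ where $$R_1(x)=\sum_{i=s}^{r} b_i x^{p^i}\in\mathbf{F}_q[x],\qquad R_2(x)=\sum_{i=0}^{t} c_i x^{p^i}\in\mathbf{F}_q[x],$$ with $0<s<r$, $0\le t\le s$, $b_sb_r\neq 0$ and $c_0c_t\neq 0$. Let $L_1$ and $L_2$ be the zero sets of $R_1$ and $R_2$ in $\overline{\mathbf{F}}_q$ (so $\#L_1=p^{r-s}$, $\#L_2=p^t$), assume $L_1\neq L_2$, and put $\delta=\#(L_1\cap L_2)$. Then the Kummer cover $C$ of $\mathbf{P}^1$ over $\mathbf{F}_q$ defined by the equation $$y^{q-1}=f(x),\qquad f(x)=-\frac{R_1(x)}{R_2(x)},$$ has genus $$g(C)=\frac{1}{2}\Big\{(p^{r-s}+p^t-\delta-1)(q-2)-\delta\, p^{\gcd(m,s)}-p^{\gcd(m,r-t)}+2\delta+2\Big\}$$ and the number of $\mathbf{F}_q$-rational points on $C$ satisfies $$\#C(\mathbf{F}_q)\ \geq\ (p^r-\delta)(q-1).$$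
   Context: $\mathbf{F}_q$ is the finite field with $q=p^m$ elements and $\overline{\mathbf{F}}_q$ an algebraic closure. The curve ''defined by'' an affine equation $y^{q-1}=f(x)$ means the non-singular complete irreducible curve over $\mathbf{F}_q$ with function field $\mathbf{F}_q(x,y)$, $y^{q-1}=f(x)$; it is a cyclic (Kummer) cover of $\mathbf{P}^1$ of degree $q-1$ via $x$. *)

(* Defs.v *)
From HB Require Import structures.
From mathcomp Require Import all_boot all_order all_algebra all_field.
From mathcomp Require Import finmap.
From mathcomp Require Import boolp classical_sets cardinality.

Set Implicit Arguments.
Unset Strict Implicit.
Unset Printing Implicit Defensive.

Import Order.TTheory GRing.Theory Num.Theory.
Local Open Scope ring_scope.

(* A function field of one variable over F is a finite extension E of F(x).   *)
(* Its non-singular complete model is the set of its places, each of which is *)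
(* given by its normalised discrete valuation, trivial on F.                  *)
Section FunctionField.

Variables (F : fieldType) (E : fieldExtType {fraction {poly F}}).

Definition constE (a : F) : E := (tofrac a%:P)%:A.

(* The true value at 0 is +oo; fixing a value there makes two places with the *)
(* same valuation on nonzero elements equal, so that places can be counted.   *)
Record is_valuation (v : E -> int) : Prop := IsValuation {
  val0 : v 0 = 0;
  valM : forall a b, a != 0 -> b != 0 -> v (a * b) = v a + v b;
  valD : forall a b, a != 0 -> b != 0 -> a + b != 0 ->
           Num.min (v a) (v b) <= v (a + b);
  val_const : forall a, a != 0 -> v (constE a) = 0;
  val_normalised : exists2 a, a != 0 & v a = 1
}.

Record place : Type := Place {
  ord : E -> int;
  ord_is_valuation : is_valuation ord
}.

HB.instance Definition _ := gen_eqMixin place.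
HB.instance Definition _ := gen_choiceMixin place.

(* For F-subspaces W <= V of E: the classes of some n elements of V form an   *)
(* F-basis of V / W.                                                          *)
Definition has_reldim (V W : set E) (n : nat) : Prop :=
  exists e : 'I_n -> E, (forall i, V (e i)) /\
    forall z, V z ->
      exists! a : 'rV[F]_n, W (z - \sum_(i < n) constE (a 0 i) * e i).

(* dim_F (V / W), set to 0 when it is infinite. *)
Definition reldim (V W : set E) : nat := xget 0%N (has_reldim V W).

Definition valuation_ring (P : place) : set E :=
  fun z => z = 0 \/ 0 <= ord P z.

Definition maximal_ideal (P : place) : set E :=
  fun z => z = 0 \/ 0 < ord P z.

Definition place_degree (P : place) : nat :=
  reldim (valuation_ring P) (maximal_ideal P).

Definition divisor := {fsfun place -> int with 0}.

Definition degree (D : divisor) : int :=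
  \sum_(P <- finsupp D) D P * (place_degree P)%:Z.

Definition riemann_roch_space (D : divisor) : set E :=
  fun z => z = 0 \/ forall P, - D P <= ord P z.

Definition ell (D : divisor) : nat :=
  reldim (riemann_roch_space D) (fun z => z = 0).

(* Riemann's definition: the genus is the maximum of deg D - l(D) + 1 over    *)
(* all divisors D (E being regarded as having F as its field of constants).   *)
Definition is_genus (g : nat) : Prop :=
  (forall D : divisor, degree D - (ell D)%:Z + 1 <= g%:Z) /\
  (exists D : divisor, degree D - (ell D)%:Z + 1 = g%:Z).

(* The F-rational points of the curve are the places of degree one.           *)
Definition rational_points : set place := fun P => place_degree P = 1%N.

End FunctionField.

(* Main.v *)
Require Import Defs.
From HB Require Import structures.
From mathcomp Require Import all_boot all_order all_algebra all_field.
From mathcomp Require Import fingroup cyclic generic_quotient.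
From mathcomp Require Import finmap.
From mathcomp Require Import boolp classical_sets cardinality.
From mathcomp Require Import zify ring lra.

(* Writing R_1 = S_1^(p^s) with S_1 separable, and dividing S_1 and R_2 by     *)
(* their gcd, f becomes - G^(p^s - 1) U_1^(p^s) / U_2 with G, U_1, U_2         *)
(* separable, pairwise coprime, and deg G = delta. As L_1 != L_2, one of U_1,  *)
(* U_2 has a zero, above which the extension of degree n = q - 1 is totally    *)
(* ramified, so 1, y, ..., y^(n-1) is a basis of E over F(x).                  *)
(* Since F contains the n-th roots of unity, the automorphisms y |-> z y split *)
(* L(k (x)_oo) into eigenspaces y^j F(x), in each of which the valuations of   *)
(* y^j turn membership into a bound on the degree of a polynomial. This gives  *)
(* l(k (x)_oo) = k n - g + 1 for large k, where summing floors produces the    *)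
(* gcds in g. Every divisor D is dominated by k (x)_oo up to a principal       *)
(* divisor, so Riemann's inequality for D follows from that for k (x)_oo.      *)
(* The ingredients are the existence of places above given ones (a maximal     *)
(* subring of Chevalley is a valuation ring), and the bound of the degree of   *)
(* a zero divisor by the degree of the extension (weak approximation).         *)
(* If u is in L but not in L_2, then f(u) = 1 by R_1 + R_2 = R, so y^n = 1 at  *)
(* every place above x = u, which hence splits into n rational places: one for *)
(* each nonzero residue of y.                                                  *)

Set Implicit Arguments.
Unset Strict Implicit.
Unset Printing Implicit Defensive.

Import Order.TTheory GRing.Theory Num.Theory.
Local Open Scope ring_scope.

(** The theorem is one instance of a statement about a Kummer equation y^n = c prod_i g_i^(a_i), n =
    q - 1, in which prod_i g_i is separable and some nonconstant g_i has exponent prime to n. With f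
    the right-hand side, [kummer_genus] gives 2g = 2 - n - gcd(deg f, n) + sum_i deg g_i (n -
    gcd(a_i, n)), the value that Riemann-Hurwitz predicts: the gcds count the geometric places above
    infinity and above a zero of g_i. Here the factors are G, U_1, U_2 with exponents p^s - 1, p^s,
    -1. Powers of p are prime to q - 1, and [gcdn_expn_pred] yields the terms p^gcd(m,s) and
    p^gcd(m,r-t).

    The genus is a maximum over all divisors, so its value needs a bound for every divisor and a
    divisor attaining it. [is_genus_of_pole_spaces] obtains both from the dimensions of L(k (x)_oo)
    for large k, and [kummer_pole_dim] computes these. Averaging over the automorphisms y |-> z y
    ([conj_average]) splits the space into components b y^j with b in F(x), where membership says
    that b times an explicit product is a polynomial of bounded degree. [floor_sum] turns the sum of
    the bounds into gcds.

    The geometry is carried by [zero_degree_le]: the zeros of A/B, counted with multiplicity and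
    degree, amount to at most [E : F(x)] max(deg A, deg B). It compares the dimension of a quotient
    of a semilocal ring, given by weak approximation ([semilocal_reldim]), with a count of monomials
    ([dependent_powers]). It makes degrees of places finite, bounds the degree of principal
    divisors, and gives rationality: where f(u) = 1 the automorphisms produce n distinct places
    above x = u, and the bound n leaves degree one to each ([kummer_split]). At least p^r - delta
    elements u of L are of this kind. *)

(** * Embedding F and F[x] into the function field *)

Section Embeddings.

Variables (F : fieldType) (E : fieldExtType {fraction {poly F}}).

Definition polyE (h : {poly F}) : E := (tofrac h)%:A.

Lemma polyE_is_zmod_morphism : zmod_morphism polyE.
Proof. by move=> g h; rewrite /polyE tofracB scalerBl. Qed.

Lemma polyE_is_monoid_morphism : monoid_morphism polyE.
Proof.
split; first by rewrite /polyE tofrac1 scale1r.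
by move=> g h; rewrite /polyE tofracM -scalerAl mul1r scalerA.
Qed.

HB.instance Definition _ :=
  GRing.isZmodMorphism.Build {poly F} E polyE polyE_is_zmod_morphism.
HB.instance Definition _ :=
  GRing.isMonoidMorphism.Build {poly F} E polyE polyE_is_monoid_morphism.

Lemma constE_is_zmod_morphism : zmod_morphism (@constE F E).
Proof. by move=> a b; rewrite /constE polyCB tofracB scalerBl. Qed.

Lemma constE_is_monoid_morphism : monoid_morphism (@constE F E).
Proof.
split; first by rewrite /constE polyC1 tofrac1 scale1r.
by move=> a b; rewrite /constE polyCM tofracM -scalerAl mul1r scalerA.
Qed.

HB.instance Definition _ :=
  GRing.isZmodMorphism.Build F E (@constE F E) constE_is_zmod_morphism.
HB.instance Definition _ :=
  GRing.isMonoidMorphism.Build F E (@constE F E) constE_is_monoid_morphism.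

Lemma polyEC a : polyE a%:P = constE E a. Proof. by []. Qed.

Lemma polyE_eq0 h : (polyE h == 0) = (h == 0).
Proof. by rewrite /polyE scaler_eq0 oner_eq0 orbF tofrac_eq0. Qed.

Lemma fraction_numden (R : idomainType) (a : {fraction R}) :
  exists g h : R, h != 0 /\ a = tofrac g / tofrac h.
Proof.
elim/quotW: a => x; exists \n_x, \d_x; have d0 := denom_ratioP x; split=> //.
apply: (canRL (mulfK _)); first by rewrite tofrac_eq0.
rewrite -[LHS]/(FracField.mul _ _) !piE /FracField.mulf.
by rewrite !numden_Ratio ?oner_eq0 // mulr1 /=; apply/eqP;
  rewrite piE /FracField.equivf /= !numden_Ratio ?oner_eq0 // mulr1 mulrC.
Qed.

Lemma fraction_polyE (a : {fraction {poly F}}) :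
  exists g h : {poly F}, [/\ h != 0, coprimep g h & a%:A = polyE g / polyE h].
Proof.
have [g [h [h0 ->]]] := fraction_numden a.
have d0 : gcdp g h != 0 by rewrite gcdp_eq0 negb_and h0 orbT.
exists (g %/ gcdp g h), (h %/ gcdp g h); split.
- by rewrite dvdp_div_eq0 ?dvdp_gcdr.
- by rewrite coprimep_div_gcd // h0 orbT.
have dE : polyE (gcdp g h) != 0 by rewrite polyE_eq0.
have hE : polyE h != 0 by rewrite polyE_eq0.
have -> : (tofrac g / tofrac h)%:A = polyE g / polyE h.
  by rewrite -in_algE rmorphM fmorphV.
have hd0 : polyE (h %/ gcdp g h) != 0.
  by rewrite polyE_eq0 dvdp_div_eq0 ?dvdp_gcdr.
apply/eqP; rewrite eqr_div // -!rmorphM; apply/eqP; congr polyE.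
rewrite -{1}(divpK (dvdp_gcdl g h)) -mulrA; congr (_ * _).
by rewrite mulrC divpK ?dvdp_gcdr.
Qed.

End Embeddings.

(** * Linear algebra modulo a subspace *)

Section RelativeDimension.

Variables (F : fieldType) (E : fieldExtType {fraction {poly F}}).
Implicit Types U V W : set E.

Record subspace V : Prop := Subspace {
  subspace0 : V 0;
  subspaceD : forall u v, V u -> V v -> V (u + v);
  subspaceZ : forall a u, V u -> V (constE E a * u)
}.

(** Families are indexed by any finite type, as the bases built later are indexed by sums, pairs and
    tagged unions. *)
Definition lcomb (I : finType) (a : I -> F) (e : I -> E) : E :=
  \sum_i constE E (a i) * e i.

Definition free_mod W (I : finType) (e : I -> E) :=
  forall a : I -> F, W (lcomb a e) -> forall i, a i = 0.

Record basis_mod V W (I : finType) (e : I -> E) : Prop := BasisMod {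
  basis_in : forall i, V (e i);
  basis_free : free_mod W e;
  basis_span : forall z, V z -> exists a : I -> F, W (z - lcomb a e)
}.

Lemma subspaceN V u : subspace V -> V u -> V (- u).
Proof. by move=> sV Vu; rewrite -mulN1r -(rmorphN1 (constE E)); exact: subspaceZ. Qed.

Lemma subspaceB V u v : subspace V -> V u -> V v -> V (u - v).
Proof. by move=> sV Vu Vv; apply: subspaceD => //; exact: subspaceN. Qed.

Lemma subspace_sum V (I : Type) (r : seq I) (P : pred I) (f : I -> E) :
  subspace V -> (forall i, P i -> V (f i)) -> V (\sum_(i <- r | P i) f i).
Proof. by move=> sV Vf; elim/big_ind: _ => //; [exact: subspace0 | exact: subspaceD]. Qed.

Lemma subspace_lcomb V (I : finType) a (e : I -> E) :
  subspace V -> (forall i, V (e i)) -> V (lcomb a e).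
Proof. by move=> sV Ve; apply: subspace_sum => // i _; apply: subspaceZ. Qed.

Lemma lcombB (I : finType) a b (e : I -> E) :
  lcomb (fun i => a i - b i) e = lcomb a e - lcomb b e.
Proof.
by rewrite /lcomb -sumrB; apply: eq_bigr => i _; rewrite rmorphB mulrBl.
Qed.

Lemma lcomb_reindex (I J : finType) (h : J -> I) a (e : I -> E) :
  bijective h -> lcomb (a \o h) (e \o h) = lcomb a e.
Proof. by case=> g hg gh; rewrite /lcomb (reindex h) //; exists g => ? _. Qed.

Lemma basis_reindex V W (I J : finType) (h : J -> I) (e : I -> E) :
  bijective h -> basis_mod V W e -> basis_mod V W (e \o h).
Proof.
move=> bij_h [Ve fe se]; have [g hg gh] := bij_h; split => /=.
- by move=> j; apply: Ve.
- move=> a Wa j; rewrite -(hg j); apply: (fe (a \o g)).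
  rewrite -(lcomb_reindex _ _ bij_h); move: Wa; congr (W (lcomb _ _)).
  by apply: funext => i /=; rewrite hg.
by move=> z /se[a Wa]; exists (a \o h); rewrite lcomb_reindex.
Qed.

Lemma has_reldimP V W n : subspace V -> subspace W ->
  has_reldim V W n <-> exists e : 'I_n -> E, basis_mod V W e.
Proof.
move=> sV sW; split=> [[e [Ve eP]] | [e [Ve fe se]]]; exists e; split=> //.
- move=> a Wa i; have [b [_ b_uniq]] := eP 0 (subspace0 sV).
  have b0 : b = 0.
    apply: b_uniq; rewrite big1 ?subr0 => [|j _]; first exact: subspace0.
    by rewrite mxE rmorph0 mul0r.
  have ba : b = \row_j a j.
    apply: b_uniq; rewrite sub0r; apply: subspaceN => //.
    by move: Wa; congr W; apply: eq_bigr => j _; rewrite mxE.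
  by have /rowP/(_ i) := etrans (esym ba) b0; rewrite !mxE.
- by move=> z /eP[a [Wa _]]; exists (a 0).
move=> z /se[a Wa]; exists (\row_i a i); split.
  by move: Wa; congr (W (_ - _)); apply: eq_bigr => i _; rewrite mxE.
move=> b Wb; apply/rowP => i; rewrite mxE; apply/eqP; rewrite -subr_eq0.
apply/eqP; move: i; apply: fe; rewrite lcombB.
rewrite [X in W X](_ : _ = (z - lcomb (b 0) e) - (z - lcomb a e)); last by ring.
exact: subspaceB.
Qed.

Lemma basis_has_reldim V W (I : finType) (e : I -> E) :
  subspace V -> subspace W -> basis_mod V W e -> has_reldim V W #|I|.
Proof.
move=> sV sW be; apply/(has_reldimP _ sV sW).
by exists (e \o enum_val); apply: basis_reindex (enum_val_bij I) be.
Qed.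

(** The exchange inequality: if [J] were larger than [I], the matrix of coefficients would kill a
    nonzero row vector, and this vector would be a relation among the [f j] modulo [W]. *)
Lemma free_mod_card W (I J : finType) (e : I -> E) (f : J -> E) :
    subspace W -> (forall j, exists a : I -> F, W (f j - lcomb a e)) ->
  free_mod W f -> (#|J| <= #|I|)%N.
Proof.
move=> sW /choice[c cP] ff; rewrite leqNgt; apply/negP => ltIJ.
pose M := \matrix_(j < #|J|, i < #|I|) c (enum_val j) (enum_val i).
have : kermx M != 0.
  rewrite -mxrank_eq0 mxrank_ker subn_eq0 -ltnNge.
  exact: leq_ltn_trans (rank_leq_col M) ltIJ.
case/rowV0Pn => v /sub_kermxP vM /negP[]; apply/eqP/rowP => j; rewrite [RHS]mxE.
rewrite -(enum_valK j); apply: (ff (fun j => v 0 (enum_rank j))).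
rewrite [X in W X](_ : _ =
  \sum_j constE E (v 0 (enum_rank j)) * (f j - lcomb (c j) e)).
  by apply: subspace_sum => // i _; apply: subspaceZ.
under [RHS]eq_bigr do rewrite mulrBr.
rewrite sumrB [X in _ - X](_ : _ = 0) ?subr0 // /lcomb.
under eq_bigr do rewrite mulr_sumr.
rewrite exchange_big big1 //= => i _.
under eq_bigr do rewrite mulrA -rmorphM.
rewrite -mulr_suml -rmorph_sum /=.
suff -> : \sum_j v 0 (enum_rank j) * c j i = 0 by rewrite rmorph0 mul0r.
have /rowP/(_ (enum_rank i)) := vM; rewrite !mxE => vMi; rewrite -[RHS]vMi.
rewrite [RHS](reindex enum_rank) /=; last exact: onW_bij (enum_rank_bij J).
by apply: eq_bigr => k _; rewrite [in RHS]mxE !enum_rankK.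
Qed.

Lemma has_reldim_free V W n (J : finType) (f : J -> E) :
    subspace V -> subspace W -> has_reldim V W n ->
  (forall j, V (f j)) -> free_mod W f -> (#|J| <= n)%N.
Proof.
move=> sV sW /(has_reldimP _ sV sW)[e [_ _ se]] Vf ff.
by have := free_mod_card sW (fun j => se _ (Vf j)) ff; rewrite card_ord.
Qed.

Lemma has_reldim_uniq V W m n : subspace V -> subspace W ->
  has_reldim V W m -> has_reldim V W n -> m = n.
Proof.
move=> sV sW Vm Vn; apply/eqP; rewrite eqn_leq.
have [[e [Ve fe _]] [f [Vf ff _]]] :=
  ((has_reldimP _ sV sW).1 Vm, (has_reldimP _ sV sW).1 Vn).
have := has_reldim_free sV sW Vn Ve fe; have := has_reldim_free sV sW Vm Vf ff.
by rewrite !card_ord => -> ->.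
Qed.

Lemma reldimE V W n : subspace V -> subspace W ->
  has_reldim V W n -> reldim V W = n.
Proof.
move=> sV sW Vn; apply: has_reldim_uniq (sV) (sW) _ (Vn).
exact: xgetPex (ex_intro _ n Vn).
Qed.

(** A free family of largest size spans: any further [z] makes it dependent, and the coefficient of
    [z] in the relation cannot vanish. *)
Lemma bounded_has_reldim V W N : subspace V -> subspace W ->
    (forall n (e : 'I_n -> E), (forall i, V (e i)) -> free_mod W e -> (n <= N)%N) ->
  exists2 n, (n <= N)%N & has_reldim V W n.
Proof.
move=> sV sW bound.
pose P n := `[< exists2 e : 'I_n -> E, forall i, V (e i) & free_mod W e >].
have P0 : exists n, P n.
  by exists 0%N; apply/asboolP; exists (fun=> 0) => [[]|a _ []].
have PN n : P n -> (n <= N)%N by move=> /asboolP[e Ve fe]; apply: bound Ve fe.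
have [n /asboolP[e Ve fe] n_max] := ex_maxnP P0 PN.
exists n; first exact: bound Ve fe.
apply/has_reldimP => //; exists e; split=> // z Vz.
pose f i := if unlift ord0 i is Some j then e j else z : E.
have Vf i : V (f i) by rewrite /f; case: unliftP.
have /existsNP[a] : ~ free_mod W f.
  move=> ff; suff /n_max : P n.+1 by rewrite ltnn.
  by apply/asboolP; exists f.
move=> /not_implyP[Wa] /existsNP[i ai].
have aE : lcomb a f = constE E (a ord0) * z + lcomb (a \o lift ord0) e.
  rewrite /lcomb big_ord_recl {1}/f unlift_none; congr (_ + _).
  by apply: eq_bigr => j _; rewrite /f liftK.
have a0 : a ord0 != 0.
  apply: contra_notN ai => /eqP a0; case: (unliftP ord0 i) => [j|] -> //.
  apply: (fe (a \o lift ord0)).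
  by move: Wa; rewrite aE a0 rmorph0 mul0r add0r.
exists (fun j => - (a ord0)^-1 * a (lift ord0 j)).
have := subspaceZ sW (a ord0)^-1 Wa; congr W.
rewrite aE mulrDr mulrA -rmorphM mulVf // rmorph1 mul1r; congr (_ + _).
rewrite /lcomb mulr_sumr -sumrN; apply: eq_bigr => j _.
by rewrite mulrA -rmorphM mulNr rmorphN mulNr opprK.
Qed.

Lemma has_reldim_add U V W m n :
    subspace U -> subspace V -> subspace W -> (V `<=` U)%classic -> (W `<=` V)%classic ->
  has_reldim U V m -> has_reldim V W n -> has_reldim U W (m + n).
Proof.
move=> sU sV sW VU WV /(has_reldimP _ sU sV)[e [Ue fe se]].
move=> /(has_reldimP _ sV sW)[f [Vf ff sf]].
rewrite -[m]card_ord -[n]card_ord -card_sum.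
pose g (i : 'I_m + 'I_n) := match i with inl i => e i | inr j => f j end.
have gE a : lcomb a g = lcomb (a \o inl) e + lcomb (a \o inr) f.
  by rewrite /lcomb big_sumType.
apply: (@basis_has_reldim _ _ _ g) => //; split.
- by case=> [i|j] /=; [apply: Ue | apply/VU/Vf].
- move=> a; rewrite gE => Wa.
  have a1 : forall i, a (inl i) = 0.
    apply: (fe (a \o inl)); rewrite -[lcomb _ e](addrK (lcomb (a \o inr) f)).
    by apply: subspaceB; [|exact: WV|exact: subspace_lcomb].
  have a2 : forall j, a (inr j) = 0.
    apply: (ff (a \o inr)); move: Wa; rewrite [lcomb _ e]big1 ?add0r // => i _ /=.
    by rewrite a1 rmorph0 mul0r.
  by case.
move=> z /se[a /sf[b Wb]].
exists (fun i => match i with inl i => a i | inr j => b j end).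
by rewrite gE opprD addrA.
Qed.

(** Multiplication by [c] induces an isomorphism of V'/W' onto V/W; the conditions on [c] say that
    it is well defined, injective and surjective. *)
Lemma has_reldim_iso V W V' W' (c : E) n :
    subspace V -> subspace W -> subspace V' -> subspace W' ->
    (forall z, V' z -> V (c * z)) -> (forall z, V' z -> W (c * z) <-> W' z) ->
    (forall v, V v -> exists2 z, V' z & W (v - c * z)) ->
  has_reldim V W n -> has_reldim V' W' n.
Proof.
move=> sV sW sV' sW' cV cW cS /(has_reldimP _ sV sW)[e [Ve fe se]].
apply/has_reldimP => //; have [f fP] := choice (fun i =>
  let: ex_intro2 z V'z Wz := cS _ (Ve i) in ex_intro _ z (conj V'z Wz)).
have V'f i : V' (f i) by have [] := fP i.
have Wef a : W (lcomb a e - c * lcomb a f).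
  rewrite /lcomb mulr_sumr -sumrB; apply: subspace_sum => // i _.
  by rewrite mulrCA -mulrBr; apply: subspaceZ => //; have [] := fP i.
exists f; split=> // [a W'a|z V'z].
  apply: fe; rewrite -[lcomb a e](subrK (c * lcomb a f)); apply: subspaceD => //.
  by apply/cW => //; apply: subspace_lcomb.
have [a Wa] := se _ (cV _ V'z); exists a; apply/cW.
  by apply: subspaceB => //; apply: subspace_lcomb.
rewrite mulrBr -[c * z](subrK (lcomb a e)) -addrA.
exact: subspaceD.
Qed.

End RelativeDimension.

(** * Valuations *)

Section Valuations.

Variables (F : fieldType) (E : fieldExtType {fraction {poly F}}).
Implicit Types (P : place E) (u z : E).

(** The conventional [ord P 0 = 0] hides the infinite order of 0; admitting 0 separately makes these
    sets subspaces. *)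
Definition vge P (i : int) z := z = 0 \/ i <= ord P z.

Lemma place_inj P Q : ord P = ord Q -> P = Q.
Proof.
case: P Q => v vP [w wP] /= vw; rewrite vw in vP *.
by congr Place; apply: Prop_irrelevance.
Qed.

Lemma ordM P u z : u != 0 -> z != 0 -> ord P (u * z) = ord P u + ord P z.
Proof. exact: (Defs.valM (ord_is_valuation P)). Qed.

Lemma ord_constE P a : ord P (constE E a) = 0.
Proof.
have [->|a0] := eqVneq a 0; last exact: (Defs.val_const (ord_is_valuation P)).
by rewrite rmorph0 (Defs.val0 (ord_is_valuation P)).
Qed.

Lemma ord1 P : ord P 1 = 0.
Proof. by rewrite -(rmorph1 (constE E)) ord_constE. Qed.

Lemma ordN P z : ord P (- z) = ord P z.
Proof.
have [->|z0] := eqVneq z 0; first by rewrite oppr0.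
by rewrite -mulN1r -(rmorphN1 (constE E)) ordM ?ord_constE ?add0r // rmorphN1 oppr_eq0 oner_eq0.
Qed.

Lemma ordX P z n : z != 0 -> ord P (z ^+ n) = n%:Z * ord P z.
Proof.
move=> z0; elim: n => [|n IHn]; first by rewrite expr0 ord1 mul0r.
by rewrite exprS ordM ?expf_neq0 // IHn -add1n PoszD mulrDl mul1r.
Qed.

Lemma ordV P z : ord P z^-1 = - ord P z.
Proof.
have [->|z0] := eqVneq z 0; first by rewrite invr0 (Defs.val0 (ord_is_valuation P)).
by apply: (addrI (ord P z)); rewrite subrr -ordM ?invr_eq0 // divff ?ord1.
Qed.

Lemma ordF P u z : u != 0 -> z != 0 -> ord P (u / z) = ord P u - ord P z.
Proof. by move=> u0 z0; rewrite ordM ?invr_eq0 // ordV. Qed.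

Lemma ordXz P z (i : int) : z != 0 -> ord P (z ^ i) = i * ord P z.
Proof.
move=> z0; case: i => n; first exact: ordX.
by rewrite NegzE -exprnN ordV ordX // mulNr.
Qed.

Lemma ord_prod P (I : Type) (r : seq I) (Q : pred I) (f : I -> E) :
  (forall i, Q i -> f i != 0) ->
  ord P (\prod_(i <- r | Q i) f i) = \sum_(i <- r | Q i) ord P (f i).
Proof.
move=> f0; elim: r => [|i r IHr]; first by rewrite !big_nil ord1.
rewrite !big_cons; case: ifP => // Qi; rewrite ordM ?f0 ?IHr //.
by elim/big_rec: _ => [|j z Qj z0]; rewrite ?oner_eq0 // mulf_neq0 ?f0.
Qed.

Lemma vgeP P i z : z != 0 -> vge P i z <-> i <= ord P z.
Proof. by move=> z0; split=> [[zz|]|]; [rewrite zz eqxx in z0| |right]. Qed.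

Lemma vge_le P i j z : i <= j -> vge P j z -> vge P i z.
Proof. by move=> ij [->|jz]; [left|right; apply: le_trans jz]. Qed.

Lemma vge_ord P z : vge P (ord P z) z. Proof. by right. Qed.

Lemma vge_const P a : vge P 0 (constE E a).
Proof. by right; rewrite ord_constE. Qed.

Lemma vge1 P : vge P 0 1. Proof. by right; rewrite ord1. Qed.

Lemma vge1_1 P : ~ vge P 1 1.
Proof. by rewrite vgeP ?oner_eq0 // ord1. Qed.

Lemma vgeD P i u z : vge P i u -> vge P i z -> vge P i (u + z).
Proof.
have [->|u0] := eqVneq u 0; first by rewrite add0r.
have [->|z0] := eqVneq z 0; first by rewrite addr0.
have [->|s0] := eqVneq (u + z) 0; first by left.
rewrite !vgeP // => iu iz.
by apply: le_trans (Defs.valD (ord_is_valuation P) u0 z0 s0); rewrite le_min iu.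
Qed.

Lemma vgeM P i j u z : vge P i u -> vge P j z -> vge P (i + j) (u * z).
Proof.
have [->|u0] := eqVneq u 0; first by rewrite mul0r; left.
have [->|z0] := eqVneq z 0; first by rewrite mulr0; left.
by rewrite !vgeP ?mulf_neq0 // ordM //; lia.
Qed.

Lemma vgeN P i z : vge P i z -> vge P i (- z).
Proof. by case=> [->|iz]; [left; rewrite oppr0 | right; rewrite ordN]. Qed.

Lemma vgeB P i u z : vge P i u -> vge P i z -> vge P i (u - z).
Proof. by move=> Pu Pz; apply/vgeD/vgeN. Qed.

Lemma vgeX P i z n : vge P i z -> vge P (n%:Z * i) (z ^+ n).
Proof.
move=> Pz; elim: n => [|n IHn]; first by rewrite mul0r expr0; apply: vge1.
by rewrite exprS -add1n PoszD mulrDl mul1r; apply: vgeM.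
Qed.

Lemma vge_sum P i (I : Type) (r : seq I) (Q : pred I) (f : I -> E) :
  (forall j, Q j -> vge P i (f j)) -> vge P i (\sum_(j <- r | Q j) f j).
Proof. by move=> Pf; elim/big_ind: _ => //; [left | move=> u z; apply: vgeD]. Qed.

Lemma subspace_vge P i : subspace (vge P i).
Proof.
split=> [|u z|a z Pz]; [by left|exact: vgeD|].
by rewrite -[i]add0r; apply: vgeM => //; apply: vge_const.
Qed.

Lemma maximal_idealE P : maximal_ideal P = vge P 1.
Proof. by apply: funext => z; rewrite /maximal_ideal /vge gtz0_ge1. Qed.

Lemma ordD P u z : u != 0 -> vge P (ord P u + 1) z ->
  u + z != 0 /\ ord P (u + z) = ord P u.
Proof.
move=> u0 Pz; have uz0 : u + z != 0.
  apply/eqP => /(canRL (addrK _)); rewrite sub0r => uz.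
  by move: Pz; rewrite -[z]opprK -uz vgeP ?oppr_eq0 // ordN; lia.
split=> //; apply/eqP; rewrite eq_le; apply/andP; split.
  rewrite leNgt -lezD1; apply/negP => lt_uz.
  have : vge P (ord P u + 1) (u + z - z) by apply: vgeB => //; right.
  by rewrite addrK vgeP // lezD1 ltxx.
apply/vgeP => //; apply: vgeD; first exact: vge_ord.
by apply: vge_le Pz; lia.
Qed.

(** The nonzero term of least order, if there were one, would dominate the others and the sum could
    not vanish. *)
Lemma ord_distinct_sum P (I : finType) (f : I -> E) :
    {in [pred i | f i != 0] &, injective (ord P \o f)} ->
  \sum_i f i = 0 -> forall i, f i = 0.
Proof.
move=> inj_f f0 i; apply/eqP/negP => /negP fi.
case: (@arg_minP _ _ _ i (fun i => f i != 0) (ord P \o f) fi) => j fj j_min.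
have : vge P (ord P (f j) + 1) (\sum_(k | k != j) f k).
  apply: vge_sum => k kj; have [->|fk] := eqVneq (f k) 0; first by left.
  right; rewrite lezD1 lt_neqAle j_min // andbT.
  by apply: contra kj => /eqP/inj_f->.
by case/(ordD fj); move: f0; rewrite (bigD1 j) //= => ->; rewrite eqxx.
Qed.

Lemma polyE_Horner h : polyE E h = \sum_(i < size h) constE E h`_i * polyE E 'X ^+ i.
Proof.
rewrite -[h in LHS]coefK poly_def rmorph_sum; apply: eq_bigr => i _.
by rewrite -mul_polyC rmorphM rmorphXn.
Qed.

Lemma vge_polyE P h : 0 <= ord P (polyE E 'X) -> vge P 0 (polyE E h).
Proof.
move=> x_ge0; rewrite polyE_Horner; apply: vge_sum => i _.
rewrite -[0]addr0; apply: vgeM; first exact: vge_const.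
by rewrite -(mulr0 i%:Z); apply: vgeX; right.
Qed.

Lemma ord_polyE_ge0 P h : 0 <= ord P (polyE E 'X) -> 0 <= ord P (polyE E h).
Proof.
by case/(vge_polyE h) => // ->; rewrite (Defs.val0 (ord_is_valuation P)).
Qed.

(** At a pole of x the monomials have distinct orders, and the leading one has the least. *)
Lemma ord_polyE_inf P h : ord P (polyE E 'X) < 0 ->
  ord P (polyE E h) = (size h).-1%:Z * ord P (polyE E 'X).
Proof.
move=> x_lt0; have [->|h0] := eqVneq h 0.
  by rewrite rmorph0 (Defs.val0 (ord_is_valuation P)) size_poly0 mul0r.
have X0 : polyE E 'X != 0 by rewrite polyE_eq0 polyX_eq0.
rewrite polyE_Horner; move: (lead_coef_eq0 h); rewrite (negPf h0) lead_coefE.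
rewrite -(prednK (_ : 0 < size h)%N) ?size_poly_gt0 // => /negbT l0.
set d := (size h).-1 in l0 *; rewrite big_ord_recr /= addrC.
have uE : ord P (constE E h`_d * polyE E 'X ^+ d) = d%:Z * ord P (polyE E 'X).
  by rewrite ordM ?expf_neq0 ?fmorph_eq0 // ord_constE add0r ordX.
rewrite (ordD _ _).2 ?uE //; first by rewrite mulf_neq0 ?expf_neq0 ?fmorph_eq0.
apply: vge_sum => i _; rewrite -[_ + 1]add0r; apply: vgeM.
  exact: vge_const.
by right; rewrite ordX //; have := ltn_ord i; nia.
Qed.

(** The maximal ideal of a valuation ring is prime. *)
Lemma vge1_prod (P : place E) (J : Type) (r : seq J) (f : J -> E) :
  (forall j, vge P 0 (f j)) -> vge P 1 (\prod_(j <- r) f j) -> exists j, vge P 1 (f j).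
Proof.
move=> f0; elim: r => [|j r IHr]; first by rewrite big_nil => /vge1_1.
rewrite big_cons => Pfr; have [fj|nfj] := pselect (vge P 1 (f j)); first by exists j.
apply: IHr; have fj0 : f j != 0 by apply: contra_notN nfj => /eqP ->; left.
have ofj : ord P (f j) = 0.
  have := f0 j; rewrite vgeP // => ge0; apply/eqP; rewrite eq_le ge0 andbT leNgt.
  by apply: contra_notN nfj; rewrite gtz0_ge1; right.
have [r0|r0] := eqVneq (\prod_(j <- r) f j) 0; first by rewrite r0; left.
by move: Pfr; rewrite !vgeP ?mulf_neq0 // ordM // ofj add0r.
Qed.

End Valuations.

(** * Chevalley's extension theorem *)

Section Chevalley.

Variable E : fieldType.
Implicit Types (A B O : set E).

Record is_subring A : Prop := IsSubring {
  subring1 : A 1;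
  subringB : forall u v, A u -> A v -> A (u - v);
  subringM : forall u v, A u -> A v -> A (u * v)
}.

Lemma subring0 A : is_subring A -> A 0.
Proof. by move=> sA; rewrite -(subrr 1); apply: subringB; rewrite //; apply: subring1. Qed.

Lemma subringD A u v : is_subring A -> A u -> A v -> A (u + v).
Proof.
move=> sA Au Av; rewrite -[v]opprK -[- v]sub0r; apply: subringB => //.
by apply: subringB => //; apply: subring0.
Qed.

Lemma subringX A u n : is_subring A -> A u -> A (u ^+ n).
Proof.
by move=> sA Au; elim: n => [|n IHn]; [exact: subring1 | rewrite exprS; apply: subringM].
Qed.

Lemma subring_sum A (I : Type) (r : seq I) (Q : pred I) (f : I -> E) :
  is_subring A -> (forall i, Q i -> A (f i)) -> A (\sum_(i <- r | Q i) f i).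
Proof.
by move=> sA Af; elim/big_ind: _ => //; [exact: subring0 | move=> u v; apply: subringD].
Qed.

Definition adjoin O z : set E :=
  fun u => exists2 p : {poly E}, forall i, O p`_i & u = p.[z].

Lemma adjoin_subring O z : is_subring O -> is_subring (adjoin O z).
Proof.
move=> sO; split.
- exists 1; last by rewrite hornerE.
  by move=> i; rewrite coef1; case: eqP => _; [exact: subring1|exact: subring0].
- move=> _ _ [p Op ->] [q Oq ->]; exists (p - q); last by rewrite hornerD hornerN.
  by move=> i; rewrite coefB; apply: subringB.
move=> _ _ [p Op ->] [q Oq ->]; exists (p * q); last by rewrite hornerM.
by move=> i; rewrite coefM; apply: subring_sum => // j _; apply: subringM.
Qed.

(** Descent on the total size. Exchanging z and z^-1 if necessary, let deg q <= deg p = n. The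
    relation for z^-1, multiplied by z^n, reads (1 - h q_0) z^n = h r(z) with deg r < n; eliminating
    z^n from p(z) = h^-1 with it gives a shorter p. A constant p would put h^-1 in O. *)
Lemma no_double_inverse O h : is_subring O -> O h -> h != 0 -> ~ O h^-1 ->
  forall N (p q : {poly E}) z, (size p + size q <= N)%N -> z != 0 ->
    (forall i, O p`_i) -> (forall i, O q`_i) ->
  p.[z] = h^-1 -> q.[z^-1] = h^-1 -> False.
Proof.
move=> sO Oh h0 Oh1; elim=> [|N IHN] p q z szN z0 Op Oq pz qz.
  have p0 : p = 0 by apply/eqP; rewrite -size_poly_eq0; lia.
  by move: pz; rewrite p0 horner0 => /esym/eqP; rewrite invr_eq0 (negPf h0).
wlog le_qp : p q z z0 Op Oq pz qz szN / (size q <= size p)%N => [W|].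
  case: (leqP (size q) (size p)) => [|/ltnW] le; first exact: W pz qz szN le.
  by apply: (W q p z^-1) => //; rewrite ?invr_eq0 ?invrK // addnC.
have [|p_gt1] := leqP (size p) 1.
  by move=> /size1_polyC pC; apply: Oh1; rewrite -pz pC hornerC.
pose n := (size p).-1; have sz_p : size p = n.+1 by rewrite prednK //; lia.
pose r := \poly_(i < n) q`_(n - i).
have pzE : h^-1 = (take_poly n p).[z] + p`_n * z ^+ n.
  rewrite -pz (@horner_coef_wide _ n.+1 p) ?sz_p // big_ord_recr.
  rewrite (@horner_coef_wide _ n) ?size_take_poly //=; congr (_ + _).
  by apply: eq_bigr => i _; rewrite coef_take_poly ltn_ord.
have qzE : z ^+ n / h = q`_0 * z ^+ n + r.[z].
  rewrite -qz (@horner_coef_wide _ n.+1) -?sz_p // mulr_sumr sz_p.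
  rewrite (reindex_inj rev_ord_inj) big_ord_recr /= subnn addrC; congr (_ + _).
    by rewrite expr0 mulr1 mulrC.
  rewrite horner_poly; apply: eq_bigr => i _.
  rewrite subSS mulrCA; congr (_ * _).
  rewrite -{1}(subnK (ltnW (ltn_ord i))) exprD mulrAC -exprMn divff //.
  by rewrite expr1n mul1r.
pose p' := (q`_0)%:P + (1 - h * q`_0) *: take_poly n p + (p`_n * h) *: r.
apply: (IHN p' q z) => //.
- suff : (size p' <= n)%N by lia.
  rewrite (leq_trans (size_polyD _ _)) // geq_max; apply/andP; split.
    rewrite (leq_trans (size_polyD _ _)) // geq_max; apply/andP; split.
      by rewrite (leq_trans (size_polyC_leq1 _)) //; lia.
    by rewrite (leq_trans (size_scale_leq _ _)) ?size_take_poly.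
  by rewrite (leq_trans (size_scale_leq _ _)) ?size_poly.
- move=> i; rewrite !coefD !coefZ coefC coef_take_poly coef_poly.
  have O0 := subring0 sO; have O1 := subring1 sO.
  apply: subringD => //; first apply: subringD => //.
  + by case: ifP.
  + by apply: subringM; [|apply: subringB; [| |apply: subringM]|case: ifP].
  by apply: subringM; [|apply: subringM|case: ifP].
rewrite !hornerE; have -> : (take_poly n p).[z] = h^-1 - p`_n * z ^+ n.
  by rewrite pzE addrK.
have -> : r.[z] = z ^+ n / h - q`_0 * z ^+ n by rewrite qzE addrC addKr.
by field.
Qed.

(* Chevalley: a maximal subring containing A but not h^-1 is a valuation ring. *)
Lemma exists_valuation_ring A h : is_subring A -> A h -> ~ A h^-1 ->
  exists O, [/\ is_subring O, (A `<=` O)%classic, ~ O h^-1 &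
    forall z, O z \/ O z^-1].
Proof.
move=> sA Ah Ah1.
have h0 : h != 0.
  by apply/eqP => h0; apply: Ah1; rewrite h0 invr0; apply: subring0.
(* Zorn's lemma is applied to the sets to be joined to [A], so that the empty chain corresponds to
   [A] itself. *)
pose ok X := is_subring (A `|` X)%classic /\ ~ (A `|` X)%classic h^-1.
have [F okF totF|X [[sO Oh1] maxX]] := @Zorn_bigcup E ok.
  split; last by move=> [//|[X /okF[_ XP] Xh]]; apply: XP; right.
  have pairs u v : (A `|` \bigcup_(X in F) X)%classic u ->
      (A `|` \bigcup_(X in F) X)%classic v ->
      exists B, [/\ is_subring B, B u, B v &
        (B `<=` A `|` \bigcup_(X in F) X)%classic].
    have sub X : F X -> (A `|` X `<=` A `|` \bigcup_(X in F) X)%classic.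
      by move=> FX w [Aw|Xw]; [left|right; exists X].
    case=> [Au|[X FX Xu]] [Av|[Y FY Yv]].
    - by exists A; split=> // w Aw; left.
    - by exists (A `|` Y)%classic; split; [case: (okF _ FY)|left|right|exact: sub].
    - by exists (A `|` X)%classic; split; [case: (okF _ FX)|right|left|exact: sub].
    case: (totF _ _ FX FY) => [XY|YX].
      exists (A `|` Y)%classic; split; [by case: (okF _ FY)| |by right|exact: sub].
      by right; apply: XY.
    exists (A `|` X)%classic; split; [by case: (okF _ FX)|by right| |exact: sub].
    by right; apply: YX.
  split.
  - by left; apply: subring1.
  - by move=> u v /pairs P /P[B [sB Bu Bv]]; apply; apply: subringB.
  - by move=> u v /pairs P /P[B [sB Bu Bv]]; apply; apply: subringM.
pose O := (A `|` X)%classic; rewrite -/O in sO Oh1.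
(* By maximality, adjoining an element outside [O] captures h^-1. For z and z^-1 both outside, this
   gives the two relations that [no_double_inverse] excludes. *)
have max_adj z : ~ O z -> adjoin O z h^-1.
  move=> Oz; apply: contrapT => Nadj.
  have OB : (O `<=` adjoin O z)%classic.
    move=> u Ou; exists u%:P; last by rewrite hornerC.
    by move=> i; rewrite coefC; case: ifP => // _; apply: subring0.
  apply: (maxX (adjoin O z)); last first.
    rewrite /ok (_ : (A `|` _)%classic = adjoin O z).
      by split=> //; apply: adjoin_subring.
    by apply/seteqP; split=> [w [Aw|//]|w]; [apply: OB; left|right].
  split=> [w Xw|BX]; first by apply: OB; right.
  apply: Oz; right; apply: BX; exists 'X; last by rewrite hornerX.
  by move=> i; rewrite coefX; case: eqP => _; [exact: subring1|exact: subring0].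
exists O; split=> // [u|z]; first by left.
have [Oz|Oz] := EM (O z); [by left|right].
apply: contrapT => Oz1; have z0 : z != 0.
  by apply/eqP => z0; apply: Oz; rewrite z0; apply: subring0.
have [p Op /esym pz] := max_adj _ Oz.
have [q Oq /esym qz] := max_adj _ Oz1.
have Oh : O h by left.
by apply: (no_double_inverse sO Oh h0 Oh1 (leqnn _) z0 Op Oq).
Qed.

End Chevalley.

(** * From a valuation ring to a discrete place *)

Section PlaceOfValuationRing.

Variables (F : fieldType) (E : fieldExtType {fraction {poly F}}).
Implicit Types (u v w z : E).

(** The values of [w] form a nonzero subgroup of the integers, generated by its least positive
    element [g]; dividing by [g] normalises [w]. *)
Lemma normalise_valuation (w : E -> int) :
    (forall u v, u != 0 -> v != 0 -> w (u * v) = w u + w v) ->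
    (forall u v, u != 0 -> v != 0 -> u + v != 0 -> Num.min (w u) (w v) <= w (u + v)) ->
    (forall a, a != 0 -> w (constE E a) = 0) ->
    (exists2 z, z != 0 & 0 < w z) ->
  exists (P : place E) (g : int), 0 < g /\ forall z, z != 0 -> w z = ord P z * g.
Proof.
move=> wM wD wC [z1 z1_0 wz1].
pose pos n := `[< (0 < n)%N /\ exists2 z, z != 0 & w z = n%:Z >].
have : exists n, pos n.
  exists `|w z1|%N; apply/asboolP; split; first by lia.
  by exists z1; rewrite // gez0_abs // ltW.
case/ex_minnP => g /asboolP[g0 [t t0 wt]] g_min; have w1 : w 1 = 0.
  by rewrite -(rmorph1 (constE E)) wC ?oner_eq0.
have wX u n : u != 0 -> w (u ^+ n) = w u * n%:Z.
  move=> u0; elim: n => [|n IHn]; first by rewrite w1 mulr0.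
  by rewrite exprS wM ?expf_neq0 // IHn -add1n PoszD mulrDr mulr1.
have wV u : u != 0 -> w u^-1 = - w u.
  by move=> u0; apply: (addrI (w u)); rewrite subrr -wM ?invr_eq0 // divff.
have wXz u (i : int) : u != 0 -> w (u ^ i) = w u * i.
  by move=> u0; case: i => n; rewrite ?NegzE -?exprnN ?wV ?wX ?expf_neq0 ?mulrN.
have wE z : z != 0 -> w z = (w z %/ g)%Z * g%:Z.
  move=> z0; set q := (w z %/ g)%Z; apply/eqP; rewrite -subr_eq0; apply/negP => r0.
  have tq0 : t ^ (- q) != 0 by rewrite expfz_neq0.
  have rE := divz_eq (w z) g.
  have wr : w (z * t ^ (- q)) = (w z %% g)%Z by rewrite wM // wXz // wt /q; lia.
  have : pos `|(w z %% g)%Z|%N.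
    apply/asboolP; split; first by move/eqP: r0; rewrite /q; lia.
    by exists (z * t ^ (- q)); rewrite ?mulf_neq0 // wr gez0_abs // modz_ge0; lia.
  by move=> /g_min; have := @ltz_pmod (w z) g; lia.
pose v z : int := if z == 0 then 0 else (w z %/ g)%Z.
have vE z : z != 0 -> w z = v z * g%:Z by move=> z0; rewrite /v (negPf z0); apply: wE.
have gz : g%:Z != 0 by lia.
have v_val : is_valuation v.
  split; first by rewrite /v eqxx.
  - by move=> a b a0 b0; apply: (mulIf gz); rewrite mulrDl -!vE ?mulf_neq0 ?wM.
  - move=> a b a0 b0 ab0; have := wD _ _ a0 b0 ab0; rewrite !vE //.
    by rewrite -minr_pMl // ler_pM2r.
  - by move=> a a0; apply: (mulIf gz); rewrite mul0r -vE ?wC ?fmorph_eq0.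
  by exists t => //; apply: (mulIf gz); rewrite mul1r -vE.
by exists (Place v_val), g%:Z; split; [lia | exact: vE].
Qed.

Lemma powers_dependent z : exists c : 'I_(\dim {:E}).+1 -> {fraction {poly F}},
  \sum_i c i *: z ^+ i = 0 /\ exists j, c j != 0.
Proof.
set N := \dim {:E}; pose X := [tuple z ^+ i | i < N.+1].
have : ~~ free X.
  by rewrite /free size_tuple ltn_eqF // ltnS dimvS ?subvf.
move=> nfX; apply: contrapT => nc; case/negP: nfX; apply/freeP => k k0 i.
apply: contrapT => ki; apply: nc; exists k; split; last by exists i; apply/eqP.
by rewrite -[RHS]k0; apply: eq_bigr => l _; rewrite -tnth_nth tnth_mktuple.
Qed.

Variables (O : set E) (h : E).
Hypothesis subO : is_subring O.
Hypothesis valO : forall z, O z \/ O z^-1.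
Hypotheses (Oh : O h) (Oh1 : ~ O h^-1).
Hypothesis constO : forall a, O (constE E a).

Let runit u := [/\ u != 0, O u & O u^-1].

(** On F(x) the ring is discrete with uniformizer [h]; what follows transfers discreteness to the
    finite extension E. *)
Hypothesis discrete : forall c : {fraction {poly F}}, c != 0 ->
  exists i : int, runit (c%:A / h ^ i).

Let h0 : h != 0.
Proof. by apply/eqP => h0; apply: Oh1; rewrite h0 invr0; apply: subring0. Qed.

Let runitM u v : runit u -> runit v -> runit (u * v).
Proof.
move=> [u0 Ou Ou1] [v0 Ov Ov1]; split; first by rewrite mulf_neq0.
  exact: subringM.
by rewrite invfM; apply: subringM.
Qed.

Let runitV u : runit u -> runit u^-1.
Proof. by case=> u0 Ou Ou1; split; rewrite ?invr_eq0 ?invrK. Qed.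

Let runitX u n : runit u -> runit (u ^+ n).
Proof.
move=> [u0 Ou Ou1]; split; first by rewrite expf_neq0.
  exact: subringX.
by rewrite -exprVn; apply: subringX.
Qed.

Let maxO u := O u /\ ~ runit u.

Let maxO_D u v : maxO u -> maxO v -> maxO (u + v).
Proof.
have key u' v' : maxO u' -> maxO v' -> v' != 0 -> O (u' / v') -> maxO (u' + v').
  move=> [Ou Uu] [Ov Uv] v0 Ouv; split; first exact: subringD.
  case=> uv0 _ Ouv1; apply: Uv; split=> //.
  rewrite (_ : v'^-1 = (u' / v' + 1) * (u' + v')^-1); last by field; rewrite v0 uv0.
  by apply: subringM => //; apply: subringD => //; apply: subring1.
move=> mu mv; have [v0|v0] := eqVneq v 0; first by rewrite v0 addr0.
have [u0|u0] := eqVneq u 0; first by rewrite u0 add0r.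
by case: (valO (u / v)) => Ouv; [|rewrite addrC]; apply: key => //; rewrite -invf_div.
Qed.

Let O_min (s : seq E) : s != [::] -> all (fun u => u != 0) s ->
  exists2 w, w \in s & forall u, u \in s -> O (u / w).
Proof.
elim: s => // a s IHs _ /= /andP[a0 s0].
have [->|/IHs/(_ s0)[w ws wP]] := eqVneq s [::].
  exists a; rewrite ?mem_head // => u; rewrite inE => /eqP ->.
  by rewrite divff //; apply: subring1.
have w0 : w != 0 by move/allP: s0; apply.
case: (valO (a / w)) => Oaw.
  exists w; rewrite ?inE ?ws ?orbT // => u; rewrite inE => /orP[/eqP -> //|].
  exact: wP.
exists a; rewrite ?mem_head // => u; rewrite inE => /orP[/eqP ->|us].
  by rewrite divff //; apply: subring1.
rewrite (_ : u / a = u / w * (a / w)^-1); last by field; rewrite a0 w0.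
by apply: subringM => //; apply: wP.
Qed.

(** In a relation sum c_i z^i = 0 two terms attain the least value. Their quotient is a unit, so
    some power of z agrees up to a unit with an element of F(x), hence with a power of h. *)
Let commensurable z : z != 0 ->
  exists (d : nat) (i : int), (0 < d <= \dim {:E})%N /\ runit (z ^+ d / h ^ i).
Proof.
move=> z0; set N := \dim {:E}.
have [c [c0 [j cj]]] := powers_dependent z.
pose f i := c i *: z ^+ i.
have f0 i : (f i != 0) = (c i != 0).
  by rewrite /f scaler_eq0 expf_eq0 (negPf z0) andbF orbF.
have [||w] := @O_min [seq f i | i <- enum 'I_N.+1 & f i != 0].
- have : f j \in [seq f i | i <- enum 'I_N.+1 & f i != 0].
    by apply: map_f; rewrite mem_filter f0 cj mem_enum.
  by case: [seq _ | _ <- _].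
- by rewrite all_map; apply/allP => i; rewrite mem_filter => /andP[].
case/mapP => i0; rewrite mem_filter => /andP[fi0 _] -> w_min.
have {}w_min i : O (f i / f i0).
  have [fi|fi] := eqVneq (f i) 0; first by rewrite fi mul0r; apply: subring0.
  by apply/w_min/map_f; rewrite mem_filter fi mem_enum.
(* Otherwise, after division by the least term, -1 would be a sum of non-units. *)
have [i1 ne_i1 Ui1] : exists2 i1, i1 != i0 & runit (f i1 / f i0).
  apply: contrapT => nU.
  have : maxO (\sum_(i | i != i0) f i / f i0).
    elim/big_ind: _; [|exact: maxO_D|].
      by split; [exact: subring0|case; rewrite eqxx].
    by move=> i ni; split=> // Ui; apply: nU; exists i.
  rewrite -mulr_suml (_ : \sum_(i | _) _ = - f i0).
    rewrite mulNr divff // => -[_]; apply; split; rewrite ?oppr_eq0 ?oner_eq0 //.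
      by rewrite -sub0r; apply: subringB => //; [exact: subring0|exact: subring1].
    rewrite invrN1 -sub0r; apply: subringB => //; [exact: subring0|exact: subring1].
  by move: c0; rewrite (bigD1 i0) //= addrC => /eqP; rewrite addr_eq0 => /eqP.
have main (i i' : 'I_N.+1) : (i < i')%N -> f i != 0 -> f i' != 0 -> runit (f i' / f i) ->
    exists (d : nat) (k : int), (0 < d <= N)%N /\ runit (z ^+ d / h ^ k).
  rewrite !f0 => ii' ci ci' U; have [k Uk] := discrete (mulf_neq0 ci' (invr_neq0 ci)).
  exists (i' - i)%N, (- k); split; first by have := ltn_ord i'; lia.
  rewrite (_ : _ / _ = f i' / f i * ((c i' / c i)%:A / h ^ k)^-1).
    by apply: runitM => //; apply: runitV.
  rewrite /f -invr_expz -[c i *: _]mulr_algl -[c i' *: _]mulr_algl.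
  rewrite -{2}(subnK (ltnW ii')) exprD.
  have -> : (c i' / c i)%:A = (c i')%:A / (c i)%:A :> E.
    by rewrite -!in_algE rmorphM fmorphV.
  have algN0 (d : {fraction {poly F}}) : d != 0 -> d%:A != 0 :> E.
    by move=> d0; rewrite scaler_eq0 (negPf d0) oner_eq0.
  move: (algN0 _ ci) (algN0 _ ci') (expfz_neq0 k h0) (expf_neq0 i z0).
  move: (c i)%:A (c i')%:A (h ^ k) (z ^+ i) (z ^+ (i' - i)) => a1 a2 a3 a4 a5.
  by move=> a10 a20 a30 a40; field; rewrite a10 a20 a30 a40 oner_eq0.
have fi1 : f i1 != 0 by case: Ui1; rewrite mulf_eq0 negb_or => /andP[].
case: (ltngtP i0 i1) => [lt|lt|/val_inj eq]; first exact: main lt fi0 fi1 Ui1.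
  by apply: main lt fi1 fi0 _; rewrite -invf_div; apply: runitV.
by rewrite eq eqxx in ne_i1.
Qed.

Let N := (\dim {:E})`!.

Let commensurableN z : z != 0 -> exists i : int, runit (z ^+ N / h ^ i).
Proof.
case/commensurable => d [i [dN U]]; have /dvdnP[e Ne] : (d %| N)%N.
  by apply: dvdn_fact; case/andP: dN => -> ->.
exists (i * e%:Z); rewrite Ne mulnC exprM -exprz_exp -exprnP -expr_div_n.
exact: runitX.
Qed.

Let runit_h i : runit (h ^ i) -> i = 0.
Proof.
wlog i0 : i / (0 <= i) => [W U|].
  case: (leP 0 i) => [/W/(_ U) //|i0]; apply/eqP; rewrite -oppr_eq0.
  by apply/eqP/W; [lia|rewrite -invr_expz; apply: runitV].
case: i i0 => // -[//|n] _ [_ _ On]; case: Oh1.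
rewrite (_ : h^-1 = h ^+ n * (h ^ n.+1%:Z)^-1).
  by apply: subringM => //; apply: subringX.
by rewrite -exprnP exprSr invfM mulrA divff ?expf_neq0 ?mul1r.
Qed.

(* Every z satisfies z^d / h^i unit for some 0 < d <= [E : F(x)]; the factorial N *)
(* is a common multiple of these d, and makes z |-> i single-valued.               *)
Let w z : int := xget 0 (fun i : int => runit (z ^+ N / h ^ i)).

Let wP z : z != 0 -> runit (z ^+ N / h ^ w z).
Proof.
by move=> z0; rewrite /w; case: xgetP => // H; case: (commensurableN z0) => i /H.
Qed.

Let w_uniq z i : runit (z ^+ N / h ^ i) -> w z = i.
Proof.
move=> U; have z0 : z ^+ N != 0 by case: U; rewrite mulf_eq0 negb_or => /andP[].
have z0' : z != 0 by apply: contra z0 => /eqP ->; rewrite expr0n gtn_eqF ?fact_gt0.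
apply/eqP; rewrite -subr_eq0; apply/eqP/runit_h.
have := runitM (runitV (wP z0')) U; congr runit.
rewrite invf_div expfzDr // -invr_expz.
have := expfz_neq0 i h0; move: (h ^ i) (h ^ w z) (z ^+ N) z0 => a b x x0 a0.
by field; rewrite a0 x0.
Qed.

Let Oexpz z i : 0 <= i -> O z -> O (z ^ i).
Proof. by case: i => // n _ Oz; apply: subringX. Qed.

Let wM u v : u != 0 -> v != 0 -> w (u * v) = w u + w v.
Proof.
move=> u0 v0; apply: w_uniq; have := runitM (wP u0) (wP v0); congr runit.
by rewrite exprMn expfzDr // invfM mulrACA.
Qed.

Let wX u n : u != 0 -> w (u ^+ n) = w u * n%:Z.
Proof.
move=> u0; elim: n => [|n IHn]; last first.
  by rewrite exprS wM ?expf_neq0 // IHn -add1n PoszD mulrDr mulr1.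
rewrite mulr0; apply: w_uniq; rewrite expr0 expr1n expr0z divr1.
by split; rewrite ?oner_eq0 ?invr1 //; apply: subring1.
Qed.

(** A valuation ring is integrally closed: if z^N and z^-1 lie in [O], so does z = z^N
    (z^-1)^(N-1). *)
Let w_ge0 z : z != 0 -> 0 <= w z <-> O z.
Proof.
move=> z0; have [_ Ou Ou1] := wP z0; split=> [wz|Oz].
  have OzN : O (z ^+ N).
    rewrite -[z ^+ N](divfK (expfz_neq0 (w z) h0)).
    by apply: subringM => //; apply: Oexpz.
  case: (valO z) => // Oz1.
  rewrite (_ : z = z ^+ N * z^-1 ^+ N.-1).
    by apply: subringM => //; apply: subringX.
  have N0 : (0 < N)%N by apply: fact_gt0.
  by rewrite -[in z ^+ N](prednK N0) exprS -mulrA -exprMn divff // expr1n mulr1.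
rewrite leNgt; apply/negP => wz; apply: Oh1.
have Ohw : O (h ^ w z).
  rewrite (_ : h ^ w z = z ^+ N * (z ^+ N / h ^ w z)^-1).
    by apply: subringM => //; apply: subringX.
  by rewrite invf_div mulrC divfK // expf_neq0.
rewrite (_ : h^-1 = h ^ w z * h ^ (- w z - 1)).
  by apply: subringM => //; apply: Oexpz => //; lia.
by rewrite -expfzDr // (_ : _ + _ = -1) ?exprN1 //; lia.
Qed.

Let wV u : u != 0 -> w u^-1 = - w u.
Proof.
move=> u0; apply: (addrI (w u)); rewrite subrr -wM ?invr_eq0 // divff //.
by have := wX 0 u0; rewrite mulr0.
Qed.

Let wD u v : u != 0 -> v != 0 -> u + v != 0 -> Num.min (w u) (w v) <= w (u + v).
Proof.
have key u' v' : u' != 0 -> v' != 0 -> u' + v' != 0 -> w v' <= w u' -> w v' <= w (u' + v').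
  move=> u0 v0 uv0 wvu; rewrite -subr_ge0 -wV // -wM ?invr_eq0 // w_ge0.
    rewrite mulrDl divff //; apply: subringD => //; last exact: subring1.
    by apply/w_ge0; rewrite ?mulf_neq0 ?invr_eq0 // wM ?invr_eq0 // wV ?subr_ge0.
  by rewrite mulf_neq0 ?invr_eq0.
move=> u0 v0 uv0; rewrite minElt; case: ltP => [/ltW|] wuv; last exact: key.
by rewrite addrC; apply: key; rewrite // addrC.
Qed.

Lemma place_of_valuation_ring :
  exists P : place E, 0 < ord P h /\ forall z, O z -> vge P 0 z.
Proof.
have wh : w h = N by apply: w_uniq; rewrite divff ?expf_neq0 //;
  split; rewrite ?oner_eq0 ?invr1 //; apply: subring1.
have wC a : a != 0 -> w (constE E a) = 0.
  move=> a0; apply: w_uniq; rewrite expr0z divr1; apply: runitX.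
  by split; [rewrite fmorph_eq0|exact: constO|rewrite -fmorphV; exact: constO].
have [|P [g [g0 wP']]] := normalise_valuation wM wD wC.
  by exists h => //; rewrite wh ltz_nat fact_gt0.
exists P; split; first by rewrite -(pmulr_lgt0 _ g0) -wP' // wh ltz_nat fact_gt0.
move=> z Oz; have [->|z0] := eqVneq z 0; first by left.
by right; rewrite -(pmulr_lge0 _ g0) -wP' // w_ge0.
Qed.

End PlaceOfValuationRing.

(** * Existence of places above given ones *)

Section ExistenceOfPlaces.

Variables (F : fieldType) (E : fieldExtType {fraction {poly F}}).

Lemma exists_place (A : set E) (h : E) :
    is_subring A -> A h -> ~ A h^-1 -> (forall a, A (constE E a)) ->
    (forall c : {fraction {poly F}}, c != 0 ->
      exists i : int, A (c%:A / h ^ i) /\ A (c%:A / h ^ i)^-1) ->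
  exists P : place E, 0 < ord P h /\ forall z, A z -> vge P 0 z.
Proof.
move=> sA Ah Ah1 Ac Adiscr.
have [O [sO AO Oh1 valO]] := exists_valuation_ring sA Ah Ah1.
have h0 : h != 0.
  by apply/eqP => h0; apply: Ah1; rewrite h0 invr0; apply: subring0.
have [|c c0|P [Ph PO]] := place_of_valuation_ring sO valO (AO _ Ah) Oh1.
- by move=> a; apply/AO/Ac.
- have [i [Ac1 Ac2]] := Adiscr c c0; exists i; split; [|exact: AO|exact: AO].
  by rewrite mulf_neq0 ?invr_eq0 ?expfz_neq0 // scaler_eq0 (negPf c0) oner_eq0.
by exists P; split=> // z /AO; apply: PO.
Qed.

Lemma poly_factor_out (q h : {poly F}) : (1 < size q)%N -> h != 0 ->
  exists (i : nat) (g : {poly F}), h = q ^+ i * g /\ ~~ (q %| g).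
Proof.
move=> q1; move: {2}(size h) (leqnn (size h)) => N.
elim: N h => [|N IHN] h szh h0; first by rewrite -size_poly_eq0 in h0; lia.
have [/dvdpP[g hE]|nd] := boolP (q %| h); last first.
  by exists 0%N, h; rewrite expr0 mul1r.
have g0 : g != 0 by apply: contraNneq h0 => g0; rewrite hE g0 mul0r.
have q0 : q != 0 by rewrite -size_poly_gt0 ltnW.
have [|i [g' [gE ndg]]] := IHN g _ g0.
  by move: q1 szh; rewrite hE size_mul //; move: (size g) (size q) => a b; lia.
by exists i.+1, g'; split=> //; rewrite hE gE exprSr mulrAC.
Qed.

Lemma exists_irreducible_factor (h : {poly F}) : (1 < size h)%N ->
  exists q : {poly F}, irreducible_poly q /\ q %| h.
Proof.
move=> h1; pose ok m := `[< exists q : {poly F}, [/\ (1 < size q)%N, q %| h & size q = m] >].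
have : exists m, ok m by exists (size h); apply/asboolP; exists h; rewrite dvdpp.
case/ex_minnP => m /asboolP[q [q1 qh qm]] m_min; exists q; split=> //.
have q0 : q != 0 by rewrite -size_poly_gt0 ltnW.
split=> // u u1 uq; rewrite -(dvdp_size_eqp uq) eqn_leq dvdp_leq // qm.
apply: m_min; apply/asboolP; exists u; split=> //; last exact: dvdp_trans qh.
by rewrite ltn_neqAle eq_sym u1 size_poly_gt0; apply: contraNneq q0 => u0;
  move: uq; rewrite u0 dvd0p.
Qed.

(** Chevalley's theorem is applied to the localisation of F[x] at [q], where every nonzero fraction
    is a unit times a power of [q]. *)
Lemma exists_finite_place (q : {poly F}) : irreducible_poly q ->
  exists P : place E, 0 < ord P (polyE E q) /\ 0 <= ord P (polyE E 'X).
Proof.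
move=> irr_q; have [q1 _] := irr_q.
pose A : set E := fun z => exists g h : {poly F},
  ~~ (q %| h) /\ z = polyE E g / polyE E h.
have ndvd0 h : ~~ (q %| h) -> polyE E h != 0.
  by move=> nd; rewrite polyE_eq0; apply: contraNneq nd => ->; apply: dvdp0.
have ndvdM h h' : ~~ (q %| h) -> ~~ (q %| h') -> ~~ (q %| h * h').
  by rewrite -!irreducible_poly_coprime // coprimepMr => -> ->.
have ndvd1 : ~~ (q %| 1) by rewrite dvdp1 gtn_eqF.
have Apoly g : A (polyE E g) by exists g, 1; rewrite rmorph1 divr1.
have q0 : q != 0 by rewrite -size_poly_gt0 ltnW.
have qE0 : polyE E q != 0 by rewrite polyE_eq0.
have sA : is_subring A.
  split; first by rewrite -(rmorph1 (polyE E)); apply: Apoly.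
    move=> _ _ [g [h [nd ->]]] [g' [h' [nd' ->]]].
    exists (g * h' - g' * h), (h * h'); split; first exact: ndvdM.
    by rewrite !(rmorphB, rmorphM) /=; field; rewrite !ndvd0.
  move=> _ _ [g [h [nd ->]]] [g' [h' [nd' ->]]].
  exists (g * g'), (h * h'); split; first exact: ndvdM.
  by rewrite !rmorphM /=; field; rewrite !ndvd0.
have [|a|c c0|P [Pq PA]] := exists_place sA (Apoly q).
- case=> g [h [nd]]; rewrite -[(polyE E q)^-1]mul1r => /eqP.
  rewrite eqr_div // ?ndvd0 // mul1r -rmorphM -subr_eq0 -rmorphB polyE_eq0 subr_eq0.
  by move=> /eqP hE; case/negP: nd; rewrite hE dvdp_mull.
- by rewrite -polyEC; apply: Apoly.
- have [g [h [h0 _ cE]]] := fraction_polyE E c.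
  have g0 : g != 0.
    apply: contraNneq c0 => g0; move: cE; rewrite g0 rmorph0 mul0r => /eqP.
    by rewrite scaler_eq0 oner_eq0 orbF.
  have [i [g' [gE ndg]]] := poly_factor_out q1 g0.
  have [j [h' [hE ndh]]] := poly_factor_out q1 h0.
  have cE' : c%:A / polyE E q ^ (i%:Z - j%:Z) = polyE E g' / polyE E h'.
    rewrite cE gE hE !rmorphM !rmorphXn expfzDr //= -invr_expz -!exprnP.
    by field; rewrite !ndvd0 ?expf_neq0.
  exists (i%:Z - j%:Z); rewrite cE'; split; first by exists g', h'.
  by exists h', g'; rewrite invf_div.
exists P; split=> //; rewrite -vgeP; last by rewrite polyE_eq0 polyX_eq0.
exact/PA/Apoly.
Qed.

(** Here the local ring is that of infinity, the fractions whose numerator has at most the degree of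
    the denominator, with uniformizer 1/x. *)
Lemma exists_infinite_place : exists P : place E, ord P (polyE E 'X) < 0.
Proof.
pose A : set E := fun z => exists g h : {poly F},
  [/\ h != 0, (size g <= size h)%N & z = polyE E g / polyE E h].
have X0 : polyE E 'X != 0 by rewrite polyE_eq0 polyX_eq0.
have szM (g h g' h' : {poly F}) : h != 0 -> h' != 0 ->
    (size g <= size h -> size g' <= size h' -> size (g * g')%R <= size (h * h')%R)%N.
  move=> h0 h0' gh gh'; rewrite (leq_trans (size_polyMleq _ _)) // size_mul //.
  by rewrite -!subn1 leq_sub2r // leq_add.
have sA : is_subring A.
  split; first by exists 1, 1; rewrite oner_eq0 rmorph1 divr1.
    move=> _ _ [g [h [h0 gh ->]]] [g' [h' [h0' gh' ->]]].
    exists (g * h' - g' * h), (h * h'); split; first by rewrite mulf_neq0.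
      rewrite (leq_trans (size_polyD _ _)) // size_polyN geq_max.
      by rewrite szM //= [h * _]mulrC szM.
    by rewrite !(rmorphB, rmorphM) /=; field; rewrite !polyE_eq0 h0 h0'.
  move=> _ _ [g [h [h0 gh ->]]] [g' [h' [h0' gh' ->]]].
  exists (g * g'), (h * h'); split; first by rewrite mulf_neq0.
    exact: szM.
  by rewrite !rmorphM /=; field; rewrite !polyE_eq0 h0 h0'.
have [||a|c c0|P [Px _]] := @exists_place A (polyE E 'X)^-1 sA.
- by exists 1, 'X; rewrite polyX_eq0 size_poly1 size_polyX rmorph1 mul1r.
- rewrite invrK => -[g [h [h0 gh /eqP]]].
  rewrite -[polyE E 'X]divr1 eqr_div ?oner_eq0 ?polyE_eq0 // mulr1 -rmorphM.
  rewrite -subr_eq0 -rmorphB polyE_eq0 subr_eq0 => /eqP gE.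
  by move: gh; rewrite -gE mulrC size_mulX // ltnn.
- exists a%:P, 1; rewrite oner_eq0 size_poly1 size_polyC_leq1 rmorph1 divr1.
  by rewrite polyEC.
- have [g [h [h0 _ cE]]] := fraction_polyE E c.
  have g0 : g != 0.
    apply: contraNneq c0 => g0; move: cE; rewrite g0 rmorph0 mul0r => /eqP.
    by rewrite scaler_eq0 oner_eq0 orbF.
  exists ((size h)%:Z - (size g)%:Z).
  have cE' : c%:A / (polyE E 'X)^-1 ^ ((size h)%:Z - (size g)%:Z) =
      polyE E (g * 'X^(size h)) / polyE E (h * 'X^(size g)).
    rewrite cE expfzDr ?invr_eq0 // -invr_expz -!exprnP !rmorphM !rmorphXn /=.
    have := expf_neq0 (size h) X0; have := expf_neq0 (size g) X0; rewrite !exprVn.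
    move: (polyE E 'X ^+ size g) (polyE E 'X ^+ size h) => a b a0 b0.
    by field; rewrite polyE_eq0 ?h0 ?a0 ?b0 ?oner_eq0.
  have sz : size (g * 'X^(size h)) = size (h * 'X^(size g)).
    by rewrite !size_mulXn // addnC.
  rewrite cE'; split.
    by exists (g * 'X^(size h)), (h * 'X^(size g)); rewrite sz mulf_neq0 ?expf_neq0 ?polyX_eq0.
  exists (h * 'X^(size g)), (g * 'X^(size h)).
  by rewrite sz invf_div mulf_neq0 ?expf_neq0 ?polyX_eq0.
by exists P; rewrite ordV oppr_gt0 in Px.
Qed.

End ExistenceOfPlaces.

(** * Weak approximation *)

Section Approximation.

Variables (F : fieldType) (E : fieldExtType {fraction {poly F}}).
Implicit Types (P Q : place E) (u z : E) (S : seq (place E)).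

Lemma exists_uniformizer P : exists2 t : E, t != 0 & ord P t = 1.
Proof. exact: (Defs.val_normalised (ord_is_valuation P)). Qed.

(** If the ring of P lay in that of Q, order 0 at P would imply order 0 at Q, and [ord Q] would be a
    constant multiple of [ord P]. Normalisation makes the constant 1, so the places coincide. *)
Lemma valuation_ring_incomparable P Q : P <> Q ->
  exists z : E, [/\ z != 0, 0 <= ord P z & ord Q z < 0].
Proof.
move=> neqPQ; apply: contrapT => nz; apply: neqPQ.
have le z : z != 0 -> 0 <= ord P z -> 0 <= ord Q z.
  by move=> z0 Pz; rewrite leNgt; apply/negP => Qz; apply: nz; exists z.
have eq0 z : z != 0 -> ord P z = 0 -> ord Q z = 0.
  move=> z0 Pz; apply/eqP; rewrite eq_le le ?Pz // andbT.
  by have := le z^-1; rewrite !ordV invr_eq0 Pz oppr0 oppr_ge0; apply.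
have [t t0 Pt] := exists_uniformizer P; have [s s0 Qs] := exists_uniformizer Q.
have QP z : z != 0 -> ord Q z = ord P z * ord Q t.
  move=> z0; have tz0 : t ^ ord P z != 0 by rewrite expfz_neq0.
  have : ord Q (z / t ^ ord P z) = 0.
    apply: eq0; first by rewrite mulf_neq0 ?invr_eq0.
    by rewrite ordF // ordXz // Pt mulr1 subrr.
  by rewrite ordF // ordXz //; lia.
have Qt : ord Q t = 1.
  have : 0 <= ord Q t by rewrite le // Pt.
  have := QP s s0; rewrite Qs; move: (ord P s) (ord Q t) => a b.
  by have [a0|a0] := lerP a 0; nia.
apply/place_inj/funext => z; have [->|z0] := eqVneq z 0.
  by rewrite !(Defs.val0 (ord_is_valuation _)).
by rewrite QP // Qt mulr1.
Qed.

Lemma separate_two_places P Q : P <> Q ->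
  exists z : E, [/\ z != 0, 0 < ord P z & ord Q z < 0].
Proof.
move=> neqPQ; have [u [u0 Pu Qu]] := valuation_ring_incomparable neqPQ.
have [v [v0 Qv Pv]] := valuation_ring_incomparable (not_eq_sym neqPQ).
by exists (u / v); rewrite mulf_neq0 ?invr_eq0 // !ordF //; split=> //; lia.
Qed.

(** By induction: u serves for S and v separates P from Q. In u + v^N, with N beyond all orders of
    u, the power dominates exactly at the poles of v among these places, and u at the rest of S. *)
Lemma separate_places P S : P \notin S ->
  exists z : E, [/\ z != 0, 0 < ord P z & forall Q, Q \in S -> ord Q z < 0].
Proof.
elim: S => [_|Q S IHS].
  by have [t t0 Pt] := exists_uniformizer P; exists t; rewrite Pt.
rewrite inE negb_or => /andP[/eqP neqPQ /IHS[u [u0 Pu Su]]].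
have [v [v0 Pv Qv]] := separate_two_places neqPQ.
pose N := (\sum_(R <- Q :: S) `|ord R u|).+1%N.
have N_gt R : R \in Q :: S -> - N%:Z < ord R u.
  move=> SR; suff : (`|ord R u| < N)%N by lia.
  by rewrite ltnS (big_rem R) //= leq_addr.
have vN0 : v ^+ N != 0 by rewrite expf_neq0.
have neg R : R \in Q :: S -> ord R v < 0 ->
    u + v ^+ N != 0 /\ ord R (u + v ^+ N) < 0.
  move=> SR Rv; have RvN : ord R (v ^+ N) < ord R u.
    by rewrite ordX //; have := N_gt R SR; rewrite /N; nia.
  rewrite addrC; have [|-> ->] := @ordD _ _ R _ u vN0; first by right; rewrite lezD1.
  by split=> //; rewrite ordX // /N; nia.
have [w0 Qw] := neg Q (mem_head _ _) Qv.
exists (u + v ^+ N); split=> //.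
  rewrite gtz0_ge1; apply/vgeP => //; apply: vgeD; right; first by rewrite -gtz0_ge1.
  by rewrite ordX // /N; nia.
move=> R; rewrite inE => /orP[/eqP -> //|SR].
have [Rv|Rv] := ltP (ord R v) 0; first by case: (neg R) => //; rewrite inE SR orbT.
have [|_ ->] := @ordD _ _ R u (v ^+ N) u0; last exact: Su.
by right; rewrite ordX //; have := Su _ SR; nia.
Qed.

(** For u with a zero at P and poles on S, the element 1/(1 + u^(N+1)) is close to 1 at P and to 0
    on S. *)
Lemma weak_approximation P S (N : nat) : P \notin S ->
  exists z : E, vge P 1 (z - 1) /\ forall Q, Q \in S -> vge Q N z.
Proof.
move=> /separate_places[u [u0 Pu Su]].
have uN0 : u ^+ N.+1 != 0 by rewrite expf_neq0.
have one0 : 1 != 0 :> E by rewrite oner_eq0.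
have [|w0 Pw] := @ordD _ _ P 1 (u ^+ N.+1) one0.
  by right; rewrite ord1 ordX //; nia.
exists (1 + u ^+ N.+1)^-1; split.
  rewrite (_ : _ - 1 = - (u ^+ N.+1 / (1 + u ^+ N.+1))); last by field.
  by apply: vgeN; right; rewrite ordF // Pw ord1 ordX //; nia.
move=> Q /Su Qu; right; rewrite ordV addrC.
have [|_ ->] := @ordD _ _ Q _ 1 uN0; first by right; rewrite ord1 ordX //; nia.
by rewrite ordX //; nia.
Qed.

Definition semilocal S (c : place E -> nat) : set E :=
  fun z => forall P, P \in S -> vge P (c P) z.

Lemma subspace_semilocal S c : subspace (semilocal S c).
Proof.
split=> [P _|u v Uu Uv P SP|a u Uu P SP]; first by left.
  by apply: vgeD; [exact: Uu|exact: Uv].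
by apply: (subspaceZ (subspace_vge P _)); apply: Uu.
Qed.

(** Division by t^(c P), for a uniformizer t at P, maps the quotient into the residue field of P. It
    is onto: a lift times an element from weak approximation keeps its residue at P and acquires the
    required orders elsewhere. *)
Lemma semilocal_step S P c f : P \in S ->
    has_reldim (valuation_ring P) (maximal_ideal P) f ->
  has_reldim (semilocal S c) (semilocal S (fun Q => c Q + (Q == P)))%N f.
Proof.
move=> SP; rewrite maximal_idealE -[valuation_ring P]/(vge P 0).
have [t t0 Pt] := exists_uniformizer P.
have tc0 : t ^+ c P != 0 by rewrite expf_neq0.
have shift i z : vge P i ((t ^+ c P)^-1 * z) <-> vge P (i + (c P)%:Z) z.
  have [->|z0] := eqVneq z 0; first by rewrite mulr0; split=> _; left.
  rewrite !vgeP ?mulf_neq0 ?invr_eq0 // ordM ?invr_eq0 // ordV ordX // Pt.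
  by split; lia.
apply: (@has_reldim_iso _ _ _ _ _ _ (t ^+ c P)^-1);
  [exact: subspace_vge|exact: subspace_vge|exact: subspace_semilocal
  |exact: subspace_semilocal|..].
- by move=> z Uz; apply/shift; rewrite add0r; apply: Uz.
- have cP1 : 1 + (c P)%:Z = (c P + (P == P))%N by rewrite eqxx; lia.
  move=> z Uz; rewrite shift cP1; split=> [Pz Q SQ|]; last exact.
  by have [->|_] := eqVneq Q P; [rewrite eqxx in Pz|rewrite addn0; apply: Uz].
move=> v Pv.
pose N := (\sum_(Q <- S) `|(c Q)%:Z - ord Q (t ^+ c P * v)|)%N.
have [|e [Pe Se]] := @weak_approximation P [seq Q <- S | Q != P] N.
  by rewrite mem_filter eqxx.
have Pe0 : vge P 0 e.
  by rewrite -[e](subrK 1); apply: vgeD; [apply: vge_le Pe|apply: vge1].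
exists (t ^+ c P * v * e) => [Q SQ|].
  have [->|QP] := eqVneq Q P.
    rewrite -[_%:Z]addr0; apply: vgeM => //; rewrite -[_%:Z]addr0; apply: vgeM => //.
    by right; rewrite ordX // Pt mulr1.
  apply: (@vge_le _ _ _ _ (ord Q (t ^+ c P * v) + N%:Z)); last first.
    by apply: vgeM; [exact: vge_ord | apply: Se; rewrite mem_filter QP].
  have : (`|(c Q)%:Z - ord Q (t ^+ c P * v)| <= N)%N.
    by rewrite /N (big_rem Q) //= leq_addr.
  by lia.
rewrite -[t ^+ c P * v * e]mulrA mulKf // -{1}[v]mulr1 -mulrBr -opprB mulrN.
by apply: vgeN; have := vgeM Pv Pe; rewrite add0r.
Qed.

(** The Chinese remainder theorem in terms of dimensions, by induction on the sum of the [c P]. *)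
Lemma semilocal_reldim S c :
    uniq S -> (forall P, P \in S -> exists f,
      has_reldim (valuation_ring P) (maximal_ideal P) f) ->
  has_reldim (semilocal S (fun=> 0)%N) (semilocal S c)
    (\sum_(P <- S) c P * place_degree P)%N.
Proof.
move=> uS fS.
have degP P : P \in S ->
    has_reldim (valuation_ring P) (maximal_ideal P) (place_degree P).
  move=> /fS[f Pf]; rewrite /place_degree (reldimE _ _ Pf) //.
    exact: (subspace_vge P 0).
  by rewrite maximal_idealE; apply: subspace_vge.
elim: {c}(\sum_(P <- S) c P)%N {-2}c (erefl (\sum_(P <- S) c P)%N) => [|N IHN] c cN.
  have c0 P : P \in S -> c P = 0%N.
    move=> SP; apply/eqP; move/eqP: cN; rewrite sum_nat_seq_eq0.
    by move/allP/(_ P SP); rewrite implyTb.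
  have -> : semilocal S c = semilocal S (fun=> 0)%N.
    apply: funext => z; apply/propext.
    by split=> Uz P SP; have := Uz P SP; rewrite c0.
  rewrite big_seq big1 => [|P /c0 -> //].
  apply/has_reldimP; [exact: subspace_semilocal|exact: subspace_semilocal|].
  exists (fun=> 0); split=> [[]//|a _ [] //|z Uz].
  by exists (fun=> 0); rewrite /lcomb big_ord0 subr0.
have /hasP[P SP cP] : has (fun P => c P != 0)%N S.
  apply/negPn; rewrite -all_predC; apply/negP => /allP c0.
  suff : \sum_(P <- S) c P = 0%N by rewrite cN.
  by rewrite big_seq big1 // => P /c0 /=; rewrite negbK => /eqP.
pose c' Q := (c Q - (Q == P))%N.
have cE : c = (fun Q => c' Q + (Q == P))%N.
  by apply: funext => Q; rewrite /c' subnK //; case: eqP => // ->; rewrite lt0n.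
have sumP (g : place E -> nat) : (\sum_(Q <- S) (Q == P) * g Q = g P)%N.
  rewrite (bigD1_seq P) //= eqxx mul1n big1 ?addn0 // => Q /negPf ->.
  by rewrite mul0n.
have c'N : (\sum_(P <- S) c' P = N)%N.
  move: cN; rewrite cE big_split /=.
  under [X in (_ + X)%N]eq_bigr do rewrite -[nat_of_bool _]muln1.
  by rewrite sumP addn1 => -[].
rewrite (_ : (\sum_(Q <- S) _ = \sum_(Q <- S) c' Q * place_degree Q + place_degree P)%N).
  apply: (@has_reldim_add _ _ _ (semilocal S c'));
    [exact: subspace_semilocal|exact: subspace_semilocal|exact: subspace_semilocal
    | | |exact: IHN|].
  - by move=> z Uz Q SQ; apply: vge_le (Uz Q SQ).
  - by move=> z Uz Q SQ; apply: vge_le (Uz Q SQ); rewrite /c' lez_nat leq_subr.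
  by rewrite [in semilocal S c]cE; apply: semilocal_step => //; apply: degP.
rewrite cE; under eq_bigr do rewrite mulnDl.
by rewrite big_split /= sumP.
Qed.

End Approximation.

(** * Bounding independent elements modulo a function *)

Section ZeroDivisorDegree.

Variables (F : fieldType) (E : fieldExtType {fraction {poly F}}).
Implicit Types (P Q : place E) (u z : E) (S : seq (place E)).

Lemma clear_denominators (I J : finType) (c : I -> J -> {fraction {poly F}}) :
  exists (D : {poly F}) (g : I -> J -> {poly F}),
    D != 0 /\ forall i j, polyE E D * (c i j)%:A = polyE E (g i j).
Proof.
have /choice[nd ndP] (ij : I * J) : exists nd : {poly F} * {poly F},
    nd.2 != 0 /\ (c ij.1 ij.2)%:A = polyE E nd.1 / polyE E nd.2.
  by have [g [h [h0 _ cE]]] := fraction_polyE E (c ij.1 ij.2); exists (g, h).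
pose D := \prod_ij (nd ij).2.
exists D, (fun i j => (nd (i, j)).1 * \prod_(ij | ij != (i, j)) (nd ij).2).
split=> [|i j]; first by apply/prodf_neq0 => ij _; case: (ndP ij).
have [d0 /= ->] := ndP (i, j); rewrite /D (bigD1 (i, j)) //= !rmorphM /=.
by rewrite mulrC -mulrA mulKf ?polyE_eq0 // mulrC.
Qed.

(** More than [E : F(x)] d elements are dependent over F[z], z = A/B. Once denominators are cleared
    by D and B^M, the M k products z^l u_i lie in the F-span of the n (M d + C) elements x^a e_j,
    where n = [E : F(x)]; these are fewer than M k for M = n C + 1. *)
Lemma dependent_powers (A B : {poly F}) (d k : nat) (u : 'I_k -> E) :
    B != 0 -> (size A <= d.+1)%N -> (size B <= d.+1)%N -> (\dim {:E} * d < k)%N ->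
  exists (M : nat) (a : 'I_M -> 'I_k -> F),
    (exists l i, a l i != 0) /\
    \sum_(l < M) (polyE E A / polyE E B) ^+ l * lcomb (a l) u = 0.
Proof.
move=> B0 szA szB ltk; set n := \dim {:E} in ltk *.
have BE0 : polyE E B != 0 by rewrite polyE_eq0.
pose e := vbasis {:E}.
have [D [g [D0 gP]]] := clear_denominators (fun i j => coord e j (u i)).
have DE0 : polyE E D != 0 by rewrite polyE_eq0.
have DuE i : polyE E D * u i = \sum_j polyE E (g i j) * e`_j.
  rewrite {1}(coord_vbasis (memvf (u i))) mulr_sumr; apply: eq_bigr => j _.
  by rewrite -gP -mulrA (mulr_algl (coord e j (u i))).
pose C := (\max_i \max_j size (g i j)).+1%N.
have szg i j : (size (g i j) < C)%N.
  by rewrite ltnS (leq_trans _ (leq_bigmax i)) // (leq_bigmax j).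
pose M := (n * C).+1%N; pose N := (M * d + C)%N.
pose f (li : 'I_M * 'I_k) := polyE E (A ^+ li.1 * B ^+ (M - li.1)) * (polyE E D * u li.2).
pose b (ja : 'I_n * 'I_N) := polyE E 'X ^+ ja.2 * e`_ja.1.
have nfree : ~ free_mod (fun z => z = 0) f.
  move=> ff; have s0 : subspace (fun z : E => z = 0).
    by split=> [|x y -> ->|x y ->]; rewrite ?addr0 ?mulr0.
  suff : (#|{: 'I_M * 'I_k}| <= #|{: 'I_n * 'I_N}|)%N.
    by rewrite !card_prod !card_ord /N; rewrite leqNgt => /negP; apply; nia.
  apply: (free_mod_card (e := b) s0 _ ff) => -[l i].
  exists (fun ja : 'I_n * 'I_N => (A ^+ l * B ^+ (M - l) * g i ja.1)`_ja.2).
  apply/eqP; rewrite subr_eq0; apply/eqP; rewrite /f /= DuE mulr_sumr /lcomb.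
  rewrite -(pair_bigA _ (fun (j : 'I_n) (a : 'I_N) =>
    constE E (A ^+ l * B ^+ (M - l) * g i j)`_a * (polyE E 'X ^+ a * e`_j))) /=.
  apply: eq_bigr => j _; rewrite mulrA -rmorphM /=.
  set h := A ^+ l * _ * _; have szh : (size h <= N)%N.
    have leX (p : {poly F}) m : (size p <= d.+1 -> size (p ^+ m) <= (d * m).+1)%N.
      move=> szp; apply: leq_trans (size_poly_exp_leq _ _) _.
      by rewrite ltnS leq_mul //; move: (size p) szp => ?; lia.
    rewrite (leq_trans (size_polyMleq _ _)) //.
    have := leq_add (leX A l szA) (leX B (M - l)%N szB).
    rewrite addSn addnS -mulnDr subnKC ?(ltnW (ltn_ord l)) // mulnC => szAB.
    have szh : (size (A ^+ l * B ^+ (M - l))%R <= (M * d).+1)%N.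
      by rewrite (leq_trans (size_polyMleq _ _)) //; move: szAB; case: (_ + _)%N.
    have := szg i j; rewrite /N; move: szh; move: (size (A ^+ l * B ^+ (M - l))%R).
    by move: (size (g i j)) (M * d)%N => *; lia.
  rewrite [polyE E h]polyE_Horner mulr_suml.
  rewrite (big_ord_widen N (fun a => constE E h`_a * polyE E 'X ^+ a * e`_j)) //.
  rewrite big_mkcond; apply: eq_bigr => a _ /=; rewrite mulrA.
  by case: ltnP => // ha; rewrite nth_default // rmorph0 !mul0r.
move/existsNP: nfree => [a /not_implyP[a0 /existsNP[[l i] ali]]].
exists M, (fun l i => a (l, i)); split; first by exists l, i; apply/eqP.
apply: (mulfI (_ : polyE E B ^+ M * polyE E D != 0)).
  by rewrite mulf_neq0 ?expf_neq0.
have {}a0 : \sum_l \sum_i constE E (a (l, i)) * f (l, i) = 0.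
  by rewrite pair_bigA /= -[RHS]a0; apply: eq_bigr => -[].
rewrite mulr0 -[RHS]a0 mulr_sumr; apply: eq_bigr => l' _; rewrite !mulr_sumr.
apply: eq_bigr => i' _; rewrite /f /= rmorphM !rmorphXn /=.
rewrite -{1}(subnK (ltnW (ltn_ord l'))) exprD expr_div_n.
have := expf_neq0 l' BE0.
move: (polyE E B ^+ l') (polyE E A ^+ l') (polyE E B ^+ (M - l')) (polyE E D).
by move: (constE E _) (u i') => x1 x2 x3 x4 x5 x6 x30; field.
Qed.

(** Elements independent modulo z are independent over F[z]: in a relation the part free of z
    vanishes modulo z, so its coefficients are 0, and a factor z can be cancelled. *)
Lemma zero_free_bound S (A B : {poly F}) (d k : nat) (u : 'I_k -> E) :
    A != 0 -> B != 0 -> (size A <= d.+1)%N -> (size B <= d.+1)%N ->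
    (forall P, P \in S -> vge P 0 (polyE E A / polyE E B)) ->
    (forall i, semilocal S (fun=> 0)%N (u i)) ->
    free_mod (fun w => semilocal S (fun=> 0)%N (w / (polyE E A / polyE E B))) u ->
  (k <= \dim {:E} * d)%N.
Proof.
move=> A0 B0 szA szB; set z := polyE E A / polyE E B => Sz Su fu.
have z0 : z != 0 by rewrite mulf_neq0 ?invr_eq0 ?polyE_eq0.
rewrite leqNgt; apply/negP => /(dependent_powers u B0 szA szB)[M [a [[l [i ali]]]]].
rewrite -/z => a0; case/eqP: ali; move: a a0 l i.
elim: M => [|M IHM] a; first by move=> _ [].
have sS := subspace_semilocal S (fun=> 0)%N.
have SzX m w : semilocal S (fun=> 0)%N w -> semilocal S (fun=> 0)%N (z ^+ m * w).
  move=> Sw P SP; rewrite -[0%N%:Z]add0r; apply: vgeM; last exact: Sw.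
  by have := vgeX m (Sz P SP); rewrite mulr0.
rewrite big_ord_recl expr0 mul1r => a0.
pose r := \sum_(l < M) z ^+ l * lcomb (a (lift ord0 l)) u.
have rE : lcomb (a ord0) u + z * r = 0.
  rewrite -[RHS]a0; congr (_ + _); rewrite mulr_sumr; apply: eq_bigr => l _.
  by rewrite mulrA -exprS.
have a00 j : a ord0 j = 0.
  apply: (fu (a ord0)); rewrite (_ : lcomb _ _ / z = - r).
    apply: (subspaceN sS); apply: (subspace_sum _ sS) => l _.
    by apply: SzX; apply: subspace_lcomb.
  by apply: (canLR (mulfK z0)); rewrite mulNr mulrC; apply/eqP; rewrite -addr_eq0 rE.
have r0 : r = 0.
  have lc0 : lcomb (a ord0) u = 0.
    by rewrite /lcomb big1 // => j _; rewrite a00 rmorph0 mul0r.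
  by move/eqP: rE; rewrite lc0 add0r mulf_eq0 (negPf z0) => /eqP.
move=> l; case: (unliftP ord0 l) => [l'|] -> //.
exact: (IHM (fun l => a (lift ord0 l))).
Qed.

End ZeroDivisorDegree.

(** * Zeros of functions and degrees of places *)

Section PlacesAndPolynomials.

Variables (F : fieldType) (E : fieldExtType {fraction {poly F}}).
Implicit Types (P Q : place E) (u z : E) (S : seq (place E)).

(** Otherwise P is trivial on F(x), and the powers of a uniformizer, having distinct orders, would
    be independent over F(x). *)
Lemma exists_poly_zero P : 0 <= ord P (polyE E 'X) ->
  exists h : {poly F}, h != 0 /\ 0 < ord P (polyE E h).
Proof.
move=> x_ge0; apply: contrapT => nh.
have h0 h : h != 0 -> ord P (polyE E h) = 0.
  move=> h0; apply/eqP; rewrite eq_le ord_polyE_ge0 // andbT leNgt.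
  by apply/negP => Ph; apply: nh; exists h.
have k0 (a : {fraction {poly F}}) : a != 0 -> ord P (a%:A) = 0.
  have [g [h [hn0 _ ->]]] := fraction_polyE E a => a0.
  have [->|g0] := eqVneq g 0; first by rewrite rmorph0 mul0r (Defs.val0 (ord_is_valuation P)).
  by rewrite ordF ?polyE_eq0 // !h0 // subr0.
have [t t0 Pt] := exists_uniformizer P.
have [c [c0 [j cj]]] := powers_dependent t.
have ordc i : c i != 0 -> ord P (c i *: t ^+ i) = i.
  move=> ci; rewrite -mulr_algl ordM ?expf_neq0 //; last first.
    by rewrite scaler_eq0 (negPf ci) oner_eq0.
  by rewrite k0 // add0r ordX // Pt mulr1.
have cn0 i : (c i *: t ^+ i != 0) = (c i != 0).
  by rewrite scaler_eq0 expf_eq0 (negPf t0) andbF orbF.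
have := ord_distinct_sum (P := P) (f := fun i => c i *: t ^+ i) _ c0 j.
move=> /(_ _)/eqP; rewrite scaler_eq0 expf_eq0 (negPf t0) andbF orbF (negPf cj).
move=> H; suff: false by []; apply: H => i i'; rewrite !inE !cn0 => ci ci' /=.
by rewrite !ordc // => -[] /val_inj.
Qed.

(** In a Bezout relation between q and g not both terms can lie in the maximal ideal. *)
Lemma ord_below_coprime P (q g : {poly F}) : irreducible_poly q ->
  0 <= ord P (polyE E 'X) -> 0 < ord P (polyE E q) -> ~~ (q %| g) ->
  ord P (polyE E g) = 0.
Proof.
move=> irr_q x_ge0 Pq; rewrite -irreducible_poly_coprime // => /Bezout_eq1_coprimepP[[u v] /= uv].
apply/eqP; rewrite eq_le ord_polyE_ge0 // andbT leNgt; apply/negP => Pg.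
have P1 h k : 0 < ord P (polyE E h) -> vge P 1 (polyE E (k * h)).
  rewrite gtz0_ge1 rmorphM -[X in vge P X]add0r => Ph.
  by apply: vgeM; [exact: vge_polyE|right].
apply: (@vge1_1 _ _ P); rewrite -(rmorph1 (polyE E)) -uv rmorphD.
by apply: vgeD; apply: P1.
Qed.

Lemma exists_zero_quotient P : exists A B : {poly F},
  [/\ A != 0, B != 0 & 0 < ord P (polyE E A / polyE E B)].
Proof.
have [x_ge0|x_lt0] := leP 0 (ord P (polyE E 'X)).
  have [h [h0 Ph]] := exists_poly_zero x_ge0; exists h, 1.
  by rewrite oner_eq0 rmorph1 divr1.
exists 1, 'X; rewrite oner_eq0 polyX_eq0; split=> //.
by rewrite rmorph1 mul1r ordV oppr_gt0.
Qed.

(** Elements independent modulo the maximal ideal are independent modulo a function vanishing at P,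
    so [zero_free_bound] bounds their number. Hence [place_degree] is never the default value of an
    infinite dimension. *)
Lemma place_degreeP P :
  has_reldim (valuation_ring P) (maximal_ideal P) (place_degree P).
Proof.
have sO : subspace (valuation_ring P) := subspace_vge P 0.
have sM : subspace (maximal_ideal P) by rewrite maximal_idealE; apply: subspace_vge.
have [A [B [A0 B0 PAB]]] := exists_zero_quotient P.
have [|f _ Pf] := @bounded_has_reldim _ _ (valuation_ring P) (maximal_ideal P)
   (\dim {:E} * maxn (size A) (size B))%N sO sM; last by rewrite /place_degree (reldimE sO sM Pf).
move=> k e Oe fe; have z0 : polyE E A / polyE E B != 0.
  by rewrite mulf_neq0 ?invr_eq0 ?polyE_eq0.
apply: (@zero_free_bound _ _ [:: P] A B _ k e) => //.
- exact: leq_trans (leq_maxl _ _) (leqnSn _).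
- exact: leq_trans (leq_maxr _ _) (leqnSn _).
- by move=> Q; rewrite inE => /eqP ->; right; apply: ltW.
- by move=> i Q; rewrite inE => /eqP ->; apply: Oe.
move=> a /(_ P (mem_head _ _)) Pa; apply: fe; rewrite maximal_idealE.
rewrite -[lcomb a e](divfK z0) -[X in vge P X]add0r; apply: vgeM => //.
by right; rewrite -gtz0_ge1.
Qed.

Lemma place_degree_gt0 P : (0 < place_degree P)%N.
Proof.
rewrite lt0n; apply/eqP => d0; have := place_degreeP P; rewrite d0.
case=> e [_ /(_ 1 (vge1 P))[a [+ _]]]; rewrite big_ord0 subr0 maximal_idealE.
exact: vge1_1.
Qed.

(** The sum is the dimension of the semilocal ring of S modulo the elements vanishing to the order
    of z on S. A basis of this quotient is independent modulo z, so [zero_free_bound] applies. *)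
Lemma zero_degree_le S (A B : {poly F}) (d : nat) :
    A != 0 -> B != 0 -> (size A <= d.+1)%N -> (size B <= d.+1)%N -> uniq S ->
    (forall P, P \in S -> 0 < ord P (polyE E A / polyE E B)) ->
  (\sum_(P <- S) `|ord P (polyE E A / polyE E B)| * place_degree P <= \dim {:E} * d)%N.
Proof.
move=> A0 B0 szA szB uS Sz; set z := polyE E A / polyE E B in Sz *.
have z0 : z != 0 by rewrite mulf_neq0 ?invr_eq0 ?polyE_eq0.
pose c P := `|ord P z|%N.
have := semilocal_reldim c uS (fun P _ => ex_intro _ _ (place_degreeP P)).
case/has_reldimP; [exact: subspace_semilocal|exact: subspace_semilocal|].
move=> e [Ue fe _]; apply: (zero_free_bound (u := e) A0 B0 szA szB) => //.
  by move=> P SP; right; apply/ltW/Sz.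
move=> a Sa; apply: fe => P SP; rewrite -[lcomb a e](divfK z0) -[X in vge P X]add0r.
apply: vgeM; first exact: Sa.
by right; rewrite /c gez0_abs // ltW // Sz.
Qed.

Lemma finite_zeros (A B : {poly F}) : A != 0 -> B != 0 ->
  finite_set [set P : place E | 0 < ord P (polyE E A / polyE E B)]%classic.
Proof.
move=> A0 B0; apply: contrapT => inf; pose d := maxn (size A) (size B).
have [X Xz] := infinite_set_fset (\dim {:E} * d).+1 inf; rewrite ltnNge => /negP[].
have := @zero_degree_le X A B d A0 B0 _ _ (fset_uniq X).
move=> /(_ (leq_trans (leq_maxl _ _) (leqnSn _)) (leq_trans (leq_maxr _ _) (leqnSn _))).
have Xpos P : P \in X -> 0 < ord P (polyE E A / polyE E B) by move=> /Xz.
move=> /(_ Xpos); apply: leq_trans; rewrite -sum1_size !big_seq; apply: leq_sum => P /Xpos.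
by move=> Pz; rewrite muln_gt0 place_degree_gt0 andbT absz_gt0 gt_eqF.
Qed.

End PlacesAndPolynomials.

(** * Riemann-Roch spaces and the pole divisor of x *)

Section RiemannInequality.

Variables (F : fieldType) (E : fieldExtType {fraction {poly F}}).
Implicit Types (P Q : place E) (u z : E) (S : seq (place E)) (c : place E -> int).

(** Finite support is not imposed on [c], so that D minus the divisor of a function can be used
    directly. *)
Definition rrspace c : set E := fun z => forall P, vge P (- c P) z.

Lemma riemann_roch_spaceE (D : divisor E) : riemann_roch_space D = rrspace D.
Proof.
apply: funext => z; apply/propext; split=> [[->|Dz] P|Dz]; [by left|by right|].
by have [->|z0] := eqVneq z 0; [left|right=> P; apply/vgeP].
Qed.

Lemma subspace_rrspace c : subspace (rrspace c).
Proof.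
split=> [P|u v Du Dv P|a u Du P]; first by left.
  by apply: vgeD; [apply: Du|apply: Dv].
exact: (subspaceZ (subspace_vge P _)).
Qed.

Lemma subspace_zero : subspace (fun z : E => z = 0).
Proof. by split=> [|x y -> ->|x y ->]; rewrite ?addr0 ?mulr0. Qed.

Let dimL c n := has_reldim (rrspace c) (fun z : E => z = 0) n.

Lemma rrspace_sub c c' : (forall P, c P <= c' P) -> (rrspace c `<=` rrspace c')%classic.
Proof. by move=> cc' z Dz P; apply: vge_le (Dz P); rewrite lerN2. Qed.

(** Multiplication by [t ^ c' P], t a uniformizer, embeds L(D + P)/L(D) into the residue field of
    P. *)
Lemma rrspace_step c c' P a : (forall Q, c' Q = c Q + (Q == P)%:Z) -> dimL c a ->
  exists b, dimL c' b /\ (b <= a + place_degree P)%N.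
Proof.
move=> c'E ca; have [t t0 Pt] := exists_uniformizer P.
have s1 := subspace_rrspace c; have s2 := subspace_rrspace c'.
have cc' : (rrspace c `<=` rrspace c')%classic.
  by apply: rrspace_sub => Q; rewrite c'E; lia.
have [m mP c'm] : exists2 m, (m <= place_degree P)%N & has_reldim (rrspace c') (rrspace c) m.
  apply: bounded_has_reldim => // k e c'e fe.
  have tc0 : t ^ c' P != 0 by rewrite expfz_neq0.
  have ordt i : vge P i (t ^ i) by right; rewrite ordXz // Pt mulr1.
  rewrite -[k]card_ord.
  apply: (has_reldim_free (f := fun i => t ^ c' P * e i) _ _ (place_degreeP P)).
  - exact: (subspace_vge P 0).
  - by rewrite maximal_idealE; apply: subspace_vge.
  - by move=> i; rewrite /valuation_ring -(subrr (c' P)); apply: vgeM; [|apply: c'e].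
  move=> b; rewrite maximal_idealE => Pb; apply: fe => Q.
  have [->|QP] := eqVneq Q P; last first.
    by have := subspace_lcomb b s2 c'e Q; rewrite c'E (negPf QP) addr0.
  have lE : lcomb b (fun i => t ^ c' P * e i) = t ^ c' P * lcomb b e.
    by rewrite /lcomb mulr_sumr; apply: eq_bigr => i _; rewrite mulrCA.
  rewrite -[lcomb b e](mulKf tc0) -lE invr_expz.
  by have := vgeM (ordt (- c' P)) Pb; rewrite c'E eqxx opprD subrK.
exists (m + a)%N; split; last by rewrite addnC leq_add2l.
apply: (has_reldim_add (V := rrspace c)) => //; first exact: subspace_zero.
by move=> _ -> Q; left.
Qed.

Lemma rrspace_raise S c c' a : uniq S -> (forall P, c P <= c' P) ->
    (forall P, P \notin S -> c P = c' P) -> dimL c a ->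
  exists b, dimL c' b /\
    b%:Z <= a%:Z + \sum_(P <- S) (c' P - c P) * (place_degree P)%:Z.
Proof.
elim: S c a => [|P S IHS] c a /=.
  move=> _ _ cc' ca; exists a; rewrite big_nil addr0 lexx; split=> //.
  by rewrite (_ : c' = c) //; apply: funext => P; rewrite cc'.
move=> /andP[SP uS] cc' c_eq ca.
have raise k : exists b, dimL (fun Q => c Q + ((Q == P) * k)%N%:Z) b /\
    (b <= a + k * place_degree P)%N.
  elim: k => [|k [b [cb ba]]].
    exists a; rewrite mul0n addn0 leqnn; split=> //.
    by rewrite (_ : (fun Q => _) = c) //; apply: funext => Q; rewrite muln0 addr0.
  have [|b' [cb' bb']] :=
      @rrspace_step _ (fun Q => c Q + ((Q == P) * k.+1)%N%:Z) P b _ cb.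
    by move=> Q; rewrite mulnS PoszD; lia.
  by exists b'; split=> //; rewrite mulSn; lia.
have [b [cb ba]] := raise `|c' P - c P|%N.
have [|Q|b' [cb' b'b]] := IHS _ b uS _ _ cb.
- by move=> Q; have [->|QP] := eqVneq Q P; have := cc' Q; have := cc' P; lia.
- have [-> _|QP SQ] := eqVneq Q P; first by have := cc' P; lia.
  by rewrite mul0n addr0 c_eq // inE negb_or QP.
exists b'; split=> //; apply: le_trans b'b _; rewrite big_cons.
rewrite (eq_big_seq (fun Q => (c' Q - c Q) * (place_degree Q)%:Z)); last first.
  by move=> Q SQ /=; case: eqP => [QP|_]; [rewrite -QP SQ in SP|rewrite mul0n addr0].
rewrite addrA lerD2r.
have -> : c' P - c P = `|c' P - c P|%N by have := cc' P; lia.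
by rewrite -PoszM -PoszD lez_nat.
Qed.

Lemma rrspace_finite_sub c c' n : (forall P, c P <= c' P) -> dimL c' n ->
  exists m, dimL c m.
Proof.
move=> cc' c'n; have s1 := subspace_rrspace c; have s2 := subspace_rrspace c'.
have [|m _ cm] := @bounded_has_reldim _ _ (rrspace c) _ n s1 subspace_zero; last by exists m.
move=> k e ce fe; rewrite -[k]card_ord.
by apply: has_reldim_free c'n _ fe => // [|i]; [exact: subspace_zero|apply: rrspace_sub (ce i)].
Qed.

Lemma rrspace_mul c h a : h != 0 -> dimL c a -> dimL (fun P => c P - ord P h) a.
Proof.
move=> h0; apply: (has_reldim_iso (c := h^-1)); try exact: subspace_rrspace;
  try exact: subspace_zero.
- move=> z Dz P; rewrite (_ : - c P = ord P h^-1 + - (c P - ord P h)).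
    by apply: vgeM; [exact: vge_ord|apply: Dz].
  by rewrite ordV; lia.
- by move=> z Dz; split=> [/eqP|->]; rewrite ?mulr0 // mulf_eq0 invr_eq0 (negPf h0) => /eqP.
move=> v Dv; exists (h * v); last by rewrite mulKf // subrr.
move=> P; rewrite opprB addrC; rewrite [- _ + _]addrC.
by apply: vgeM; [exact: vge_ord|apply: Dv].
Qed.

Lemma sum_support (V : nmodType) (T : eqType) (A B : seq T) (f : T -> V) :
    uniq A -> uniq B -> {subset A <= B} -> (forall i, i \notin A -> f i = 0) ->
  \sum_(i <- A) f i = \sum_(i <- B) f i.
Proof.
move=> uA uB AB fA; rewrite [RHS](bigID (mem A)) /= [X in _ = _ + X]big1 //.
rewrite addr0 -[RHS]big_filter; apply: perm_big.
apply: uniq_perm; rewrite ?filter_uniq // => P; rewrite mem_filter.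
by case: (boolP (P \in A)) => //= /AB ->.
Qed.

Lemma degreeE (D : divisor E) S : uniq S -> {subset finsupp D <= S} ->
  degree D = \sum_(P <- S) D P * (place_degree P)%:Z.
Proof.
move=> uS DS; apply: sum_support => // P PD.
by rewrite fsfun_dflt ?mul0r.
Qed.

Definition pole_order_X P : int := Num.max 0 (- ord P (polyE E 'X)).

Lemma finite_X_poles : finite_set [set P : place E | ord P (polyE E 'X) < 0]%classic.
Proof.
have := finite_zeros E (oner_neq0 {poly F}) (negbT (polyX_eq0 F)).
by congr finite_set; apply/funext => P; rewrite /= rmorph1 mul1r ordV oppr_gt0.
Qed.

Definition X_poles : {fset place E} := fset_set [set P : place E | ord P (polyE E 'X) < 0]%classic.

Lemma mem_X_poles P : (P \in X_poles) = (ord P (polyE E 'X) < 0).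
Proof.
rewrite /X_poles in_fset_set; last exact: finite_X_poles.
by apply/idP/idP; rewrite in_setE.
Qed.

Lemma pole_order_out P : P \notin X_poles -> pole_order_X P = 0.
Proof. by rewrite mem_X_poles -leNgt => x_ge0; apply/max_idPl; rewrite oppr_le0. Qed.

Lemma pole_order_in P : P \in X_poles -> pole_order_X P = - ord P (polyE E 'X).
Proof. by rewrite mem_X_poles => x_lt0; apply/max_idPr; rewrite oppr_ge0 ltW. Qed.

Lemma pole_order_ge0 P : 0 <= pole_order_X P.
Proof. by rewrite le_max lexx. Qed.

Definition pole_divisor (k : nat) : divisor E :=
  [fsfun P in X_poles => k%:Z * pole_order_X P].

Lemma pole_divisorE k P : pole_divisor k P = k%:Z * pole_order_X P.
Proof.
by rewrite fsfunE; case: ifPn => // /pole_order_out ->; rewrite mulr0.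
Qed.

Lemma pole_degree_le :
  \sum_(P <- X_poles) pole_order_X P * (place_degree P)%:Z <= (\dim {:E})%:Z.
Proof.
have := @zero_degree_le _ E X_poles 1 'X 1 (oner_neq0 _) (negbT (polyX_eq0 F)) _ _ (fset_uniq _).
rewrite size_poly1 size_polyX rmorph1 mul1r muln1 => /(_ isT isT).
have Xp P : P \in X_poles -> 0 < ord P (polyE E 'X)^-1.
  by rewrite mem_X_poles ordV oppr_gt0.
move=> /(_ Xp); rewrite -lez_nat; apply: le_trans.
rewrite (big_morph Posz PoszD (erefl _)) big_seq [X in _ <= X]big_seq.
apply: ler_sum => P PX; rewrite PoszM gtz0_abs ?Xp //.
by rewrite ordV pole_order_in.
Qed.

Lemma pole_divisor_supp k : {subset finsupp (pole_divisor k) <= X_poles}.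
Proof.
move=> P; rewrite mem_finsupp pole_divisorE; apply: contraNT => /pole_order_out ->.
by rewrite mulr0.
Qed.

(** * Riemann's inequality from the spaces L(k (x)_oo) *)

Variables (g k0 : nat) (l : nat -> nat).
Hypothesis dim_pole : forall k, (k0 <= k)%N -> dimL (pole_divisor k) (l k).
Hypothesis l_eq : forall k, (k0 <= k)%N ->
  (l k)%:Z = k%:Z * (\dim {:E})%:Z - g%:Z + 1.

(** Passing from k0 to k0 + 1 raises the dimension by [E : F(x)], yet by at most the degree of
    (x)_oo; the other inequality is [pole_degree_le]. *)
Lemma pole_degree :
  \sum_(P <- X_poles) pole_order_X P * (place_degree P)%:Z = (\dim {:E})%:Z.
Proof.
apply/eqP; rewrite eq_le pole_degree_le /=.
have [||b [cb bl]] := rrspace_raise (fset_uniq X_poles) _ _ (dim_pole (leqnn k0))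
   (c' := pole_divisor k0.+1).
- by move=> P; rewrite !pole_divisorE; have := pole_order_ge0 P; nia.
- by move=> P /pole_order_out PX; rewrite !pole_divisorE PX !mulr0.
have := has_reldim_uniq (subspace_rrspace _) subspace_zero cb (dim_pole (leqnSn k0)).
move=> bE; move: bl; rewrite bE !l_eq //.
have -> : \sum_(P <- X_poles) (pole_divisor k0.+1 P - pole_divisor k0 P) * (place_degree P)%:Z
    = \sum_(P <- X_poles) pole_order_X P * (place_degree P)%:Z.
  by apply: eq_bigr => P _; rewrite !pole_divisorE -mulrBl -addn1 PoszD addrC addKr mul1r.
rewrite -addn1 PoszD mulrDl mul1r.
by move: (\sum_(P <- _) _) (\dim _)%:Z => x y; lia.
Qed.

Lemma pole_divisor_degree k : degree (pole_divisor k) = k%:Z * (\dim {:E})%:Z.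
Proof.
rewrite (degreeE (fset_uniq X_poles) (@pole_divisor_supp k)) -pole_degree mulr_sumr.
by apply: eq_bigr => P _; rewrite pole_divisorE mulrA.
Qed.

Lemma ellE (D : divisor E) m : dimL D m -> ell D = m.
Proof.
rewrite /ell riemann_roch_spaceE => Dm.
exact: reldimE (subspace_rrspace _) subspace_zero Dm.
Qed.

Lemma exists_dominating_poly (D : divisor E) : exists h : {poly F}, h != 0 /\
  forall P, 0 <= ord P (polyE E 'X) -> D P <= ord P (polyE E h).
Proof.
have /choice[hp hpP] P : exists h : {poly F}, h != 0 /\
    (0 <= ord P (polyE E 'X) -> 0 < ord P (polyE E h)).
  have [/exists_poly_zero[h [h0 Ph]]|x_lt0] := leP 0 (ord P (polyE E 'X)).
    by exists h.
  by exists 1; rewrite oner_eq0.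
pose h := \prod_(P <- finsupp D) hp P ^+ `|D P|.
have hp0 P : hp P != 0 by case: (hpP P).
exists h; split=> [|P x_ge0].
  by rewrite /h prodf_seq_neq0; apply/allP => P _; rewrite expf_neq0.
have [PD|PD] := boolP (P \in finsupp D); last by rewrite fsfun_dflt // ord_polyE_ge0.
rewrite /h rmorph_prod ord_prod => [|Q _]; last by rewrite polyE_eq0 expf_neq0.
rewrite (big_fsetD1 P) //= -[D P]addr0; apply: lerD.
  rewrite rmorphXn ordX ?polyE_eq0 //; have [_ /(_ x_ge0)] := hpP P.
  by move: (ord P _) => i; nia.
by apply: sumr_ge0 => Q _; rewrite ord_polyE_ge0.
Qed.

(** With d = deg h, the zeros have degree at most d [E : F(x)] by [zero_degree_le], and the pole
    divisor d (x)_oo has exactly this degree. *)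
Lemma principal_degree_le (h : {poly F}) S : h != 0 -> uniq S ->
    {subset X_poles <= S} -> (forall P, 0 < ord P (polyE E h) -> P \in S) ->
  \sum_(P <- S) ord P (polyE E h) * (place_degree P)%:Z <= 0.
Proof.
move=> h0 uS XS ZS; set d := (size h).-1.
pose Z := fset_set [set P : place E | 0 < ord P (polyE E h / polyE E 1)]%classic.
have inZ P : (P \in Z) = (0 < ord P (polyE E h)).
  rewrite /Z in_fset_set; last exact: finite_zeros (oner_neq0 _).
  by apply/idP/idP; rewrite in_setE rmorph1 divr1.
pose pos P := if P \in Z then ord P (polyE E h) else 0.
have ordE P : ord P (polyE E h) = pos P - d%:Z * pole_order_X P.
  rewrite /pos inZ; have [x_lt0|x_ge0] := ltP (ord P (polyE E 'X)) 0.
    rewrite pole_order_in ?mem_X_poles // ord_polyE_inf // -/d.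
    by case: ltP; nia.
  rewrite pole_order_out ?mem_X_poles -?leNgt // mulr0 subr0.
  by have := ord_polyE_ge0 h x_ge0; case: ltP => //; lia.
rewrite (eq_bigr (fun P => pos P * (place_degree P)%:Z -
    d%:Z * (pole_order_X P * (place_degree P)%:Z))); last first.
  by move=> P _; rewrite {1}ordE mulrBl mulrA.
have SX : \sum_(P <- S) pole_order_X P * (place_degree P)%:Z = (\dim {:E})%:Z.
  rewrite -pole_degree; symmetry; apply: sum_support => // P /pole_order_out ->.
  by rewrite mul0r.
have SZ : \sum_(P <- S) pos P * (place_degree P)%:Z =
    \sum_(P <- Z) pos P * (place_degree P)%:Z.
  symmetry; apply: sum_support => // [P|P PZ]; first by rewrite inZ; apply: ZS.
  by rewrite /pos (negPf PZ) mul0r.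
rewrite sumrB -mulr_sumr SX SZ subr_le0.
have := @zero_degree_le _ E Z h 1 d h0 (oner_neq0 _) _ _ (fset_uniq _).
rewrite prednK ?size_poly_gt0 // size_poly1 rmorph1 divr1 size_poly_gt0.
move=> /(_ (leqnn _) h0).
have Zh P : P \in Z -> 0 < ord P (polyE E h) by rewrite inZ.
move=> /(_ Zh); rewrite [(d%:Z * _)]mulrC -PoszM -lez_nat; apply: le_trans.
rewrite (big_morph Posz PoszD (erefl _)) big_seq [X in _ <= X]big_seq.
by apply: ler_sum => P PZ; rewrite PoszM gtz0_abs ?Zh // /pos PZ.
Qed.

(** For suitable h and k, D - div h <= k (x)_oo. Raising the first divisor to the second gives l(k
    (x)_oo) <= l(D) + deg(k (x)_oo) - deg D + deg(div h), where deg(div h) <= 0. The maximum is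
    attained at k0 (x)_oo. *)
Lemma is_genus_of_pole_spaces : is_genus E g.
Proof.
split; last first.
  exists (pole_divisor k0); rewrite (ellE (dim_pole (leqnn _))) l_eq //.
  by rewrite pole_divisor_degree; lia.
move=> D; have [h [h0 Dh]] := exists_dominating_poly D.
(* At a pole of x the sum accounts for D and [(size h).-1] for the pole of h. *)
pose k := (k0 + \sum_(P <- finsupp D) `|D P| + (size h).-1)%N.
have hE0 : polyE E h != 0 by rewrite polyE_eq0.
pose D1 P := D P - ord P (polyE E h).
have D1k P : D1 P <= pole_divisor k P.
  rewrite pole_divisorE /D1; have [x_lt0|x_ge0] := ltP (ord P (polyE E 'X)) 0; last first.
    have := pole_order_ge0 P; have := Dh P x_ge0; nia.
  rewrite pole_order_in ?mem_X_poles // ord_polyE_inf //.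
  have DP : (`|D P| <= \sum_(P <- finsupp D) `|D P|)%N.
    have [PD|PD] := boolP (P \in finsupp D); last by rewrite fsfun_dflt.
    by rewrite (big_fsetD1 P) //= leq_addr.
  have : (`|D P| + (size h).-1 <= k)%N by rewrite /k; lia.
  move: k (size h).-1 (ord P _) x_lt0 (D P) => k' d v v0 e; nia.
have k0k : (k0 <= k)%N by rewrite /k; lia.
pose Z := fset_set [set P : place E | 0 < ord P (polyE E h / polyE E 1)]%classic.
have inZ P : (P \in Z) = (0 < ord P (polyE E h)).
  rewrite /Z in_fset_set; last exact: finite_zeros (oner_neq0 _).
  by apply/idP/idP; rewrite in_setE rmorph1 divr1.
pose S := (finsupp D `|` X_poles `|` Z)%fset.
have [m D1m] := rrspace_finite_sub D1k (dim_pole k0k).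
have Dm : dimL D m.
  have := rrspace_mul (invr_neq0 hE0) D1m; congr (has_reldim (rrspace _) _ _).
  by apply: funext => P; rewrite /D1 ordV; lia.
have [|b [kb bm]] := rrspace_raise (fset_uniq S) D1k _ D1m.
  move=> P; rewrite !inE !negb_or inZ -leNgt => /andP[/andP[PD PX] Ph].
  have x_ge0 : 0 <= ord P (polyE E 'X) by rewrite leNgt -mem_X_poles.
  rewrite pole_divisorE (pole_order_out PX) mulr0 /D1 fsfun_dflt //.
  by have := ord_polyE_ge0 h x_ge0; lia.
have bE := has_reldim_uniq (subspace_rrspace _) subspace_zero kb (dim_pole k0k).
rewrite (ellE Dm); move: bm; rewrite bE l_eq //.
have sumE : \sum_(P <- S) (pole_divisor k P - D1 P) * (place_degree P)%:Z =
    k%:Z * (\dim {:E})%:Z - degree D + \sum_(P <- S) ord P (polyE E h) * (place_degree P)%:Z.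
  rewrite -pole_divisor_degree !(degreeE (fset_uniq S)).
  - rewrite -sumrB -big_split /=; apply: eq_bigr => P _; rewrite /D1; lia.
  - by move=> P PD; rewrite !inE PD.
  by move=> P /pole_divisor_supp PX; rewrite !inE PX orbT.
rewrite sumE; have := @principal_degree_le h S h0 (fset_uniq S) _ _.
have XS : {subset X_poles <= S} by move=> P PX; rewrite !inE PX orbT.
have ZS P : 0 < ord P (polyE E h) -> P \in S by rewrite -inZ !inE => ->; rewrite orbT.
move=> /(_ XS ZS); move: (\sum_(P <- S) _) (k%:Z * _) (degree D) => x y z.
by lia.
Qed.

End RiemannInequality.

(** * Sums of floors *)

Section FloorSum.

Lemma sum_dvdn_multiples (d k : nat) : (0 < d)%N ->
  (\sum_(j < d * k) (d %| j) = k)%N.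
Proof.
move=> d0; elim: k => [|k IHk]; first by rewrite muln0 big_ord0.
rewrite mulnSr big_split_ord /= IHk (bigD1 (Ordinal d0)) //= addn0 dvdn_mulr //.
rewrite big1 ?addn1 // => i i0; rewrite dvdn_addr ?dvdn_mulr // gtnNdvd //.
by rewrite lt0n; apply: contra i0 => /eqP i0; apply/eqP/val_inj.
Qed.

(** With e = gcd(a, n), n divides j a exactly when n/e divides j. *)
Lemma sum_dvdn_mul (n a : nat) : (0 < n)%N ->
  (\sum_(j < n) (n %| j * a) = gcdn a n)%N.
Proof.
move=> n0; set e := gcdn a n; have e0 : (0 < e)%N by rewrite gcdn_gt0 n0 orbT.
have [n' nE] : exists n', n = (n' * e)%N by apply/dvdnP/dvdn_gcdr.
have [a' aE] : exists a', a = (a' * e)%N by apply/dvdnP/dvdn_gcdl.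
have cop : coprime n' a'.
  rewrite coprime_sym; have : gcdn (a' * e) (n' * e) = e by rewrite -aE -nE.
  by rewrite -muln_gcdl -[X in _ = X -> _]mul1n => /eqP; rewrite eqn_pmul2r.
have n'0 : (0 < n')%N by move: n0; rewrite nE muln_gt0 => /andP[].
rewrite -[RHS](sum_dvdn_multiples e n'0) -nE; apply: eq_bigr => j _.
by rewrite aE {1}nE mulnA dvdn_pmul2r // Gauss_dvdl.
Qed.

Lemma floor_add_opp (x n : int) : 0 < n ->
  (x %/ n)%Z + ((- x) %/ n)%Z = (n %| x)%Z%:Z - 1.
Proof.
move=> n0; have nn0 : n != 0 by rewrite gt_eqF.
have xE := divz_eq x n; have r_ge0 := modz_ge0 x nn0; have r_lt := ltz_pmod x n0.
have [/dvdz_mod0P nx|/dvdz_mod0P nx] := boolP (n %| x)%Z.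
  have -> : - x = (- (x %/ n)%Z) * n by rewrite {1}xE nx addr0 mulNr.
  by rewrite mulzK //; lia.
have -> : - x = (- (x %/ n)%Z - 1) * n + (n - (x %% n)%Z).
  by rewrite {1}xE; ring.
rewrite divzMDl // [((n - _) %/ n)%Z]divz_small; first by lia.
by rewrite gtz0_abs //; lia.
Qed.

(** The terms of index j and n - j add up to a - 1, or to a if n divides j a; [sum_dvdn_mul] counts
    the latter case. *)
Lemma floor_sum (n : nat) (a : int) : (0 < n)%N ->
  (\sum_(j < n) (j%:Z * a %/ n%:Z)%Z) * 2 = a * (n%:Z - 1) - n%:Z + (gcdn `|a| n)%:Z.
Proof.
case: n => // n _; rewrite big_ord_recl mul0r div0z add0r.
have pair (i : 'I_n) : ((lift ord0 i)%:Z * a %/ n.+1%:Z)%Z +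
    ((lift ord0 (rev_ord i))%:Z * a %/ n.+1%:Z)%Z =
    a - 1 + (n.+1 %| lift ord0 i * `|a|)%N%:Z.
  have -> : (lift ord0 (rev_ord i))%:Z * a = a * n.+1%:Z + - ((lift ord0 i)%:Z * a).
    have -> : (lift ord0 (rev_ord i))%:Z = n.+1%:Z - (lift ord0 i)%:Z.
      by rewrite !lift0 /=; have := ltn_ord i; move: (nat_of_ord i) => k; lia.
    by ring.
  rewrite divzMDl // addrCA floor_add_opp //.
  by rewrite dvdzE abszM /=; lia.
have := sum_dvdn_mul `|a|%N (ltn0Sn n); rewrite big_ord_recl mul0n dvdn0 /= => gE.
rewrite mulr_natr mulr2n [X in _ + X](reindex_inj rev_ord_inj) /= -big_split /=.
rewrite (eq_bigr _ (fun i _ => pair i)) big_split /= sumr_const card_ord -gE.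
rewrite PoszD -(big_morph Posz PoszD (erefl _)) -[_ *+ n]mulr_natr.
move: (\sum_(i < n) _)%N => S.
by lia.
Qed.

End FloorSum.

(** * Integer inequalities for orders at places *)

Section PoleEstimates.

Implicit Types (n u v s e k m q : int).

Lemma denominator_absurd n u v s : 0 < n -> 0 < u -> u <= v ->
  s <= u * (n - 1) -> 0 <= n * (- v) + s -> False.
Proof.
move=> n0 u0 uv su sv; have : n * u <= n * v by rewrite ler_pM2l.
lia.
Qed.

Lemma pole_bound_suff n v e s k m q : 0 < n -> v < 0 -> q * n <= - e ->
  m <= k + s + q -> n * - (k * - v) <= n * (m * v) + v * (e - n * s).
Proof.
move=> n0 v0 qe mq; suff : 0 <= (- v) * (n * (k - m) - e + n * s) by lia.
by apply: mulr_ge0; [lia|nia].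
Qed.

Lemma pole_bound_nec n v e s k m : v < 0 ->
  n * - (k * - v) <= n * (m * v) + v * (e - n * s) -> (m - k - s) * n <= - e.
Proof.
move=> v0 le1; have : 0 <= (- v) * (- e - (m - k - s) * n) by lia.
by rewrite pmulr_rge0 ?oppr_gt0 // subr_ge0.
Qed.

Lemma size_bound_regroup (z : nat) k s q : (0 < z)%N ->
  z.-1%:Z - k - s <= q -> z%:Z <= k + s + q + 1.
Proof. by move=> z0 zq; lia. Qed.

Lemma lt_absz_max (m : nat) (D : int) :
  (m < `|Num.max 0%R (D + 1)%R|)%N -> m%:Z <= D.
Proof. by rewrite maxElt; case: ifP; lia. Qed.

Lemma le_absz_max (m : nat) (D : int) :
  m%:Z <= D + 1 -> (m <= `|Num.max 0%R (D + 1)%R|)%N.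
Proof. by rewrite maxElt; case: ifP; lia. Qed.

Lemma eq1_of_sum_le (o f r N : nat) :
  (0 < N -> N.-1 <= r -> 0 < o -> 0 < f -> o * f + r <= N -> f = 1)%N.
Proof. by move=> N0 Nr o0 f0 le; have : (o * f <= 1)%N; [lia|nia]. Qed.

End PoleEstimates.

(** * Elements of E coming from F(x) *)

Section BaseFieldElements.

Variables (F : fieldType) (E : fieldExtType {fraction {poly F}}).

Lemma exprz_polyE_base (h : {poly F}) (m : int) :
  exists b : {fraction {poly F}}, polyE E h ^ m = b%:A.
Proof.
by exists (tofrac h ^ m); rewrite -[RHS]/(in_alg E _) fmorphXz; congr (_ ^ _).
Qed.

Lemma prod_exprz_polyE_base (I : finType) (g : I -> {poly F}) (m : I -> int) :
  exists b : {fraction {poly F}}, \prod_i polyE E (g i) ^ m i = b%:A.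
Proof.
elim/big_rec: _ => [|i x _ [b ->]]; first by exists 1; rewrite scale1r.
have [d ->] := exprz_polyE_base (g i) (m i); exists (d * b).
by rewrite mulr_algl scalerA.
Qed.

Lemma polyE_div_base (g : {poly F}) (b : {fraction {poly F}}) :
  exists d : {fraction {poly F}}, polyE E g / b%:A = d%:A.
Proof.
by exists (tofrac g / b); rewrite -[RHS]/(in_alg E _) rmorphM fmorphV; congr (_ / _).
Qed.

End BaseFieldElements.

(** * Power sums over a finite field *)

Section FiniteFieldPowerSums.

Variables (F : finFieldType) (n : nat).
Hypothesis cardF : #|F| = n.+1.

Lemma unit_power_n (x : F) : x != 0 -> x ^+ n = 1.
Proof.
move=> x0; apply: (mulfI x0); rewrite mulr1 -exprS -cardF.
exact: expf_card.
Qed.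

Lemma card_pred_gt0 : (0 < n)%N.
Proof. by have := finNzRing_gt1 F; rewrite cardF. Qed.

Lemma natr_card_pred : n%:R = -1 :> F.
Proof.
have := @expg_cardG _ [set: F]%G (1%R : F) (finset.in_setT _).
rewrite cardsT cardF => H; have {}H : 1%:R + n%:R = 0 :> F by rewrite -mulrS.
by apply/eqP; rewrite -addr_eq0 addrC H.
Qed.

(** If n does not divide m, some nonzero x has x^m != 1, and multiplying the sum by x^m permutes its
    terms. *)
Lemma sum_unit_powers (m : nat) :
  \sum_(x : F | x != 0) x ^+ m = if (n %| m)%N then -1 else 0.
Proof.
case: ifPn => [/dvdnP[k ->]|nm].
  rewrite (eq_bigr (fun=> 1)) => [|x x0]; last first.
    by rewrite mulnC exprM unit_power_n // expr1n.
  rewrite sumr_const -natr_card_pred; congr (_ *+ _).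
  have := cardC1 (0 : F); rewrite cardF => /= <-.
  by apply: eq_card => x; rewrite !inE.
have n0 := card_pred_gt0; pose r := (m %% n)%N.
have powr (x : F) : x != 0 -> x ^+ m = x ^+ r.
  by move=> x0; rewrite {1}(divn_eq m n) exprD mulnC exprM unit_power_n // expr1n mul1r.
have r0 : (0 < r)%N by rewrite lt0n.
have rn : (r < n)%N by rewrite ltn_mod.
have [x [x0 xr]] : exists x : F, x != 0 /\ x ^+ r != 1.
  apply: contrapT => nx; pose p : {poly F} := 'X^r - 1.
  have p0 : p != 0 by rewrite -size_poly_gt0 size_XnsubC.
  have := @max_poly_roots _ p (enum (predC1 (0 : F))) p0.
  rewrite enum_uniq size_XnsubC // -cardE cardC1 cardF /= ltnS => H.
  suff : (n <= r)%N by rewrite leqNgt rn.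
  apply: H => //; apply/allP => x; rewrite mem_enum inE => x0.
  rewrite rootE !hornerE subr_eq0; apply: contrapT => /negP xr.
  by apply: nx; exists x.
rewrite (eq_bigr (fun x => x ^+ r)) => [|z /powr //].
apply/eqP; have : (x ^+ r - 1) * \sum_(z : F | z != 0) z ^+ r = 0.
  rewrite mulrBl mul1r [X in _ - X](reindex_inj (mulfI x0)) /= mulr_sumr.
  rewrite [X in _ - X](eq_bigl (fun z => z != 0)) => [|z]; last by rewrite mulf_eq0 (negPf x0).
  by rewrite [X in _ - X](eq_bigr (fun z => x ^+ r * z ^+ r)) ?subrr // => z _; rewrite exprMn.
by move=> /eqP; rewrite mulf_eq0 subr_eq0 (negPf xr).
Qed.

End FiniteFieldPowerSums.

(** * Ramification in a Kummer extension *)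

Section KummerExtension.

Variables (F : finFieldType) (E : fieldExtType {fraction {poly F}}) (y : E) (n : nat).
Variables (I : finType) (g : I -> {poly F}) (a : I -> int) (c : F) (i0 : I).
Hypotheses (cardF : #|F| = n.+1) (genE : <<1; y>>%VS = {:E}%VS).
Hypotheses (c0 : c != 0) (sep_g : separable_poly (\prod_i g i)).
Hypothesis eqC : y ^+ n = constE E c * \prod_i polyE E (g i) ^ a i.
Hypotheses (cop0 : coprime `|a i0| n) (g0_gt1 : (1 < size (g i0))%N).

Let n_gt0 : (0 < n)%N := card_pred_gt0 cardF.

Lemma factor_neq0 i : g i != 0.
Proof.
by have /prodf_neq0 := separable_poly_neq0 sep_g; apply.
Qed.

Let gE0 i : polyE E (g i) != 0. Proof. by rewrite polyE_eq0 factor_neq0. Qed.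

Lemma kummer_gen_neq0 : y != 0.
Proof.
apply/eqP => y0; move/eqP: eqC; rewrite y0 expr0n gtn_eqF //= eq_sym mulf_eq0.
rewrite fmorph_eq0 (negPf c0) /=; apply/negP/prodf_neq0 => i _.
by rewrite expfz_neq0 ?gE0.
Qed.

Let y0 := kummer_gen_neq0.

Lemma kummer_ord P : n%:Z * ord P y = \sum_i a i * ord P (polyE E (g i)).
Proof.
rewrite -ordX // eqC ordM ?fmorph_eq0 //; last first.
  by apply/prodf_neq0 => i _; rewrite expfz_neq0 ?gE0.
rewrite ord_constE add0r ord_prod => [|i _]; last by rewrite expfz_neq0 ?gE0.
by apply: eq_bigr => i _; rewrite ordXz.
Qed.

(** The product of the g_i is squarefree, so q divides it at most once, and the cofactor has order 0
    at P. *)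
Lemma separable_ord_le P (q : {poly F}) : irreducible_poly q ->
  0 <= ord P (polyE E 'X) -> 0 < ord P (polyE E q) ->
  \sum_i ord P (polyE E (g i)) <= ord P (polyE E q).
Proof.
move=> irr_q x_ge0 Pq; have [q1 _] := irr_q.
rewrite -ord_prod // -rmorph_prod.
have G0 : \prod_i g i != 0 by apply/prodf_neq0 => i _; apply: factor_neq0.
have [j [h [GE nqh]]] := poly_factor_out q1 G0.
have hE0 : polyE E h != 0.
  by rewrite polyE_eq0; apply: contraNneq nqh => ->; apply: dvdp0.
have qE0 : polyE E q != 0 by rewrite polyE_eq0 irredp_neq0.
have j1 : (j <= 1)%N.
  rewrite leqNgt; apply/negP => j1.
  have := separable_nosquare sep_g j1 (negbT (gtn_eqF q1)).
  by rewrite GE dvdp_mulr.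
rewrite /= GE rmorphM rmorphXn ordM ?expf_neq0 // ordX //.
by rewrite /= (ord_below_coprime irr_q x_ge0 Pq nqh); move: (ord P _) Pq => e; nia.
Qed.

Lemma ord_base_dvd P (q : {poly F}) (b : {fraction {poly F}}) : irreducible_poly q ->
    0 <= ord P (polyE E 'X) -> 0 < ord P (polyE E q) -> b != 0 ->
  exists i : int, ord P (b%:A) = i * ord P (polyE E q).
Proof.
move=> irr_q x_ge0 Pq b0; have [q1 _] := irr_q.
have qE0 : polyE E q != 0 by rewrite polyE_eq0 irredp_neq0.
have polyP h : h != 0 -> exists i : int, ord P (polyE E h) = i * ord P (polyE E q).
  move=> h0; have [j [h' [-> nqh]]] := poly_factor_out q1 h0.
  have hE0 : polyE E h' != 0.
    by rewrite polyE_eq0; apply: contraNneq nqh => ->; apply: dvdp0.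
  exists j; rewrite rmorphM rmorphXn ordM ?expf_neq0 // ordX //.
  by rewrite /= (ord_below_coprime irr_q x_ge0 Pq nqh) addr0.
have [u [v [v0 _ bE]]] := fraction_polyE E b.
have u0 : u != 0.
  apply: contraNneq b0 => u0; move: bE; rewrite u0 rmorph0 mul0r => /eqP.
  by rewrite scaler_eq0 oner_eq0 orbF.
have [[i Pu] [j Pv]] := (polyP _ u0, polyP _ v0).
by exists (i - j); rewrite bE ordF ?polyE_eq0 // Pu Pv mulrBl.
Qed.

(* Total ramification above a zero of g i0 separates the orders of the powers of y modulo n. *)
Lemma kummer_independent (b : 'I_n -> {fraction {poly F}}) :
  \sum_j b j *: y ^+ j = 0 -> forall j, b j = 0.
Proof.
move=> b_sum j; have [q [irr_q qg]] := exists_irreducible_factor g0_gt1.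
have [P [Pq x_ge0]] := exists_finite_place E irr_q.
set e := ord P (polyE E q) in Pq.
have ge0 i : 0 <= ord P (polyE E (g i)) by apply: ord_polyE_ge0.
have ge_e : e <= ord P (polyE E (g i0)).
  have [h gE] := dvdpP _ _ qg; have := factor_neq0 i0.
  rewrite gE mulf_eq0 negb_or => /andP[h0 q0].
  by rewrite rmorphM ordM ?polyE_eq0 // -/e lerDr ord_polyE_ge0.
have := separable_ord_le irr_q x_ge0 Pq; rewrite (bigD1 i0) //= -/e => sum_le.
have rest_ge0 : 0 <= \sum_(i | i != i0) ord P (polyE E (g i)).
  by apply: sumr_ge0 => i _.
have rest0 i : i != i0 -> ord P (polyE E (g i)) = 0.
  move=> ii0; apply/eqP; move: sum_le rest_ge0; rewrite (bigD1 i) //=.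
  have : 0 <= \sum_(k | (k != i0) && (k != i)) ord P (polyE E (g k)) by apply: sumr_ge0.
  by move: (ge0 i) ge_e {Pq}; move: e (\sum_(k | _) _) (ord P _) (ord P _) => *; lia.
have yE : n%:Z * ord P y = a i0 * e.
  rewrite kummer_ord (bigD1 i0) //= big1 ?addr0 => [|i /rest0 ->]; last by rewrite mulr0.
  by congr (_ * _); apply/eqP; rewrite eq_le ge_e andbT (le_trans _ sum_le) // lerDl.
(* As n divides a_(i0) e and a_(i0) is prime to n, the ramification index e is a multiple of n. *)
have [e' eE] : exists e' : int, e = e' * n%:Z.
  apply/dvdzP; rewrite -(@Gauss_dvdzr _ (a i0)); first by rewrite -yE dvdz_mulr.
  by rewrite coprimez_sym.
have e'0 : 0 < e' by move: Pq; rewrite eE; nia.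
have Py : ord P y = a i0 * e'.
  by move: yE; rewrite eE mulrA [RHS]mulrC => /mulfI; apply; lia.
have bn0 i : (b i *: y ^+ i != 0) = (b i != 0).
  by rewrite scaler_eq0 expf_eq0 (negPf y0) andbF orbF.
apply/eqP; have := ord_distinct_sum (P := P) (f := fun j => b j *: y ^+ j) _ b_sum j.
move=> H; apply: contraTT (introT eqP (H _)) => [bj|]; first by rewrite bn0.
move=> i i'; rewrite !inE !bn0 => bi bi' /=.
have ordE k : b k != 0 -> exists w, ord P (b k *: y ^+ k) = e' * (n%:Z * w + k%:Z * a i0).
  move=> bk; have [w wE] := ord_base_dvd irr_q x_ge0 Pq bk; exists w.
  rewrite -mulr_algl ordM ?expf_neq0 //; last first.
    by rewrite scaler_eq0 (negPf bk) oner_eq0.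
  by rewrite ordX // wE -/e Py eE; ring.
have [[w ->] [w' ->]] := (ordE _ bi, ordE _ bi'); move/mulfI => /(_ (lt0r_neq0 e'0)) ww'.
apply/val_inj/eqP; rewrite -eqz_nat -subr_eq0.
have : (n %| (i%:Z - i'%:Z))%Z.
  rewrite -(@Gauss_dvdzl _ _ (a i0)); last by rewrite coprimez_sym.
  by apply/dvdzP; exists (w' - w); lia.
have := ltn_ord i; have := ltn_ord i'.
rewrite /=; move: (nat_of_ord i) (nat_of_ord i') => i1 i2 i2n i1n /dvdzP[k kE].
by rewrite kE; have [k1|k1|->] := ltrgtP k 0; [nia|nia|rewrite mul0r].
Qed.


(** * The basis of powers of y and the automorphisms multiplying y by a constant *)

Variable base : {fraction {poly F}}.
Hypothesis baseE : y ^+ n = base%:A.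

Lemma kummer_powE m : y ^+ m = base ^+ (m %/ n) *: y ^+ (m %% n).
Proof.
rewrite {1}(divn_eq m n) exprD mulnC exprM baseE.
by rewrite -(rmorphXn (in_alg E)) /= mulr_algl.
Qed.

Lemma kummer_span z : exists b : 'I_n -> {fraction {poly F}},
  z = \sum_j b j *: y ^+ j.
Proof.
have /Fadjoin_polyP[p /polyOverP p1 ->] : z \in <<1; y>>%VS by rewrite genE memvf.
have /choice[k kP] i : exists k, p`_i = k%:A by have /vlineP := p1 i.
exists (fun j : 'I_n => \sum_(i < size p | (i %% n)%N == j) k i * base ^+ (i %/ n)).
rewrite horner_coef; symmetry; under eq_bigr do rewrite scaler_suml.
rewrite [RHS](partition_big (fun i : 'I__ => Ordinal (ltn_pmod i n_gt0)) xpredT) //=.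
apply: eq_bigr => j _; apply: eq_big => [i //|i /eqP <-].
by rewrite kP mulr_algl [in RHS]kummer_powE scalerA.
Qed.

Definition kummer_basis : n.-tuple E := [tuple y ^+ j | j < n].

Lemma nth_kummer_basis (j : 'I_n) : kummer_basis`_j = y ^+ j.
Proof. by rewrite -tnth_nth tnth_mktuple. Qed.

Lemma kummer_free : free kummer_basis.
Proof.
apply/freeP => b b0 j; apply: (kummer_independent (b := b)).
by rewrite -[RHS]b0; apply: eq_bigr => i _; rewrite nth_kummer_basis.
Qed.

Lemma kummer_full : <<kummer_basis>>%VS = {:E}%VS.
Proof.
apply/eqP; rewrite eqEsubv subvf; apply/subvP => z _.
have [b ->] := kummer_span z; apply: memv_suml => j _; apply: memvZ.
by rewrite -nth_kummer_basis memv_span // mem_nth ?size_tuple.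
Qed.

Lemma kummer_dim : \dim {:E} = n.
Proof. by rewrite -kummer_full; have /eqP -> := kummer_free; rewrite size_tuple. Qed.

Definition kcoord (j : 'I_n) (z : E) : {fraction {poly F}} := coord kummer_basis j z.

Lemma kcoord_sum z : z = \sum_j kcoord j z *: y ^+ j.
Proof.
rewrite {1}(coord_span (X := kummer_basis) (v := z)) ?kummer_full ?memvf //.
by apply: eq_bigr => j _; rewrite nth_kummer_basis.
Qed.

Lemma kcoordE (b : 'I_n -> {fraction {poly F}}) j : kcoord j (\sum_i b i *: y ^+ i) = b j.
Proof.
rewrite /kcoord -(coord_sum_free b j kummer_free); congr (coord _ _ _).
by apply: eq_bigr => i _; rewrite nth_kummer_basis.
Qed.

(* The automorphism of E over F(x) with y |-> x y, for x != 0. *)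
Definition conj (x : F) (z : E) : E := \sum_j kcoord j z *: (constE E x * y) ^+ j.

Lemma conjD x u v : conj x (u + v) = conj x u + conj x v.
Proof.
by rewrite /conj -big_split; apply: eq_bigr => j _; rewrite /kcoord linearD scalerDl.
Qed.

Lemma conjZ x b u : conj x (b *: u) = b *: conj x u.
Proof.
by rewrite /conj scaler_sumr; apply: eq_bigr => j _; rewrite /kcoord linearZ scalerA.
Qed.

Lemma conj0 x : conj x 0 = 0.
Proof. by apply: (addrI (conj x 0)); rewrite -conjD !addr0. Qed.

Lemma conj_sum x (J : Type) (r : seq J) (Q : pred J) (f : J -> E) :
  conj x (\sum_(j <- r | Q j) f j) = \sum_(j <- r | Q j) conj x (f j).
Proof. exact: (big_morph _ (conjD x) (conj0 x)). Qed.

(** Since x^n = 1, the element x y satisfies the equation of y, so exponents reduce modulo n in the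
    same way for both. *)
Lemma conj_pow x m : x != 0 -> conj x (y ^+ m) = (constE E x * y) ^+ m.
Proof.
move=> x0; have xyn : (constE E x * y) ^+ n = y ^+ n.
  by rewrite exprMn -rmorphXn (unit_power_n cardF x0) rmorph1 mul1r.
have lt_mn : (m %% n < n)%N by rewrite ltn_mod.
rewrite kummer_powE conjZ [RHS](_ : _ = base ^+ (m %/ n) *: (constE E x * y) ^+ (m %% n)).
  congr (_ *: _); pose j0 := Ordinal lt_mn.
  have yE : y ^+ (m %% n) = \sum_j ((j == j0)%:R : {fraction {poly F}}) *: y ^+ j.
    rewrite (bigD1 j0) //= eqxx scale1r big1 ?addr0 // => j /negPf ->.
    by rewrite scale0r.
  rewrite yE /conj; under eq_bigr do rewrite kcoordE.
  rewrite (bigD1 j0) //= eqxx scale1r big1 ?addr0 // => j /negPf ->.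
  by rewrite scale0r.
rewrite {1}(divn_eq m n) exprD mulnC exprM xyn baseE.
by rewrite -(rmorphXn (in_alg E)) /= mulr_algl.
Qed.

Lemma conjM x u v : x != 0 -> conj x (u * v) = conj x u * conj x v.
Proof.
have mulZZ (b d : {fraction {poly F}}) (s t : E) : (b *: s) * (d *: t) = (b * d) *: (s * t).
  by rewrite -scalerAl -scalerAr scalerA.
move=> x0; rewrite {1}(kcoord_sum u) {1}(kcoord_sum v) mulr_suml conj_sum.
rewrite [conj x u]/conj mulr_suml; apply: eq_bigr => i _.
rewrite mulr_sumr conj_sum [conj x v]/conj mulr_sumr; apply: eq_bigr => j _.
by rewrite !mulZZ conjZ -!exprD conj_pow.
Qed.

Lemma constE_scale (x : F) (z : E) : constE E x * z = tofrac x%:P *: z.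
Proof. by rewrite /constE mulr_algl. Qed.

Lemma conjK x z : x != 0 -> conj x (conj x^-1 z) = z.
Proof.
move=> x0; rewrite [RHS]kcoord_sum [conj x^-1 z]/conj conj_sum.
apply: eq_bigr => j _; rewrite conjZ; congr (_ *: _).
rewrite exprMn -rmorphXn /= constE_scale conjZ -constE_scale conj_pow //.
rewrite exprMn -rmorphXn mulrA -rmorphM -exprMn mulVf // expr1n.
by rewrite rmorph1 mul1r.
Qed.

Lemma conj_base x (b : {fraction {poly F}}) : x != 0 -> conj x (b%:A) = b%:A.
Proof. by move=> x0; rewrite conjZ -(expr0 y) conj_pow // !expr0. Qed.

Lemma conj_eq0 x z : x != 0 -> (conj x z == 0) = (z == 0).
Proof.
move=> x0; apply/eqP/eqP => [z0|->]; last exact: conj0.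
by rewrite -(conjK z (invr_neq0 x0)) invrK z0 conj0.
Qed.

Lemma conj_is_valuation P x : x != 0 -> is_valuation (fun z => ord P (conj x z)).
Proof.
move=> x0; split.
- by rewrite conj0 (Defs.val0 (ord_is_valuation P)).
- by move=> u v u0 v0; rewrite conjM // ordM ?conj_eq0.
- move=> u v u0 v0 uv0; rewrite conjD.
  by apply: (Defs.valD (ord_is_valuation P)); rewrite -?conjD conj_eq0.
- by move=> b _; rewrite /constE conj_base // -/(constE E b) ord_constE.
have [t t0 Pt] := exists_uniformizer P.
by exists (conj x^-1 t); rewrite ?conj_eq0 ?invr_eq0 // conjK.
Qed.

Definition conj_place P x (x0 : x != 0) : place E := Place (conj_is_valuation P x0).

(** Projection to the component of y^j: on y^i it is a power sum of exponent n - j + i, which n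
    divides only for i = j. The sign comes from n = -1 in F. *)
Lemma conj_average z (j : 'I_n) :
  \sum_(x : F | x != 0) constE E (x ^+ (n - j)) * conj x z = - (kcoord j z *: y ^+ j).
Proof.
under eq_bigr do rewrite /conj mulr_sumr.
rewrite exchange_big (bigD1 j) //= [X in _ + X]big1 ?addr0 => [|i ij].
  rewrite (eq_bigr (fun=> kcoord j z *: y ^+ j)); last first.
    move=> x x0; rewrite exprMn -scalerAr mulrA -rmorphXn -rmorphM -exprD /=.
    by rewrite subnK ?(ltnW (ltn_ord j)) // (unit_power_n cardF x0) rmorph1 mul1r.
  have card_unit : #|[pred x : F | x != 0]| = n.
    by have := cardC1 (0 : F); rewrite cardF => /= <-; apply: eq_card.
  rewrite sumr_const card_unit -mulr_natr.
  have nE : n%:R = -1 :> E.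
    by rewrite -(rmorph_nat (constE E)) (natr_card_pred cardF) rmorphN1.
  by rewrite nE mulrN1.
rewrite (eq_bigr (fun x => constE E (x ^+ (n - j + i)) * (kcoord i z *: y ^+ i))).
  rewrite -mulr_suml -rmorph_sum (sum_unit_powers cardF) ifN ?rmorph0 ?mul0r //.
  have := ltn_ord i; have := ltn_ord j; move: ij; rewrite -val_eqE /=.
  move: (nat_of_ord i) (nat_of_ord j) => i1 j1 ij j1n i1n.
  apply/negP => /dvdnP[k kE]; case: k kE => [|[|k]] kE; move/eqP: ij; nia.
move=> x x0; rewrite exprMn -!scalerAr; congr (_ *: _).
by rewrite mulrA -rmorphXn -rmorphM -exprD.
Qed.

(** The automorphisms fix x, hence preserve the space, and so does their weighted average. *)
Lemma rrspace_kcoord k z (j : 'I_n) : rrspace (pole_divisor E k) z ->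
  rrspace (pole_divisor E k) (kcoord j z *: y ^+ j).
Proof.
move=> Dz; rewrite -[X in rrspace _ X]opprK -conj_average.
apply: (subspaceN (subspace_rrspace _)).
apply: (subspace_sum _ (subspace_rrspace _)) => x x0.
apply: (subspaceZ (subspace_rrspace _)) => P.
have := Dz (conj_place P x0); rewrite !pole_divisorE /pole_order_X /=.
rewrite (_ : conj x (polyE E 'X) = polyE E 'X); last exact: conj_base.
have [->|z0] := eqVneq z 0; first by rewrite conj0; left.
by rewrite !vgeP ?conj_eq0.
Qed.

(** * The components of L(k (x)_oo) *)

Let d i : int := (size (g i)).-1%:Z.
Let degf : int := \sum_i a i * d i.
Let fl (j : nat) i : int := (j%:Z * a i %/ n%:Z)%Z.
Let H (j : nat) : E := \prod_i polyE E (g i) ^ fl j i.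
(* The component b y^j of L(k (x)_oo) is obtained by letting b run over the *)
(* polynomials of degree at most deg_bound k j, divided by H j.              *)
Let deg_bound (k j : nat) : int :=
  k%:Z + \sum_i d i * fl j i + ((- (j%:Z * degf)) %/ n%:Z)%Z.

Let nZ : 0 < n%:Z :> int. Proof. by rewrite ltz_nat. Qed.
Let nZ0 : n%:Z != 0 :> int. Proof. by rewrite gt_eqF. Qed.

Let H0 j : H j != 0.
Proof. by apply/prodf_neq0 => i _; rewrite expfz_neq0 ?gE0. Qed.

Let yj0 j : y ^+ j != 0. Proof. by rewrite expf_neq0. Qed.

Let yH0 j : y ^+ j / H j != 0. Proof. by rewrite mulf_neq0 ?invr_eq0 ?yj0 ?H0. Qed.

Let rem j i : int := (j%:Z * a i %% n%:Z)%Z.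

Let remE j i : j%:Z * a i = fl j i * n%:Z + rem j i. Proof. exact: divz_eq. Qed.

Let rem_ge0 j i : 0 <= rem j i. Proof. exact: modz_ge0. Qed.

Let rem_le j i : rem j i <= n%:Z - 1.
Proof. by have := ltz_pmod (j%:Z * a i) nZ; rewrite -/(rem j i); lia. Qed.

(** Division by [H j] removes the integral part of each exponent j a_i / n and leaves [rem j i / n],
    which lies in [0, 1). *)
Let ord_yH P j :
  n%:Z * ord P (y ^+ j / H j) = \sum_i ord P (polyE E (g i)) * rem j i.
Proof.
rewrite ordF ?yj0 ?H0 // ordX // mulrBr mulrCA kummer_ord /H ord_prod => [|i _]; last first.
  by rewrite expfz_neq0 ?gE0.
rewrite !mulr_sumr -sumrB; apply: eq_bigr => i _; rewrite ordXz ?gE0 //.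
by have := remE j i; move: (ord P _) (fl j i) (rem j i) => v f r jE; rewrite mulrA jE; ring.
Qed.

Let sum_rem j : \sum_i d i * rem j i = j%:Z * degf - n%:Z * \sum_i d i * fl j i.
Proof.
rewrite /degf !mulr_sumr -sumrB; apply: eq_bigr => i _; rewrite mulrA remE; ring.
Qed.

Lemma kummer_pole_in k j m : m%:Z <= deg_bound k j ->
  rrspace (pole_divisor E k) (polyE E 'X ^+ m * (y ^+ j / H j)).
Proof.
have X0 : polyE E 'X != 0 by rewrite polyE_eq0 polyX_eq0.
move=> m_le P; apply/vgeP; first by rewrite mulf_neq0 ?yH0 ?expf_neq0.
rewrite pole_divisorE ordM ?yH0 ?expf_neq0 // ordX // -(ler_pM2l nZ) mulrDr ord_yH.
have [x_lt0|x_ge0] := ltP (ord P (polyE E 'X)) 0; last first.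
  rewrite pole_order_out ?mem_X_poles -?leNgt // mulr0 oppr0 mulr0.
  rewrite addr_ge0 ?mulr_ge0 // sumr_ge0 // => i _.
  by rewrite mulr_ge0 // ord_polyE_ge0.
rewrite pole_order_in ?mem_X_poles //.
rewrite (eq_bigr (fun i => ord P (polyE E 'X) * (d i * rem j i))); last first.
  by move=> i _; rewrite ord_polyE_inf // -/(d i); ring.
rewrite -mulr_sumr sum_rem.
move: m_le; rewrite /deg_bound; set q := divz _ _.
have : q * n%:Z <= - (j%:Z * degf) by apply: lez_floor.
move=> q_le m_le; apply: pole_bound_suff nZ x_lt0 q_le m_le.
Qed.

(** Write b H_j = A/B in lowest terms. Above a prime factor q of B the order would be at most - ord
    q + (1 - 1/n) ord q < 0, impossible at a finite place; so B is constant. The order at one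
    infinite place bounds deg A. *)
Lemma kummer_pole_out k j (b : {fraction {poly F}}) : b != 0 ->
    rrspace (pole_divisor E k) (b *: y ^+ j) ->
  exists B : {poly F}, b%:A * H j = polyE E B /\ (size B)%:Z <= deg_bound k j + 1.
Proof.
move=> b0 Db; have [h HE] := prod_exprz_polyE_base E g (fl j).
have bE0 : b%:A != 0 :> E by rewrite scaler_eq0 (negPf b0) oner_eq0.
have [A [B [B0 copAB ABE]]] := fraction_polyE E (b * h).
have bHE : b%:A * H j = polyE E A / polyE E B.
  by rewrite -ABE /H HE mulr_algl scalerA.
have bH0 : b%:A * H j != 0 by rewrite mulf_neq0 ?H0.
have A0 : A != 0 by apply: contraNneq bH0 => A0; rewrite bHE A0 rmorph0 mul0r.
have byE : b *: y ^+ j = polyE E A / polyE E B * (y ^+ j / H j).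
  rewrite -bHE -(mulr_algl b (y ^+ j)) -mulrA; congr (_ * _).
  by rewrite mulrC divfK ?H0.
have AB0 : polyE E A / polyE E B != 0 by rewrite -bHE.
have ordb P : n%:Z * ord P (b *: y ^+ j) =
    n%:Z * (ord P (polyE E A) - ord P (polyE E B)) +
    \sum_i ord P (polyE E (g i)) * rem j i.
  by rewrite byE ordM ?yH0 // mulrDr ord_yH ordF ?polyE_eq0.
have by0 : b *: y ^+ j != 0 by rewrite byE mulf_neq0 ?yH0.
have B1 : (size B <= 1)%N.
  rewrite leqNgt; apply/negP => /exists_irreducible_factor[q [irr_q qB]].
  have [P [Pq x_ge0]] := exists_finite_place E irr_q.
  have nqA : ~~ (q %| A).
    rewrite -irreducible_poly_coprime //; apply: (coprimep_dvdr qB).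
    by rewrite coprimep_sym.
  have := Db P; rewrite vgeP // pole_divisorE pole_order_out; last first.
    by rewrite mem_X_poles -leNgt.
  rewrite mulr0 oppr0 -(pmulr_rge0 _ nZ) ordb (ord_below_coprime irr_q) // sub0r.
  have qleB : ord P (polyE E q) <= ord P (polyE E B).
    have [B' BE] := dvdpP _ _ qB; move: B0; rewrite BE mulf_eq0 negb_or => /andP[B'0 q0].
    by rewrite rmorphM ordM ?polyE_eq0 // lerDr ord_polyE_ge0.
  have : \sum_i ord P (polyE E (g i)) * rem j i <= ord P (polyE E q) * (n%:Z - 1).
    apply: (@le_trans _ _ (\sum_i ord P (polyE E (g i)) * (n%:Z - 1))).
      by apply: ler_sum => i _; apply: ler_wpM2l; [exact: ord_polyE_ge0|exact: rem_le].
    by rewrite -mulr_suml; apply: ler_wpM2r; [rewrite subr_ge0 lez_nat|exact: (separable_ord_le irr_q x_ge0 Pq)].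
  exact: denominator_absurd nZ Pq qleB.
have [bb BE] : exists bb, B = bb%:P by exists B`_0; apply: size1_polyC.
have bb0 : bb != 0 by apply: contraNneq B0 => bb0; rewrite BE bb0.
exists (bb^-1 *: A); split.
  by rewrite bHE BE polyEC -mul_polyC rmorphM /= polyEC fmorphV mulrC.
rewrite size_scale ?invr_eq0 //.
have [P x_lt0] := exists_infinite_place E.
have := Db P; rewrite vgeP // pole_divisorE pole_order_in ?mem_X_poles //.
rewrite -(ler_pM2l nZ) ordb BE polyEC ord_constE subr0 (ord_polyE_inf A x_lt0).
rewrite (eq_bigr (fun i => ord P (polyE E 'X) * (d i * rem j i))); last first.
  by move=> i _; rewrite ord_polyE_inf // -/(d i); ring.
rewrite -mulr_sumr sum_rem /deg_bound => le1.
have szA : (0 < size A)%N by rewrite size_poly_gt0.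
have : ((size A).-1%:Z - k%:Z - \sum_i d i * fl j i) <= (- (j%:Z * degf) %/ n%:Z)%Z.
  by rewrite lez_divRL //; apply: pole_bound_nec x_lt0 le1.
exact: size_bound_regroup.
Qed.

(** The truncation at 0 covers negative degree bounds, which only the zero polynomial meets. *)
Let dim_bound (k : nat) (j : 'I_n) : nat := `|Num.max 0%R (deg_bound k j + 1)%R|%N.

Let H_base j : exists b : {fraction {poly F}}, H j = b%:A.
Proof. exact: prod_exprz_polyE_base. Qed.

(** The functions x^m y^j / H_j within the degree bounds form a basis: independence is that of the
    powers of y over F(x), and [rrspace_kcoord] with [kummer_pole_out] gives generation. *)
Lemma kummer_pole_dim k : has_reldim (rrspace (pole_divisor E k)) (fun z => z = 0)
  (\sum_(j < n) dim_bound k j)%N.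
Proof.
pose T := {j : 'I_n & 'I_(dim_bound k j)}.
pose e (p : T) : E := polyE E 'X ^+ tagged p * (y ^+ tag p / H (tag p)).
have cardT : #|{: T}| = (\sum_(j < n) dim_bound k j)%N.
  rewrite card_tagged sumnE big_map big_enum /=.
  by apply: eq_bigr => j _; rewrite card_ord.
rewrite -cardT; apply: (basis_has_reldim (e := e)).
- exact: subspace_rrspace.
- exact: subspace_zero.
have eE (al : T -> F) : lcomb al e =
    \sum_j polyE E (\sum_(m < dim_bound k j) al (Tagged _ m) *: 'X^m) * (y ^+ j / H j).
  rewrite /lcomb; transitivity (\sum_(j < n) \sum_(m < dim_bound k j)
      constE E (al (Tagged (fun j => 'I_(dim_bound k j)) m)) *
      (polyE E 'X ^+ m * (y ^+ j / H j))).
    by rewrite sig_big_dep; apply: eq_bigr => -[].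
  apply: eq_bigr => j _; rewrite rmorph_sum mulr_suml; apply: eq_bigr => m _.
  by rewrite -mul_polyC rmorphM rmorphXn mulrA.
split.
- move=> p; apply: kummer_pole_in.
  exact: lt_absz_max (ltn_ord (tagged p)).
- move=> al; rewrite eE => sum0 p.
  have /choice[b bP] (j : 'I_n) : exists b : {fraction {poly F}},
      polyE E (\sum_(m < dim_bound k j) al (Tagged _ m) *: 'X^m) / H j = b%:A.
    by have [h ->] := H_base j; apply: polyE_div_base.
  have b0 : forall j, b j = 0.
    apply: kummer_independent; rewrite -[RHS]sum0; apply: eq_bigr => j _.
    by rewrite -(mulr_algl (b j) (y ^+ j)) -bP mulrAC mulrA.
  case: p => j m; have := bP j; rewrite b0 scale0r => /eqP.
  rewrite mulf_eq0 invr_eq0 (negPf (H0 _)) orbF polyE_eq0 => /eqP/polyP/(_ m).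
  rewrite coef0 coef_sum (bigD1 m) //= coefZ coefXn eqxx mulr1 big1 ?addr0 // => i im.
  rewrite coefZ coefXn; case: eqP => [/val_inj mi|_]; last by rewrite mulr0.
  by rewrite mi eqxx in im.
move=> z Dz.
have /choice[B BP] (j : 'I_n) : exists B : {poly F},
    (kcoord j z)%:A * H j = polyE E B /\ (size B <= dim_bound k j)%N.
  have [->|zj0] := eqVneq (kcoord j z) 0.
    by exists 0; rewrite scale0r mul0r rmorph0 size_poly0.
  have [B [BE szB]] := kummer_pole_out zj0 (rrspace_kcoord j Dz).
  by exists B; split=> //; apply: le_absz_max.
exists (fun p : T => (B (tag p))`_(nat_of_ord (tagged p))); apply/eqP; rewrite subr_eq0; apply/eqP.
rewrite eE [LHS](kcoord_sum z); apply: eq_bigr => j _ /=.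
have [BE szB] := BP j; rewrite -(mulr_algl (kcoord j z) (y ^+ j)).
have -> : \sum_(m < dim_bound k j) (B j)`_m *: 'X^m = B j.
  rewrite -poly_def; apply/polyP => m; rewrite coef_poly; case: ltnP => // le_m.
  by rewrite nth_default // (leq_trans szB).
by rewrite -BE -mulrA; congr (_ * _); rewrite mulrC divfK ?H0.
Qed.

(** * The genus of the Kummer cover *)

Lemma deg_bound_add k j : deg_bound k j = k%:Z + deg_bound 0 j.
Proof. by rewrite /deg_bound add0r addrA. Qed.

Lemma deg_bound00 : deg_bound 0 0 = 0.
Proof.
rewrite /deg_bound /fl mul0r oppr0 div0z addr0 add0r big1 // => i _.
by rewrite mul0r div0z mulr0.
Qed.

(** n times the bound is at most - sum_i d_i [rem j i], where the term of i0 is positive because n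
    does not divide j a_(i0). *)
Lemma deg_bound0_lt0 j : (0 < j < n)%N -> deg_bound 0 j < 0.
Proof.
case/andP=> j0 jn; rewrite -(pmulr_rlt0 _ nZ).
have rem0 : 0 < rem j i0.
  rewrite lt_neqAle rem_ge0 andbT eq_sym; apply/eqP => /dvdz_mod0P.
  rewrite Gauss_dvdzl; last by rewrite coprimez_sym.
  by rewrite dvdzE /= => /(dvdn_leq j0); rewrite leqNgt jn.
have di0 : 0 < d i0 by rewrite /d ltz_nat -ltnS prednK // ltnW.
have drem : 0 < \sum_i d i * rem j i.
  rewrite (bigD1 i0) //= ltr_pwDl ?mulr_gt0 // sumr_ge0 // => i _.
  exact: mulr_ge0.
have := lez_floor (- (j%:Z * degf)) nZ0; rewrite mulrC => le_floor.
rewrite /deg_bound add0r mulrDr; apply: le_lt_trans (lerD (lexx _) le_floor) _.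
by rewrite -oppr_gt0 opprD opprK addrC -sum_rem.
Qed.

(** For large k no truncation occurs, and the dimensions add up to k n + sum_j (deg_bound 0 j + 1),
    which has to be k n - g + 1. *)
Let genus_int : int := 1 - \sum_(j < n) (deg_bound 0 j + 1).

Lemma genus_int_ge0 : 0 <= genus_int.
Proof.
rewrite subr_ge0 (bigD1 (Ordinal n_gt0)) //= deg_bound00 add0r -[leRHS]addr0 lerD2l.
apply: sumr_le0 => j j0; rewrite -ltzD1 ltrD2r deg_bound0_lt0 // ltn_ord andbT lt0n.
by apply: contra j0 => /eqP j0; apply/eqP/val_inj.
Qed.

Lemma genus_int_double : genus_int * 2 =
  2 - n%:Z - (gcdn `|degf| n)%:Z + \sum_i d i * (n%:Z - (gcdn `|a i| n)%:Z).
Proof.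
have sum1 : (\sum_(j < n) \sum_i d i * fl j i) * 2 =
    \sum_i d i * (a i * (n%:Z - 1) - n%:Z + (gcdn `|a i| n)%:Z).
  rewrite exchange_big mulr_suml; apply: eq_bigr => i _ /=.
  by rewrite -mulr_sumr -mulrA floor_sum.
have sum2 : (\sum_(j < n) ((- (j%:Z * degf)) %/ n%:Z)%Z) * 2 =
    - degf * (n%:Z - 1) - n%:Z + (gcdn `|degf| n)%:Z.
  by rewrite -(abszN degf) -floor_sum //; congr (_ * _); apply: eq_bigr => j _; rewrite mulrN.
have -> : genus_int = 1 - n%:Z - \sum_(j < n) \sum_i d i * fl j i -
    \sum_(j < n) ((- (j%:Z * degf)) %/ n%:Z)%Z.
  rewrite /genus_int /deg_bound; under eq_bigr do rewrite add0r.
  by rewrite !big_split /= sumr_const card_ord -[1 *+ n]/(n%:R) natz; ring.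
rewrite !mulrBl sum1 sum2.
rewrite (eq_bigr (fun i => (a i * d i) * (n%:Z - 1) - d i * (n%:Z - (gcdn `|a i| n)%:Z))).
  by rewrite sumrB -mulr_suml -/degf; ring.
by move=> i _; ring.
Qed.

Lemma kummer_genus : exists G : nat, is_genus E G /\ G%:Z * 2 =
  2 - n%:Z - (gcdn `|degf| n)%:Z + \sum_i d i * (n%:Z - (gcdn `|a i| n)%:Z).
Proof.
exists `|genus_int|%N; rewrite gez0_abs ?genus_int_ge0 ?genus_int_double //; split=> //.
pose k0 := (\sum_(j < n) `|deg_bound 0 j|)%N.
apply: (@is_genus_of_pole_spaces _ _ _ k0 (fun k => \sum_(j < n) dim_bound k j)%N).
  by move=> k _; apply: kummer_pole_dim.
move=> k k0k; rewrite gez0_abs ?genus_int_ge0 // kummer_dim (big_morph Posz PoszD (erefl _)).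
rewrite (eq_bigr (fun j : 'I_n => k%:Z + (deg_bound 0 j + 1))) => [|j _].
  rewrite big_split /= sumr_const card_ord -mulr_natr natz /genus_int.
  by rewrite opprB addrA subrK.
have jk : (`|deg_bound 0 j| <= k)%N.
  by apply: leq_trans k0k; rewrite /k0 (bigD1 j) //= leq_addr.
rewrite /dim_bound deg_bound_add -addrA; move: (deg_bound 0 j) jk => D Dk.
by rewrite maxElt; case: ifP; lia.
Qed.

(** * Complete splitting above a rational value of x *)

Lemma expf_card_factor : y ^+ n.+1 - y = \prod_(x : F) (y - constE E x).
Proof.
have := congr1 (fun p => (map_poly (constE E) p).[y]) (finField_genPoly F).
rewrite rmorphB rmorph_prod /= map_polyXn map_polyX hornerD hornerN hornerXn hornerX.
rewrite horner_prod cardF => ->; apply: eq_bigr => x _.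
by rewrite map_polyXsubC hornerXsubC.
Qed.

(** The product of all y - x, x in F, is y (y^n - 1), which lies in the maximal ideal; hence so does
    a factor. It is not y, since y^n has residue 1. *)
Lemma kummer_residue (P : place E) : vge P 1 (y ^+ n - 1) ->
  exists x : F, x != 0 /\ vge P 1 (y - constE E x).
Proof.
move=> Pyn; have yn_ge0 : vge P 0 (y ^+ n).
  by rewrite -[y ^+ n](subrK 1); apply: vgeD; [apply: vge_le Pyn|apply: vge1].
have y_ge0 : vge P 0 y.
  by move: yn_ge0; rewrite !vgeP ?expf_neq0 // ordX // pmulr_rge0.
have [||x Px] := @vge1_prod _ _ P _ (index_enum F) (fun x => y - constE E x).
- by move=> x; apply: vgeB; [|apply: vge_const].
- rewrite -expf_card_factor exprS (_ : y * _ - y = y * (y ^+ n - 1)); last by ring.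
  by rewrite -[X in vge P X]add0r; apply: vgeM.
exists x; split=> //; apply/eqP => x0; apply: (@vge1_1 _ _ P).
rewrite -(subKr (y ^+ n) 1); apply: vgeB => //.
rewrite x0 rmorph0 subr0 in Px.
rewrite -(prednK n_gt0) exprS -[X in vge P X]addr0; apply: vgeM => //.
by have := vgeX n.-1 y_ge0; rewrite mulr0.
Qed.

Lemma conj_place_residue (P : place E) (x z : F) (x0 : x != 0) :
  vge P 1 (y - constE E z) -> vge (conj_place P x0) 1 (y - constE E (x * z)).
Proof.
have conjyE : conj x (y - constE E (x * z)) = constE E x * (y - constE E z).
  rewrite (_ : y - constE E (x * z) = y ^+ 1 + (- (tofrac (x * z)%:P))%:A); last first.
    by rewrite expr1 scaleNr.
  rewrite conjD conj_pow // conj_base // expr1 scaleNr -/(constE E _) rmorphM.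
  by rewrite -mulrBr.
move=> Pyz; have [z0|z0] := eqVneq (y - constE E (x * z)) 0; first by rewrite z0; left.
apply/vgeP => //=; rewrite -vgeP ?conj_eq0 // conjyE.
by apply: (subspaceZ (subspace_vge P 1)).
Qed.

Lemma conj_place_polyE (P : place E) (x : F) (x0 : x != 0) h :
  ord (conj_place P x0) (polyE E h) = ord P (polyE E h).
Proof. by rewrite /= (_ : conj x (polyE E h) = polyE E h) //; apply: conj_base. Qed.

(** The automorphisms carry one place above u to places where y takes each nonzero residue, so to n
    distinct ones. The zeros of x - u have total degree at most n, which leaves degree one for
    each. *)
Lemma kummer_split (u : F) :
    (forall P, 0 < ord P (polyE E ('X - u%:P)) -> vge P 1 (y ^+ n - 1)) ->
  forall z : F, z != 0 -> exists P : place E,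
    [/\ rational_points P, 0 < ord P (polyE E ('X - u%:P)) & vge P 1 (y - constE E z)].
Proof.
move=> split_u.
have [P0 [P0u _]] := exists_finite_place E (irredp_XsubC u).
have [x [x0 P0x]] := kummer_residue (split_u _ P0u).
have /choice[pl plP] (z : F) : exists P : place E, z != 0 ->
    0 < ord P (polyE E ('X - u%:P)) /\ vge P 1 (y - constE E z).
  have [->|z0] := eqVneq z 0; first by exists P0.
  have zx0 : z / x != 0 by rewrite mulf_neq0 ?invr_eq0.
  exists (conj_place P0 zx0) => _; rewrite conj_place_polyE; split=> //.
  by have := conj_place_residue zx0 P0x; rewrite divfK.
move=> z z0; exists (pl z); have [plu ply] := plP z z0; split=> //.
pose U := enum (predC1 (0 : F)); pose S := [seq pl w | w <- U].
have U0 w : w \in U -> w != 0 by rewrite mem_enum inE.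
have S_pos P : P \in S -> 0 < ord P (polyE E ('X - u%:P)).
  by case/mapP => w /U0/plP[] + _ ->.
have uS : uniq S.
  rewrite map_inj_in_uniq ?enum_uniq // => v w /U0/plP[_ vy] /U0/plP[_ wy] vw.
  apply/eqP; rewrite -subr_eq0; apply: contrapT => /negP vw0.
  rewrite -vw in wy; have Pvw := vgeB wy vy; apply: (@vge1_1 _ _ (pl v)).
  have := subspaceZ (subspace_vge (pl v) 1) (v - w)^-1 Pvw.
  have -> : y - constE E w - (y - constE E v) = constE E (v - w).
    by rewrite rmorphB /=; ring.
  by rewrite -rmorphM mulVf // rmorph1.
have sizeS : size S = n by rewrite size_map -cardE cardC1 cardF.
have XU0 : 'X - u%:P != 0 :> {poly F} by rewrite polyXsubC_eq0.
have := @zero_degree_le _ E S ('X - u%:P) 1 1 XU0 (oner_neq0 _) _ _ uS.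
rewrite size_XsubC size_poly1 rmorph1 divr1 muln1 kummer_dim => /(_ isT isT S_pos).
have zS : pl z \in S by apply: map_f; rewrite mem_enum inE.
rewrite (bigD1_seq (pl z)) //=.
have term_gt0 P : P \in S -> (0 < `|ord P (polyE E ('X - u%:P))| * place_degree P)%N.
  by move=> /S_pos Pu; rewrite muln_gt0 place_degree_gt0 andbT absz_gt0 gt_eqF.
have rest : (n.-1 <= \sum_(P <- S | P != pl z)
    `|ord P (polyE E ('X - u%:P))| * place_degree P)%N.
  apply: (@leq_trans (\sum_(P <- S | P != pl z) 1)%N).
    rewrite -sizeS (perm_size (perm_to_rem zS)) /= sum1_count -size_filter.
    by rewrite (rem_filter _ uS).
  by rewrite big_seq_cond [leqRHS]big_seq_cond; apply: leq_sum => P /andP[/term_gt0].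
apply: eq1_of_sum_le n_gt0 rest _ (place_degree_gt0 _).
by rewrite absz_gt0 gt_eqF.
Qed.

End KummerExtension.

(** * Counting rational points *)

Section RationalPoints.

Variables (F : finFieldType) (E : fieldExtType {fraction {poly F}}).

Lemma ord_X_ge0 (P : place E) (u : F) :
  0 < ord P (polyE E ('X - u%:P)) -> 0 <= ord P (polyE E 'X).
Proof.
move=> Pu; rewrite leNgt; apply/negP => x_lt0; move: Pu.
by rewrite ord_polyE_inf // size_XsubC mul1r ltNge ltW.
Qed.

(** The residue field is one-dimensional and spanned by the class of 1, so x has a residue in F. *)
Lemma rational_point_residue (P : place E) : rational_points P ->
  0 <= ord P (polyE E 'X) -> exists u : F, 0 < ord P (polyE E ('X - u%:P)).
Proof.
rewrite /rational_points => Pdeg x_ge0; have := place_degreeP P.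
rewrite Pdeg maximal_idealE => -[e [_ eP]].
have [a [P1 _]] := eP 1 (vge1 P); rewrite big_ord1 in P1.
have [b [Px _]] := eP (polyE E 'X) (vge_polyE _ x_ge0); rewrite big_ord1 in Px.
have a0 : a 0 0 != 0.
  apply/eqP => a0; move: P1; rewrite a0 rmorph0 mul0r subr0; exact: vge1_1.
exists (b 0 0 / a 0 0); rewrite gtz0_ge1 -vgeP ?polyE_eq0 ?polyXsubC_eq0 //.
have := vgeB Px (subspaceZ (subspace_vge P 1) (b 0 0 / a 0 0) P1).
congr vge; rewrite rmorphB /= polyEC mulrBr mulr1 mulrA -rmorphM divfK //.
by ring.
Qed.

Lemma finite_rational_points : finite_set (@rational_points F E).
Proof.
apply: (@sub_finite_set _ _ ([set P : place E | ord P (polyE E 'X) < 0%R] `|`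
    \bigcup_(u in [set: F]) [set P : place E | 0%R < ord P (polyE E ('X - u%:P) / polyE E 1)])%classic).
  move=> P Prat; have [x_lt0|x_ge0] := ltP (ord P (polyE E 'X)) 0; first by left.
  right; have [u Pu] := rational_point_residue Prat x_ge0.
  by exists u => //=; rewrite rmorph1 divr1.
rewrite finite_setU; split; first exact: finite_X_poles.
apply: bigcup_finite => [|u _]; first exact: finite_finset.
by apply: finite_zeros; rewrite ?polyXsubC_eq0 ?oner_eq0.
Qed.

(** A place determines the residues of x and y, so distinct pairs (u, z) give distinct places. *)
Lemma rational_points_lower_bound (y : E) (n : nat) (T : {set F}) :
    #|F| = n.+1 ->
    (forall u z : F, u \in T -> z != 0 -> exists P : place E,
      [/\ rational_points P, 0 < ord P (polyE E ('X - u%:P)) & vge P 1 (y - constE E z)]) ->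
  exists2 N : nat, (rational_points (E := E) #= `I_N)%card & (#|T| * n <= N)%N.
Proof.
move=> cardF TP; have /finite_fsetP[X XE] := finite_rational_points.
exists #|` X|%fset; first by rewrite XE; apply/card_eq_fsetP.
have /choice[pl plP] (uz : F * F) : exists P : place E, uz.1 \in T -> uz.2 != 0 ->
   [/\ rational_points P, 0 < ord P (polyE E ('X - uz.1%:P)) & vge P 1 (y - constE E uz.2)].
  case: uz => u z /=; have [uT|] := boolP (u \in T); last first.
    by have [P _] := exists_infinite_place E; exists P.
  have [->|z0] := eqVneq z 0; first by have [P _] := exists_infinite_place E; exists P.
  by have [P PP] := TP u z uT z0; exists P.
pose S := [seq pl (u, z) | u <- enum T, z <- enum (predC1 (0 : F))].
have sizeS : size S = (#|T| * n)%N by rewrite size_allpairs -!cardE cardC1 cardF.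
rewrite -sizeS; apply: uniq_leq_size => [|P].
  apply: allpairs_uniq; rewrite ?enum_uniq // => -[u z] [v w] /=.
  case/allpairsP=> -[u1 z1] /= []; rewrite !mem_enum inE => uT z0 [-> ->] {u z}.
  case/allpairsP=> -[v1 w1] /= []; rewrite !mem_enum inE => vT w0 [-> ->] {v w}.
  have [_ Pu Pz] := plP (u1, z1) uT z0; have [_ Pv Pw] := plP (v1, w1) vT w0.
  move=> /= uv_eq; rewrite -uv_eq /= in Pv Pw; move: Pu Pz Pv Pw => /=.
  have const0 (x : F) Q : vge Q 1 (constE E x) -> x = 0.
    by have [//|x0] := eqVneq x 0; rewrite vgeP ?fmorph_eq0 // ord_constE.
  move: (pl _) => Q; rewrite !gtz0_ge1 -!vgeP ?polyE_eq0 ?polyXsubC_eq0 //.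
  move=> Pu Pz Pv Pw.
  have := vgeB Pv Pu; rewrite -rmorphB /= (_ : _ - _ = (u1 - v1)%:P); last first.
    by rewrite polyCB; ring.
  rewrite polyEC => /const0/eqP; rewrite subr_eq0 => /eqP ->.
  have := vgeB Pw Pz; rewrite (_ : _ - _ = constE E (z1 - w1)); last first.
    by rewrite rmorphB /=; ring.
  by move=> /const0/eqP; rewrite subr_eq0 => /eqP ->.
case/allpairsP=> -[u z] /= []; rewrite !mem_enum inE => uT z0 ->.
have [+ _ _] := plP (u, z) uT z0.
by rewrite XE.
Qed.

End RationalPoints.

(** * Gcds of the numbers p^i - 1 and linearized polynomials *)

(** Euclid's algorithm on exponents: p^j - 1 = p^(j-i) (p^i - 1) + (p^(j-i) - 1). *)
Lemma gcdn_expn_pred (p i j : nat) : (0 < p)%N ->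
  gcdn (p ^ i - 1) (p ^ j - 1) = (p ^ gcdn i j - 1)%N.
Proof.
move=> p0; move: {2}(i + j)%N (leqnn (i + j)) => N.
elim: N i j => [|N IHN] i j ijN.
  have [-> ->] : i = 0%N /\ j = 0%N by lia.
  by rewrite !gcd0n.
wlog ij : i j ijN / (i <= j)%N => [W|].
  by case: (leqP i j) => [/W ->//|/ltnW ji]; rewrite gcdnC [in RHS]gcdnC W // addnC.
have [->|i0] := posnP i; first by rewrite expn0 !gcd0n.
have pi0 : (0 < p ^ i)%N by rewrite expn_gt0 p0.
have pji0 : (0 < p ^ (j - i))%N by rewrite expn_gt0 p0.
have -> : (p ^ j - 1 = p ^ (j - i) * (p ^ i - 1) + (p ^ (j - i) - 1))%N.
  have -> : (p ^ j = p ^ (j - i) * p ^ i)%N by rewrite -expnD subnK.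
  by move: (p ^ i)%N (p ^ (j - i))%N pi0 pji0 => a b; nia.
rewrite gcdnMDl IHN; last by lia.
by congr (p ^ _ - 1)%N; rewrite -{2}(subnK ij) gcdnDr.
Qed.

Section LinearizedPolynomials.

Variables (p : nat) (F : finFieldType).
Hypothesis charFp : p \in [pchar F].

Let p_prime : prime p. Proof. by case/andP: charFp. Qed.
Let p_gt0 : (0 < p)%N. Proof. exact: prime_gt0. Qed.

Lemma pnat_expn s : ([pchar F]).-nat (p ^ s)%N.
Proof.
by rewrite pnatX; apply/orP; left; rewrite pnatE.
Qed.

Lemma exprDn_frob s (g h : {poly F}) : (g + h) ^+ (p ^ s) = g ^+ (p ^ s) + h ^+ (p ^ s).
Proof.
apply: exprDn_pchar; apply: sub_in_pnat (pnat_expn s) => l _.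
by rewrite pchar_poly.
Qed.

Lemma frob_root s (x : F) : exists y, y ^+ (p ^ s) = x.
Proof.
have inj : injective (fun y : F => y ^+ (p ^ s)).
  move=> u v /eqP; rewrite -subr_eq0 -exprNn_pchar ?pnat_expn //.
  rewrite -exprDn_pchar ?pnat_expn // expf_eq0 subr_eq0 => /andP[_ /eqP //].
by exists (invF inj x); apply: (f_invF inj x).
Qed.

Definition lin_poly (k : nat) (c : nat -> F) : {poly F} :=
  \sum_(0 <= i < k.+1) c i *: 'X^(p ^ i).

Lemma size_lin_poly k c : c k != 0 -> size (lin_poly k c) = (p ^ k).+1.
Proof.
move=> ck; rewrite /lin_poly big_nat_recr //= addrC size_polyDl size_scale ?size_polyXn //.
rewrite big_nat; elim/big_ind: _ => [|g h gk hk|i /andP[_ ik]].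
- by rewrite size_poly0.
- by rewrite (leq_ltn_trans (size_polyD _ _)) // gtn_max gk.
by rewrite (leq_ltn_trans (size_scale_leq _ _)) // size_polyXn ltnS ltn_exp2l // prime_gt1.
Qed.

(** In characteristic p the derivative is the nonzero constant c_0. *)
Lemma separable_lin_poly k c : c 0%N != 0 -> separable_poly (lin_poly k c).
Proof.
move=> c0; rewrite separable_poly.unlock.
suff -> : (lin_poly k c)^`() = (c 0%N)%:P by rewrite -alg_polyC coprimepZr // coprimep1.
rewrite /lin_poly big_nat_recl // raddfD /= expn0 derivZ derivX alg_polyC.
rewrite raddf_sum big1 ?addr0 // => i _ /=; rewrite derivZ derivXn.
have pX : (p ^ i.+1)%:R = 0 :> {poly F}.
  by apply/eqP; rewrite -(dvdn_pcharf (_ : p \in [pchar {poly F}])) ?pchar_poly // dvdn_exp.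
by rewrite -mulr_natl pX mul0r scaler0.
Qed.

(** Frobenius is bijective on F and additive, so the p^s-th root can be taken coefficient by
    coefficient. *)
Lemma lin_poly_frob s r (b : nat -> F) : (s <= r)%N -> b s != 0 -> b r != 0 ->
  exists b' : nat -> F, [/\ b' 0%N != 0, b' (r - s)%N != 0 &
    lin_poly (r - s) b' ^+ (p ^ s) = \sum_(s <= i < r.+1) b i *: 'X^(p ^ i)].
Proof.
move=> sr bs br; have /choice[b' bE] i := frob_root s (b (i + s)%N).
have b'0 i : b (i + s)%N != 0 -> b' i != 0.
  by apply: contraNneq => b'i; rewrite -bE b'i expr0n expn_eq0 gtn_eqF.
exists b'; split; [by apply: b'0; rewrite add0n|by apply: b'0; rewrite subnK|].
rewrite /lin_poly (big_morph (fun g => g ^+ (p ^ s)) (exprDn_frob s) (id1 := 0)); last first.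
  by rewrite expr0n expn_eq0 gtn_eqF.
rewrite -[s in RHS]add0n big_addn subSn //; apply: eq_bigr => i _.
by rewrite exprZn bE -exprM -expnD.
Qed.

End LinearizedPolynomials.

(** * Root counting and arithmetic for the final formulas *)

Lemma card_roots_separable (F : fieldType) (K : closedFieldType)
    (iota : {rmorphism F -> K}) (G : {poly F}) (A : {fset K}) :
    separable_poly G -> (forall z, (z \in A) = root (map_poly iota G) z) ->
  #|` A|%fset = (size G).-1.
Proof.
move=> sepG AG; have [rs GE] := closed_field_poly_normal (map_poly iota G).
have l0 : lead_coef (map_poly iota G) != 0.
  by rewrite lead_coef_eq0 map_poly_eq0 separable_poly_neq0.
rewrite -(size_map_poly iota) GE size_scale // size_prod_XsubC /=.
apply/perm_size/uniq_perm; rewrite ?fset_uniq //.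
  rewrite -separable_prod_XsubC -(eqp_separable (eqp_scale _ l0)) -GE.
  by rewrite separable_map.
by move=> z; rewrite AG GE rootZ // root_prod_XsubC.
Qed.

Lemma fraction_opp_div (F : fieldType) (E : fieldExtType {fraction {poly F}}) (g h : {poly F}) :
  (- (tofrac g / tofrac h))%:A = - (polyE E g / polyE E h).
Proof.
by rewrite -[LHS]/(in_alg E _) rmorphN rmorphM fmorphV.
Qed.

Lemma predn_size_mul (R : idomainType) (g h : {poly R}) : g != 0 -> h != 0 ->
  (size (g * h)).-1 = ((size g).-1 + (size h).-1)%N.
Proof. by move=> g0 h0; rewrite size_mul //; move: (polySpred g0) (polySpred h0); lia. Qed.

Lemma kummer_degree_arith (D d1 d2 e A B w : nat) :
    (d1 + D = A)%N -> (d2 + D = B)%N -> (e * A = B * w)%N -> (0 < w)%N ->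
  (e%:Z - 1) * D%:Z + (e%:Z * d1%:Z + (-1 * d2%:Z + 0)) = (B * (w - 1))%N%:Z.
Proof.
move=> <- <- ew w0; rewrite mulnBr muln1 -ew -subzn; last by rewrite ew leq_pmulr.
by rewrite !(PoszM, PoszD); ring.
Qed.

Lemma leq_int_bound (N i k x D n : nat) : (x <= D)%N -> (i * n <= N)%N -> (x + i = k)%N ->
  (k%:Z - D%:Z) * n%:Z <= N%:Z.
Proof.
move=> xD iN <-; apply: (@le_trans _ _ (i%:Z * n%:Z)); last by rewrite -PoszM lez_nat.
by apply: ler_wpM2r => //; lia.
Qed.

(** Here A = p^(r-s), B = p^t, D = delta, Q = p^m; u - 1 and v - 1 are the gcds of Q - 1 with p^s -
    1 and with deg f. The exponents p^s and -1 have gcd 1 with Q - 1. *)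
Lemma genus_arith (A B D Q u v : int) (G : nat) :
    G%:Z * 2 = 2 - (Q - 1) - (v - 1) +
      (D * ((Q - 1) - (u - 1)) + ((A - D) * ((Q - 1) - 1) + ((B - D) * ((Q - 1) - 1) + 0))) ->
  (G%:R : rat) = 1 / 2 * ((A%:~R + B%:~R - D%:~R - 1) * (Q%:~R - 2)
    - D%:~R * u%:~R - v%:~R + 2 * D%:~R + 2).
Proof.
move=> GE; have : G%:Z * 2 = (A + B - D - 1) * (Q - 2) - D * u - v + 2 * D + 2.
  by rewrite GE; ring.
move=> /(congr1 (fun z : int => z%:~R : rat)).
rewrite !(rmorphM, rmorphD, rmorphB, rmorphN) /= => {}GE.
have -> : (G%:R : rat) = G%:~R by rewrite pmulrn.
by lra.
Qed.

(** * The cover y^(q-1) = - R_1 / R_2 *)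

Theorem mainTheorem1 (p m : nat) (F : finFieldType) (charFp : p \in [pchar F])
    (cardF : #|F| = (p ^ m)%N)
    (K : closedFieldType) (iota : {rmorphism F -> K})
    (algK : integralRange iota)
    (r : nat) (r_ge2 : (2 <= r)%N)
    (L : {vspace pPrimeCharType charFp}) (dimL : \dim L = r)
    (s t : nat) (s_gt0 : (0 < s)%N) (s_ltr : (s < r)%N) (t_les : (t <= s)%N)
    (b c : nat -> F) (bs_br : b s * b r != 0) (c0_ct : c 0%N * c t != 0)
    (R1 R2 : {poly F})
    (defR1 : R1 = \sum_(s <= i < r.+1) b i *: 'X^(p ^ i))
    (defR2 : R2 = \sum_(0 <= i < t.+1) c i *: 'X^(p ^ i))
    (defR : \prod_(a : F | (a : pPrimeCharType charFp) \in L) ('X - a%:P)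
              = R1 + R2)
    (L1 L2 : {fset K})
    (defL1 : forall z, (z \in L1) = root (map_poly iota R1) z)
    (defL2 : forall z, (z \in L2) = root (map_poly iota R2) z)
    (neqL : L1 != L2)
    (delta : nat) (def_delta : delta = #|` (L1 `&` L2)%fset|)
    (E : fieldExtType {fraction {poly F}}) (y : E)
    (genE : <<1; y>>%VS = {:E}%VS)
    (eqC : y ^+ (p ^ m - 1) = (- (tofrac R1 / tofrac R2))%:A) :
  (exists2 g : nat, is_genus E g &
     g%:R = 1 / 2 *
       ((p%:R ^+ (r - s) + p%:R ^+ t - delta%:R - 1)
           * (p%:R ^+ m - 2)
         - delta%:R * p%:R ^+ gcdn m s - p%:R ^+ gcdn m (r - t)
         + 2 * delta%:R + 2) :> rat) /\
  (exists2 N : nat, (rational_points (E := E) #= `I_N)%card &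
     (p%:R ^+ r - delta%:R) * (p%:R ^+ m - 1) <= N%:R :> int).
Proof.
have p_pr : prime p by have /andP[] := charFp.
have p_gt0 := prime_gt0 p_pr; have p_gt1 := prime_gt1 p_pr.
set n := (p ^ m - 1)%N in eqC *.
have pm_gt1 : (1 < p ^ m)%N by rewrite -cardF finNzRing_gt1.
have cardF' : #|F| = n.+1 by rewrite cardF /n subn1 prednK // ltnW.
have m_gt0 : (0 < m)%N by rewrite lt0n; apply: contraTneq pm_gt1 => ->.
have n_gt0 : (0 < n)%N by rewrite /n subn_gt0.
have cop_pn k : coprime (p ^ k) n.
  apply: coprimeXl; apply: (@coprime_dvdl _ n.+1); last by rewrite coprimeSn.
  by rewrite -cardF' cardF dvdn_exp.
have /norP[bs br] : ~~ ((b s == 0) || (b r == 0)) by rewrite -mulf_eq0.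
have /norP[c0 ct] : ~~ ((c 0%N == 0) || (c t == 0)) by rewrite -mulf_eq0.
have [b' [b'0 b'r S1E]] := lin_poly_frob charFp (ltnW s_ltr) bs br.
rewrite -defR1 in S1E; set S1 := lin_poly p _ b' in S1E.
have R2E : R2 = lin_poly p t c by [].
have sepS1 : separable_poly S1 := separable_lin_poly charFp _ b'0.
have sepR2 : separable_poly R2 by rewrite R2E; apply: separable_lin_poly.
have szS1 : size S1 = (p ^ (r - s)).+1 := size_lin_poly charFp b'r.
have szR2 : size R2 = (p ^ t).+1 by rewrite R2E; apply: (size_lin_poly charFp ct).
have S10 := separable_poly_neq0 sepS1; have R20 := separable_poly_neq0 sepR2.
pose G := gcdp S1 R2; pose U1 := S1 %/ G; pose U2 := R2 %/ G.
have S1U : S1 = U1 * G by rewrite divpK ?dvdp_gcdl.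
have R2U : R2 = U2 * G by rewrite divpK ?dvdp_gcdr.
have /norP[U10 G0] : ~~ ((U1 == 0) || (G == 0)) by rewrite -mulf_eq0 -S1U.
have U20 : U2 != 0 by apply: contraNneq R20 => U20; rewrite R2U U20 mul0r.
have sepGU : separable_poly (G * (U1 * U2)).
  have := sepS1; rewrite S1U (separable_mul U1 G) => /and3P[sU1 sG copU1G].
  have := sepR2; rewrite R2U (separable_mul U2 G) => /and3P[sU2 _ copU2G].
  rewrite !separable_mul sG sU1 sU2 /= coprimepMr ![coprimep G _]coprimep_sym.
  by rewrite copU1G copU2G coprimep_div_gcd // S10.
(* R_1 and [S1] have the same roots, so the common zeros of R_1 and R_2 are the roots of the
   separable polynomial [G]. *)
have deltaE : delta = (size G).-1.
  rewrite def_delta; apply: (@card_roots_separable _ _ iota) => [|z].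
    by move: sepGU; rewrite separable_mul => /and3P[].
  rewrite in_fsetI defL1 defL2 gcdp_map root_gcd -S1E rmorphXn /=; congr (_ && _).
  by rewrite rootE hornerE expf_eq0 expn_gt0 p_gt0.
have szU1 : ((size U1).-1 + delta = p ^ (r - s))%N.
  by rewrite deltaE -predn_size_mul // -S1U szS1.
have szU2 : ((size U2).-1 + delta = p ^ t)%N.
  by rewrite deltaE -predn_size_mul // -R2U szR2.
(* R_1 = (U1 G)^(p^s) and R_2 = U2 G, so one factor [G] cancels in f. *)
pose g (i : 'I_3) := nth 0 [:: G; U1; U2] i.
pose a (i : 'I_3) := nth 0 [:: (p ^ s)%:Z - 1; (p ^ s)%:Z; -1] i.
have sep_g : separable_poly (\prod_i g i).
  by rewrite !big_ord_recl big_ord0 mulr1.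
have polyE0 (h : {poly F}) : h != 0 -> polyE E h != 0 by rewrite polyE_eq0.
have yE : y ^+ n = constE E (-1) * \prod_i polyE E (g i) ^ a i.
  rewrite eqC fraction_opp_div rmorphN1 mulN1r; congr (- _).
  rewrite !big_ord_recl big_ord0 mulr1 -S1E {1}S1U {1}R2U.
  rewrite !rmorphM rmorphXn rmorphM exprMn /g /a /=.
  rewrite expfzDr ?polyE0 // !exprN1 -!exprnP /=.
  have := polyE0 _ G0; have := polyE0 _ U20.
  move: (polyE E G) (polyE E U2) => x1 x2 x20 x10.
  move: (x1 ^+ _) (_ ^+ _) => x3 x4.
  by field; rewrite x10 x20.
(* The exponents of [U1] and [U2] are prime to n. If both were constant, R_1 and R_2 would have the
   same roots as [G], and L_1 = L_2. *)
have [i0 [cop0 g0]] : exists i0 : 'I_3, coprime `|a i0| n /\ (1 < size (g i0))%N.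
  have [U1_gt1|U1_le1] := ltnP 1 (size U1).
    by exists (Ordinal (isT : 1 < 3)%N); split=> //; apply: cop_pn.
  have [U2_gt1|U2_le1] := ltnP 1 (size U2).
    by exists (Ordinal (isT : 2 < 3)%N); split=> //; rewrite /= coprime1n.
  case/negP: neqL; apply/eqP/fsetP => z; rewrite defL1 defL2.
  have no_root (h : {poly F}) : h != 0 -> (size h <= 1)%N -> root (map_poly iota h) z = false.
    move=> h0 /size1_polyC hC; rewrite hC map_polyC rootC fmorph_eq0.
    by apply/negbTE; apply: contraNneq h0 => hc0; rewrite hC hc0.
  rewrite -S1E rmorphXn rootE hornerE expf_eq0 expn_gt0 p_gt0 /= -rootE.
  by rewrite S1U R2U !rmorphM /= !rootM (no_root U1) ?(no_root U2).
have N10 : -1 != 0 :> F by rewrite oppr_eq0 oner_eq0.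
split.
  have [Gn [genus_Gn]] := kummer_genus cardF' genE N10 sep_g yE cop0 g0 eqC.
  rewrite !big_ord_recl !big_ord0 /g /a /= => GnE.
  exists Gn => //.
  have -> : p%:R ^+ (r - s) = (p ^ (r - s))%:Z%:~R :> rat by rewrite -pmulrn natrX.
  have -> : p%:R ^+ t = (p ^ t)%:Z%:~R :> rat by rewrite -pmulrn natrX.
  have -> : p%:R ^+ m = (p ^ m)%:Z%:~R :> rat by rewrite -pmulrn natrX.
  have -> : p%:R ^+ gcdn m s = (p ^ gcdn m s)%:Z%:~R :> rat by rewrite -pmulrn natrX.
  have -> : p%:R ^+ gcdn m (r - t) = (p ^ gcdn m (r - t))%:Z%:~R :> rat.
    by rewrite -pmulrn natrX.
  have -> : delta%:R = delta%:Z%:~R :> rat by rewrite -pmulrn.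
  apply: genus_arith; rewrite GnE.
  have -> : ((p ^ s)%:Z - 1) * (size G).-1%:Z +
      ((p ^ s)%:Z * (size U1).-1%:Z + (-1 * (size U2).-1%:Z + 0)) =
      (p ^ t * (p ^ (r - t) - 1))%N%:Z.
    rewrite -deltaE; apply: (kummer_degree_arith szU1 szU2); last by rewrite expn_gt0 p_gt0.
    by rewrite -!expnD !subnKC // ltnW // (leq_ltn_trans t_les).
  have gcd_pn k j : gcdn (p ^ k * (p ^ j - 1)) n = (p ^ gcdn m j - 1)%N.
    by rewrite gcdnC Gauss_gcdr 1?coprime_sym // gcdn_expn_pred.
  rewrite absz_nat gcd_pn.
  have -> : (p ^ s)%:Z - 1 = (p ^ 0 * (p ^ s - 1))%N%:Z.
    by rewrite expn0 mul1n subzn // expn_gt0 p_gt0.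
  rewrite !absz_nat gcd_pn (eqP (cop_pn s)) gcd1n.
  have predE k : (p ^ k - 1)%N%:Z = (p ^ k)%:Z - 1 by rewrite subzn // expn_gt0 p_gt0.
  by rewrite /n !predE -deltaE -szU1 -szU2 !PoszD; ring.
(* For u in L, R_2(u) = 0 forces R_1(u) = 0; so at most delta elements of L are zeros of R_2, and at
   the others f(u) = 1. *)
pose A := [set u : F | (u : pPrimeCharType charFp) \in L].
pose Z := [set u : F | R2.[u] == 0].
have rootA u : u \in A -> (R1 + R2).[u] = 0.
  by rewrite inE => uL; rewrite -defR horner_prod (bigD1 u) //= hornerXsubC subrr mul0r.
have cardA : #|A| = (p ^ r)%N.
  have := congr1 (fun g : {poly F} => size g) defR; rewrite -big_filter size_prod_XsubC.
  have szR1 : size R1 = (p ^ r).+1.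
    rewrite -S1E (polySpred (expf_neq0 _ S10)) size_exp szS1 /=.
    by rewrite -expnD addnC subnKC // ltnW.
  rewrite size_polyDl szR1 ?szR2; first by move=> -[<-]; rewrite cardsE cardE.
  by rewrite ltnS ltn_exp2l // (leq_ltn_trans t_les).
have cardAZ : (#|A :&: Z| <= delta)%N.
  rewrite def_delta cardE -(size_map iota); apply: uniq_leq_size.
    by rewrite map_inj_uniq ?enum_uniq //; apply: fmorph_inj.
  move=> z /mapP[u]; rewrite mem_enum inE => /andP[/rootA Ru Zu] ->; rewrite inE in Zu.
  rewrite in_fsetI defL1 defL2 !mapf_root /= !rootE Zu andbT.
  by move/eqP: Ru; rewrite hornerD (eqP Zu) addr0.
have [|N ratN TN] := @rational_points_lower_bound _ _ y n (A :\: Z) cardF'.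
  move=> u z /setDP[uA uZ] z0; rewrite inE in uZ.
  apply: (kummer_split cardF' genE N10 sep_g yE cop0 g0 eqC) => // P Pu.
  have x_ge0 := ord_X_ge0 Pu.
  have R2P : ord P (polyE E R2) = 0.
    by apply: (ord_below_coprime (irredp_XsubC u)); rewrite ?dvdp_XsubCl.
  have /dvdpP[q RE] : ('X - u%:P) %| R1 + R2 by rewrite dvdp_XsubCl rootE rootA.
  (* f - 1 = - (R_1 + R_2) / R_2, whose numerator vanishes at u and whose denominator does not. *)
  have -> : y ^+ n - 1 = - (polyE E q * polyE E ('X - u%:P) / polyE E R2).
    rewrite -rmorphM -RE rmorphD eqC fraction_opp_div.
    by rewrite mulrDl divff ?polyE0 // opprD.
  apply: vgeN; rewrite -[1%R]addr0 -[X in X + 0]add0r; apply: vgeM; last first.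
    by right; rewrite ordV R2P oppr0.
  apply: vgeM; first exact: vge_polyE.
  by right; rewrite -gtz0_ge1.
exists N => //.
have -> : p%:R ^+ r - delta%:R = (p ^ r)%:Z - delta%:Z by rewrite -natrX !natz.
have -> : p%:R ^+ m - 1 = n%:Z by rewrite -natrX natz /n -subzn // expn_gt0 p_gt0.
rewrite natz; apply: leq_int_bound cardAZ TN _.
by rewrite cardsID cardA.
Qed.
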